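(* Let $R=R_0\oplus R_1\oplus R_2\oplus\cdots$ be a graded ring and $(R,\Lambda)$ a graded form ring (with respect to a fixed $\lambda$). Let $k$ be a positive integer that is a unit in $R_0$. Let $N=N_0+N_1+\cdots+N_r\in M_{2n}(R)$ be a nilpotent matrix, where $N_i\in M_{2n}(R_i)$, such that $\mathrm{I}+N\in\mathrm{GQ}^{\lambda}(2n,R,\Lambda)$, where $\mathrm{I}$ is the identity matrix. If $[\mathrm{I}+N]^k=[\mathrm{I}]$ in $\mathrm{K}_1\mathrm{GQ}^{\lambda}(R,\Lambda)$, then $[\mathrm{I}+N]=[\mathrm{I}+N_0]$ in $\mathrm{K}_1\mathrm{GQ}^{\lambda}(R,\Lambda)$.
   Context: Form rings: $R$ is an associative ring with $1$, with an involution $a\mapsto\overline a$ (an additive anti-automorphism with $\overline{\overline a}=a$), and $\lambda$ is a fixed element of the center of $R$ with $\lambda\overline\lambda=1$. Put $\Lambda_{\max}=\{a\in R: a=-\lambda\overline a\}$ and $\Lambda_{\min}=\{a-\lambda\overline a: a\in R\}$. A $\lambda$-form parameter is an additive subgroup $\Lambda$ with $\Lambda_{\min}\subseteq\Lambda\subseteq\Lambda_{\max}$ and $\overline x\Lambda x\subseteq\Lambda$ for all $x\in R$; the pair $(R,\Lambda)$ is called a form ring. Put $\overline\Lambda=\{\overline a:a\in\Lambda\}$. Graded form ring: the grading of $R$ is compatible with the form structure, i.e. $\overline{R_i}=R_i$ for all $i$, $\lambda\in R_0$, and $\Lambda=\bigoplus_i(\Lambda\cap R_i)$. (Then $\mathrm{I}+N\in\mathrm{GQ}^{\lambda}(2n,R,\Lambda)$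 implies $\mathrm{I}+N_0\in\mathrm{GQ}^{\lambda}(2n,R,\Lambda)$, so both classes are defined.) Matrices: for $a=(a_{ij})$ over $R$, $a^*=(\overline{a_{ji}})$. A matrix $\gamma\in M_n(R)$ is $\Lambda$-Hermitian if $\gamma=-\lambda\gamma^*$ and its diagonal entries lie in $\Lambda$; $\beta\in M_n(R)$ is $\overline\Lambda$-Hermitian if $\beta=-\overline\lambda\beta^*$ and its diagonal entries lie in $\overline\Lambda$. Groups: $\mathrm{GQ}^{\lambda}(2n,R,\Lambda)$ is the group of all $\sigma=\begin{pmatrix}a&b\\c&d\end{pmatrix}\in\mathrm{GL}_{2n}(R)$ ($n\times n$ blocks) with $\sigma^*\psi_n\sigma=\psi_n$, where $\psi_n=\begin{pmatrix}0&\mathrm{I}_n\\ \lambda\mathrm{I}_n&0\end{pmatrix}$, such that the diagonal entries of $a^*c$ and $b^*d$ lie in $\Lambda$. $\mathrm{EQ}^{\lambda}(2n,R,\Lambda)$ is the subgroup generated by the matrices $\begin{pmatrix}\varepsilon&0\\0&(\varepsilon^* )^{-1}\end{pmatrix}$ with $\varepsilon$ in the elementary group $\mathrm{E}_n(R)$ (generated by $\mathrm{I}_n+xe_{ij}$, $x\in R$, $i\ne j$), $\begin{pmatrix}\mathrm{I}_n&\beta\\0&\mathrm{I}_n\end{pmatrix}$ with $\beta$ $\overline\Lambda$-Hermitian, and $\begin{pmatrix}\mathrm{I}_n&0\\ \gamma&\mathrm{I}_n\end{pmatrix}$ with $\gamma$ $\Lambda$-Hermitian. Stabilization $\mathrm{GQ}^{\lambda}(2n,R,\Lambda)\to\mathrm{GQ}^{\lambda}(2n+2,R,\Lambda)$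 replaces $a,d$ by $\begin{pmatrix}a&0\\0&1\end{pmatrix},\begin{pmatrix}d&0\\0&1\end{pmatrix}$ and $b,c$ by $\begin{pmatrix}b&0\\0&0\end{pmatrix},\begin{pmatrix}c&0\\0&0\end{pmatrix}$. $\mathrm{GQ}^{\lambda}(R,\Lambda)$ and $\mathrm{EQ}^{\lambda}(R,\Lambda)$ denote the unions over $n$; $\mathrm{EQ}^{\lambda}(R,\Lambda)$ is the commutator subgroup of $\mathrm{GQ}^{\lambda}(R,\Lambda)$, and $\mathrm{K}_1\mathrm{GQ}^{\lambda}(R,\Lambda)=\mathrm{GQ}^{\lambda}(R,\Lambda)/\mathrm{EQ}^{\lambda}(R,\Lambda)$. The class of a matrix $\alpha\in\mathrm{GQ}^{\lambda}(R,\Lambda)$ is written $[\alpha]$. *)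

(* Defs.v *)
From mathcomp Require Import all_boot all_order all_algebra.

Set Implicit Arguments.
Unset Strict Implicit.
Unset Printing Implicit Defensive.

Import GRing.Theory.
Local Open Scope ring_scope.

Record is_involution (R : pzRingType) (bar : R -> R) : Prop := IsInvolution {
  bar_add : {morph bar : x y / x + y};
  bar_mul : forall x y, bar (x * y) = bar y * bar x;
  bar_bar : involutive bar }.

Definition bar_image (R : pzRingType) (bar : R -> R) (A : R -> Prop) : R -> Prop :=
  fun x => exists2 a, A a & x = bar a.

Definition additive_subgroup (R : pzRingType) (A : R -> Prop) : Prop :=
  A 0 /\ forall x y, A x -> A y -> A (x - y).

Definition Lambda_max (R : pzRingType) (bar : R -> R) (lam : R) : R -> Prop :=
  fun a => a = - (lam * bar a).

Definition Lambda_min (R : pzRingType) (bar : R -> R) (lam : R) : R -> Prop :=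
  fun x => exists a, x = a - lam * bar a.

Record is_form_ring (R : pzRingType) (bar : R -> R) (lam : R) (L : R -> Prop)
    : Prop := IsFormRing {
  form_bar : is_involution bar;
  form_lam_central : forall x, lam * x = x * lam;
  form_lam_unitary : lam * bar lam = 1;
  form_additive : additive_subgroup L;
  form_min : forall x, Lambda_min bar lam x -> L x;
  form_max : forall x, L x -> Lambda_max bar lam x;
  form_conj : forall x a, L a -> L (bar x * a * x) }.

(* [A] is the internal direct sum of the subgroups [B i], i = 0, 1, 2, ...    *)
Definition is_direct_sum (R : pzRingType) (A : R -> Prop) (B : nat -> R -> Prop)
    : Prop :=
  (forall x, A x <->
     exists m (f : nat -> R), (forall i, B i (f i)) /\ x = \sum_(i < m) f i) /\
  (forall m (f : nat -> R), (forall i, B i (f i)) ->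
     \sum_(i < m) f i = 0 -> forall i, (i < m)%N -> f i = 0).

Record is_graded_ring (R : pzRingType) (G : nat -> R -> Prop) : Prop :=
  IsGradedRing {
  grad_additive : forall i, additive_subgroup (G i);
  grad_one : G 0%N 1;
  grad_mul : forall i j x y, G i x -> G j y -> G (i + j)%N (x * y);
  grad_sum : is_direct_sum (fun _ => True) G }.

Record is_graded_form_ring (R : pzRingType) (bar : R -> R) (lam : R)
    (L : R -> Prop) (G : nat -> R -> Prop) : Prop := IsGradedFormRing {
  gform_form : is_form_ring bar lam L;
  gform_graded : is_graded_ring G;
  gform_bar : forall i x, bar_image bar (G i) x <-> G i x;
  gform_lam : G 0%N lam;
  gform_L : is_direct_sum L (fun i x => L x /\ G i x) }.

Definition starmx (R : pzRingType) (bar : R -> R) (m n : nat)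
    (A : 'M[R]_(m, n)) : 'M[R]_(n, m) := map_mx bar A^T.

(* MathComp's [unitmx] and [invmx] need a commutative ring of coefficients.   *)
Definition inverse_mx (R : pzRingType) (n : nat) (A B : 'M[R]_n) : Prop :=
  A *m B = 1%:M /\ B *m A = 1%:M.

Definition inGL (R : pzRingType) (n : nat) (A : 'M[R]_n) : Prop :=
  exists B, inverse_mx A B.

Inductive gen_subgroup (R : pzRingType) (n : nat) (S : 'M[R]_n -> Prop)
    : 'M[R]_n -> Prop :=
  | gen_base A : S A -> gen_subgroup S A
  | gen_one : gen_subgroup S 1%:M
  | gen_mul A B : gen_subgroup S A -> gen_subgroup S B -> gen_subgroup S (A *m B)
  | gen_inv A B : gen_subgroup S A -> inverse_mx A B -> gen_subgroup S B.

Definition elementary (R : pzRingType) (n : nat) : 'M[R]_n -> Prop :=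
  gen_subgroup (fun A =>
    exists (i j : 'I_n) (x : R), i != j /\ A = 1%:M + x *: delta_mx i j).

Definition Lambda_hermitian (R : pzRingType) (bar : R -> R) (lam : R)
    (L : R -> Prop) (n : nat) (A : 'M[R]_n) : Prop :=
  A = - (lam *: starmx bar A) /\ forall i, L (A i i).

Definition psi (R : pzRingType) (lam : R) (n : nat) : 'M[R]_(n + n) :=
  block_mx 0 1%:M lam%:M 0.

Definition GQ (R : pzRingType) (bar : R -> R) (lam : R) (L : R -> Prop)
    (n : nat) (s : 'M[R]_(n + n)) : Prop :=
  [/\ inGL s,
      starmx bar s *m psi lam n *m s = psi lam n,
      forall i, L ((starmx bar (ulsubmx s) *m dlsubmx s) i i)
    & forall i, L ((starmx bar (ursubmx s) *m drsubmx s) i i)].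

Inductive EQ_generator (R : pzRingType) (bar : R -> R) (lam : R) (L : R -> Prop)
    (n : nat) : 'M[R]_(n + n) -> Prop :=
  | EQ_diag (e f : 'M[R]_n) : elementary e -> inverse_mx (starmx bar e) f ->
      EQ_generator bar lam L (block_mx e 0 0 f)
  | EQ_upper (b : 'M[R]_n) : Lambda_hermitian bar (bar lam) (bar_image bar L) b ->
      EQ_generator bar lam L (block_mx 1%:M b 0 1%:M)
  | EQ_lower (c : 'M[R]_n) : Lambda_hermitian bar lam L c ->
      EQ_generator bar lam L (block_mx 1%:M 0 c 1%:M).

Definition EQ (R : pzRingType) (bar : R -> R) (lam : R) (L : R -> Prop) (n : nat)
    : 'M[R]_(n + n) -> Prop :=
  gen_subgroup (@EQ_generator R bar lam L n).

(* The m-fold stabilization GQ(2n) -> GQ(2(n + m)), written in one step.      *)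
Definition stab (R : pzRingType) (n m : nat) (s : 'M[R]_(n + n))
    : 'M[R]_((n + m) + (n + m)) :=
  block_mx (block_mx (ulsubmx s) 0 0 1%:M) (block_mx (ursubmx s) 0 0 0)
           (block_mx (dlsubmx s) 0 0 0) (block_mx (drsubmx s) 0 0 1%:M).

(* [s], seen in the union over all sizes, belongs to the stable group         *)
(* EQ(R, L) = \bigcup_m EQ(2m, R, L).                                         *)
Definition EQ_stable (R : pzRingType) (bar : R -> R) (lam : R) (L : R -> Prop)
    (n : nat) (s : 'M[R]_(n + n)) : Prop :=
  exists m, EQ bar lam L (stab m s).

(* [s] = [t] in K_1 GQ(R, L) = GQ(R, L) / EQ(R, L), that is t lies in the     *)
(* coset s EQ(R, L). Powers in the quotient group are those of                *)
(* representatives: [s]^k is the class of s ^+ k.                             *)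
Definition K1GQ_eq (R : pzRingType) (bar : R -> R) (lam : R) (L : R -> Prop)
    (n : nat) (s t : 'M[R]_(n + n)) : Prop :=
  [/\ GQ bar lam L s, GQ bar lam L t
    & exists2 e, EQ_stable bar lam L e & t = s *m e].

(* Main.v *)
(* For an isometry t of a nonsingular quadratic form f, let iota_f(t) be the class
   in K_1 GQ of t + 1 acting on the hyperbolic form f + (-f), and let H(x) be the
   class of diag(x, x^{-*}). If f is itself the standard hyperbolic form, then
   iota_f(s) is the class of s.

   1. If t is unipotent, 16 iota(t) = 8 H(t), where t is viewed as a 1 x 1 matrix
   over the form ring A = M_{2n}(R). Indeed the lattices <-1> + Z^8 and <-1> + E_8
   are isometric, so 8 iota_f(t) is the class of t on f times E_8; this form is even,
   so the isometry there has an invertible upper left block b and its class is H(b).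
   As b is the product of t with the adjoint of b, and the adjoint of b has class
   -H(b), one gets 2 H(b) = 8 H(t).

   2. If t^k is elementary and k is invertible in the graded ring, then
   H(t) = H(t_0). With X, Y the left and right shifts of A^m, take a root u^k = 1 - X
   and compare the images of t under x |-> sum x_i Y^i and x |-> sum x_i B^i, where B
   is u^{-1} Y u: both are killed by k, while the class of their quotient,
   multiplicative in u, becomes H(t_0^{-1} t) when u is replaced by u^k.

   3. Hence 16 [s] = 16 [s_0] as soon as s^k is stably elementary, after returning
   from matrices over A to matrices over R. If k is odd this suffices, since 16 is
   prime to k. If k is even, 2 is invertible and one applies it to the unipotent
   16-th root of s, which is again unitary. *)

Require Import Defs.
From mathcomp Require Import all_boot all_order all_algebra.
From mathcomp Require Import perm mxtens.
From Stdlib Require Import IndefiniteDescription.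

Set Implicit Arguments.
Unset Strict Implicit.
Unset Printing Implicit Defensive.

Import GRing.Theory.
Local Open Scope ring_scope.

(** The obstacle is the involution. The graded argument substitutes shift matrices for the degree
    variable, and this evaluation does not respect [bar]. It can therefore only speak of hyperbolic
    classes H(x), which make sense for every invertible x, and a multiple of iota(t) has to be
    turned into such a class beforehand. In a hyperbolic frame of f + (-f) the upper left block of t
    + 1 is 1 + E(t - 1), where E = p^{-1} f and p is the polar form of f. As E need not commute with
    t, nilpotency of t - 1 does not make this block invertible. Tensoring with an even unimodular
    lattice of Gram matrix h + h^T replaces E by the integer matrix (h + h^T)^{-1} h, which commutes
    with t. The signature of such a lattice is divisible by 8, and E_8 attains 8: this is where the
    constants 8 and 16 come from. Working over A = M_{2n}(R) makes t a ring element, which can be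
    evaluated. What evaluation transports of the hypothesis is that t^k is a product of ordinary
    elementary matrices over R: such a product becomes stably elementary over A. *)

Lemma gen_subgroup_morph (R Q : pzRingType) n m (S : 'M[R]_n -> Prop)
    (S' : 'M[Q]_m -> Prop) (f : 'M[R]_n -> 'M[Q]_m) A :
  f 1%:M = 1%:M -> {morph f : B C / B *m C} ->
  (forall B, S B -> gen_subgroup S' (f B)) ->
  gen_subgroup S A -> gen_subgroup S' (f A).
Proof.
move=> f1 fM h; elim=> [B /h //||B C _ hB _ hC|B C _ hB [i j]].
- by rewrite f1; exact: gen_one.
- by rewrite fM; exact: gen_mul.
- by apply: (gen_inv hB); split; rewrite -fM ?i ?j f1.
Qed.

(** * Inverses, generated subgroups and elementary matrices *)

Section InverseMatrices.
Variable R : pzRingType.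

Lemma inverse_mx1 n : inverse_mx (1%:M : 'M[R]_n) 1%:M.
Proof. by split; rewrite mulmx1. Qed.

Lemma inverse_mxC n (A B : 'M[R]_n) : inverse_mx A B -> inverse_mx B A.
Proof. by case. Qed.

Lemma inverse_mxM n (A A' B B' : 'M[R]_n) :
  inverse_mx A A' -> inverse_mx B B' -> inverse_mx (A *m B) (B' *m A').
Proof.
move=> [h1 h2] [h3 h4]; split.
  by rewrite -mulmxA [B *m _]mulmxA h3 mul1mx.
by rewrite -mulmxA [A' *m _]mulmxA h2 mul1mx.
Qed.

Lemma inverse_mx_uniq n (A B C : 'M[R]_n) :
  inverse_mx A B -> inverse_mx A C -> B = C.
Proof. by move=> [_ h] [h' _]; rewrite -[B]mulmx1 -h' mulmxA h mul1mx. Qed.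

Lemma inverse_mx_block n m (A A' : 'M[R]_n) (B B' : 'M[R]_m) :
  inverse_mx A A' -> inverse_mx B B' ->
  inverse_mx (block_mx A 0 0 B) (block_mx A' 0 0 B').
Proof.
move=> [h1 h2] [h3 h4]; split;
by rewrite mulmx_block !mulmx0 !mul0mx !addr0 !add0r ?h1 ?h2 ?h3 ?h4 -scalar_mx_block.
Qed.

Lemma inverse_mx_upper n m (B : 'M[R]_(n, m)) :
  inverse_mx (block_mx 1%:M B 0 1%:M) (block_mx 1%:M (- B) 0 1%:M).
Proof.
split; by rewrite mulmx_block !mulmx0 !mul0mx !mulmx1 !mul1mx !addr0 !add0r
  ?addNr ?subrr -scalar_mx_block.
Qed.

Lemma inverse_mx_lower n m (B : 'M[R]_(m, n)) :
  inverse_mx (block_mx 1%:M 0 B 1%:M) (block_mx 1%:M 0 (- B) 1%:M).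
Proof.
split; by rewrite mulmx_block !mulmx0 !mul0mx !mulmx1 !mul1mx !addr0 !add0r
  ?addNr ?subrr -scalar_mx_block.
Qed.

Lemma gen_subgroupS n (S S' : 'M[R]_n -> Prop) A :
  (forall B, S B -> gen_subgroup S' B) -> gen_subgroup S A -> gen_subgroup S' A.
Proof.
move=> h; elim=> [B /h //||B C _ hB _ hC|B C _ hB i]; first exact: gen_one.
  exact: gen_mul.
exact: gen_inv hB i.
Qed.

Lemma gen_subgroup_inverse n (S : 'M[R]_n -> Prop) A :
  (forall B, S B -> inGL B) -> gen_subgroup S A -> inGL A.
Proof.
move=> h; elim=> [B /h //||B C _ [B' hB] _ [C' hC]|B C _ hB i].
- by exists 1%:M; exact: inverse_mx1.
- by exists (C' *m B'); exact: inverse_mxM.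
- by exists B; exact: inverse_mxC.
Qed.

Lemma delta_mx_mul0 n (x : R) (i j : 'I_n) : i != j ->
  (x *: delta_mx i j : 'M[R]_n) *m (x *: delta_mx i j) = 0.
Proof.
move=> ij; apply/matrixP=> a b; rewrite !mxE big1 // => c _; rewrite !mxE.
case: (c =P i) => [->|_]; last by rewrite mulr0 mulr0.
by rewrite (negbTE ij) andbF mulr0 mul0r.
Qed.

Lemma mul_delta_delta n (x y : R) (i j k : 'I_n) :
  (x *: delta_mx i j : 'M[R]_n) *m (y *: delta_mx j k) = (x * y) *: delta_mx i k.
Proof.
apply/matrixP=> a b; rewrite !mxE (bigD1 j) //= big1 ?addr0 => [|c cj].
  rewrite !mxE !eqxx andbT /=.
  by case: (a == i); case: (b == k); rewrite /= ?mulr0 ?mulr1 ?mul0r.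
by rewrite !mxE (negbTE cj) andbF mulr0 mul0r.
Qed.

Lemma mul_delta_delta0 n (x y : R) (i j k l : 'I_n) : j != k ->
  (x *: delta_mx i j : 'M[R]_n) *m (y *: delta_mx k l) = 0.
Proof.
move=> jk; apply/matrixP=> a b; rewrite !mxE big1 // => c _; rewrite !mxE.
case: (c =P j) => [->|_]; last by rewrite andbF mulr0 mul0r.
by rewrite (negbTE jk) /= !mulr0.
Qed.

Lemma inverse_mx_elementary n (i j : 'I_n) (x : R) : i != j ->
  inverse_mx (1%:M + x *: delta_mx i j) (1%:M - x *: delta_mx i j).
Proof.
move=> ij; set X := x *: _; have X2 : X *m X = 0 by exact: delta_mx_mul0.
split; first by rewrite mulmxDl mul1mx mulmxBr mulmx1 X2 subr0 addrNK.
by rewrite mulmxBl mul1mx mulmxDr mulmx1 X2 addr0 addrK.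
Qed.

Lemma elementary_inverse n (A : 'M[R]_n) : elementary A -> inGL A.
Proof.
apply: gen_subgroup_inverse => B [i [j [x [ij ->]]]].
by eexists; exact: inverse_mx_elementary.
Qed.

(* Entries of the off-diagonal block are inserted one at a time. *)
Lemma elementary_upper n m (B : 'M[R]_(n, m)) :
  elementary (block_mx 1%:M B 0 1%:M).
Proof.
pose P (B : 'M[R]_(n, m)) := elementary (block_mx 1%:M B 0 1%:M).
have PD : forall B C, P B -> P C -> P (B + C).
  move=> C D hC hD; rewrite /P; suff -> : block_mx 1%:M (C + D) 0 1%:M =
    block_mx 1%:M C 0 1%:M *m block_mx 1%:M D 0 1%:M :> 'M[R]_(n + m).
    exact: gen_mul.
  by rewrite mulmx_block !mulmx0 !mul0mx !mulmx1 !mul1mx !addr0 !add0r addrC.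
have P0 : P 0 by rewrite /P -scalar_mx_block; exact: gen_one.
rewrite -/(P B) [B]matrix_sum_delta.
apply: (big_ind P) => // i _; apply: (big_ind P) => // j _.
apply: gen_base; exists (lshift m i), (rshift n j), (B i j); split.
  by rewrite eq_lrshift.
apply/matrixP=> a b; rewrite !mxE.
by case: (split_ordP a) => a' ->; rewrite ?mxE; case: (split_ordP b) => b' ->;
  rewrite !(row_mxEl, row_mxEr, mxE, eq_shift) ?andbF ?mulr0 ?add0r ?addr0.
Qed.

Lemma elementary_lower n m (B : 'M[R]_(m, n)) :
  elementary (block_mx 1%:M 0 B 1%:M).
Proof.
pose P (B : 'M[R]_(m, n)) := elementary (block_mx 1%:M 0 B 1%:M).
have PD : forall B C, P B -> P C -> P (B + C).
  move=> C D hC hD; rewrite /P; suff -> : block_mx 1%:M 0 (C + D) 1%:M =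
    block_mx 1%:M 0 C 1%:M *m block_mx 1%:M 0 D 1%:M :> 'M[R]_(n + m).
    exact: gen_mul.
  by rewrite mulmx_block !mulmx0 !mul0mx !mulmx1 !mul1mx !addr0 !add0r.
have P0 : P 0 by rewrite /P -scalar_mx_block; exact: gen_one.
rewrite -/(P B) [B]matrix_sum_delta.
apply: (big_ind P) => // i _; apply: (big_ind P) => // j _.
apply: gen_base; exists (rshift n i), (lshift m j), (B i j); split.
  by rewrite eq_rlshift.
apply/matrixP=> a b; rewrite !mxE.
by case: (split_ordP a) => a' ->; rewrite ?mxE; case: (split_ordP b) => b' ->;
  rewrite !(row_mxEl, row_mxEr, mxE, eq_shift) ?andbF ?mulr0 ?add0r ?addr0.
Qed.

Lemma elementary_block_l n m (A : 'M[R]_n) :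
  elementary A -> elementary (block_mx A 0 0 1%:M : 'M_(n + m)).
Proof.
apply: (gen_subgroup_morph (f := fun A : 'M[R]_n => block_mx A 0 0 1%:M : 'M_(n + m))).
- by rewrite -scalar_mx_block.
- by move=> B C; rewrite mulmx_block !mulmx0 !mul0mx mulmx1 !addr0 add0r.
move=> B [i [j [x [ij ->]]]]; apply: gen_base.
exists (lshift m i), (lshift m j), x; split; first by rewrite (inj_eq (@lshift_inj _ _)).
apply/matrixP=> a b; rewrite !mxE.
by case: (split_ordP a) => a' ->; rewrite ?mxE; case: (split_ordP b) => b' ->;
  rewrite !(row_mxEl, row_mxEr, mxE, eq_shift) ?andbF ?mulr0 ?add0r ?addr0.
Qed.

Lemma elementary_block_r n m (A : 'M[R]_m) :
  elementary A -> elementary (block_mx 1%:M 0 0 A : 'M_(n + m)).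
Proof.
apply: (gen_subgroup_morph (f := fun A : 'M[R]_m => block_mx 1%:M 0 0 A : 'M_(n + m))).
- by rewrite -scalar_mx_block.
- by move=> B C; rewrite mulmx_block !mulmx0 !mul0mx mulmx1 !addr0 add0r.
move=> B [i [j [x [ij ->]]]]; apply: gen_base.
exists (rshift n i), (rshift n j), x; split; first by rewrite (inj_eq (@rshift_inj _ _)).
apply/matrixP=> a b; rewrite !mxE.
by case: (split_ordP a) => a' ->; rewrite ?mxE; case: (split_ordP b) => b' ->;
  rewrite !(row_mxEl, row_mxEr, mxE, eq_shift) ?andbF ?mulr0 ?add0r ?addr0.
Qed.

(** The right side is the commutator of the two unipotent blocks; [B *m A = 0] kills every term
    outside the upper left corner. With [A *m B] equal to a multiple of a matrix unit this presents
    an elementary matrix as a commutator, first for the radicals and later for evaluations. *)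
Lemma commutator_block n m (A : 'M[R]_(n, m)) (B : 'M[R]_(m, n)) : B *m A = 0 ->
  block_mx (1%:M + A *m B) 0 0 1%:M =
  (block_mx 1%:M A 0 1%:M *m block_mx 1%:M 0 B 1%:M) *m
  (block_mx 1%:M (- A) 0 1%:M *m block_mx 1%:M 0 (- B) 1%:M) :> 'M_(n + m).
Proof.
move=> BA; rewrite !mulmx_block.
rewrite !(mulmx0, mul0mx, mulmx1, mul1mx, add0r, addr0).
rewrite !(mulmxN, mulNmx, mulmxDr, mulmxDl, mul1mx, mulmx1, opprK) -!mulmxA.
have BAC p (C : 'M_(m, p)) : B *m (A *m C) = 0 by rewrite mulmxA BA mul0mx.
by rewrite !BAC BA !mulmx0 !(oppr0, addr0, add0r) addrK addNr subrr.
Qed.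

Lemma elementary_commutator n m (A : 'M[R]_(n, m)) (B : 'M[R]_(m, n)) :
  B *m A = 0 -> elementary (block_mx (1%:M + A *m B) 0 0 1%:M : 'M_(n + m)).
Proof.
move=> /commutator_block ->; apply: gen_mul; apply: gen_mul;
  by [apply: elementary_upper | apply: elementary_lower].
Qed.
End InverseMatrices.

(** * The conjugate transpose *)

Section Star.
Variables (R : pzRingType) (bar : R -> R).
Hypothesis barP : is_involution bar.
Local Notation st := (starmx bar).

Let barD x y : bar (x + y) = bar x + bar y := bar_add barP x y.
Let barM x y : bar (x * y) = bar y * bar x := bar_mul barP x y.
Let barK x : bar (bar x) = x := bar_bar barP x.

Lemma bar0 : bar 0 = 0.
Proof. by apply: (addrI (bar 0)); rewrite -barD !addr0. Qed.

Lemma barN x : bar (- x) = - bar x.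
Proof. by apply: (addrI (bar x)); rewrite -barD !subrr bar0. Qed.

Lemma bar1 : bar 1 = 1.
Proof. by rewrite -[LHS]mul1r -{1}[1]barK -barM mul1r barK. Qed.

Lemma bar_nat (b : bool) : bar b%:R = b%:R.
Proof. by case: b; rewrite ?bar1 ?bar0. Qed.

Lemma barB x y : bar (x - y) = bar x - bar y.
Proof. by rewrite barD barN. Qed.

Lemma bar_sum I (r : seq I) (P : pred I) F :
  bar (\sum_(i <- r | P i) F i) = \sum_(i <- r | P i) bar (F i).
Proof. exact: (big_morph bar barD bar0). Qed.

Lemma starD n m (A B : 'M[R]_(n, m)) : st (A + B) = st A + st B.
Proof. by apply/matrixP=> i j; rewrite !mxE barD. Qed.

Lemma starN n m (A : 'M[R]_(n, m)) : st (- A) = - st A.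
Proof. by apply/matrixP=> i j; rewrite !mxE barN. Qed.

Lemma starB n m (A B : 'M[R]_(n, m)) : st (A - B) = st A - st B.
Proof. by rewrite starD starN. Qed.

Lemma star0 n m : st (0 : 'M[R]_(n, m)) = 0.
Proof. by apply/matrixP=> i j; rewrite !mxE bar0. Qed.

Lemma star_scalar n (a : R) : st (a%:M : 'M[R]_n) = (bar a)%:M.
Proof.
apply/matrixP=> i j; rewrite !mxE eq_sym.
by case: eqP => _; rewrite ?mulr1n ?mulr0n ?bar0.
Qed.

Lemma star1 n : st (1%:M : 'M[R]_n) = 1%:M.
Proof. by rewrite star_scalar bar1. Qed.

Lemma starM n m p (A : 'M[R]_(n, m)) (B : 'M[R]_(m, p)) :
  st (A *m B) = st B *m st A.
Proof.
apply/matrixP=> i j; rewrite !mxE bar_sum; apply: eq_bigr => k _.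
by rewrite !mxE barM.
Qed.

Lemma starK n m (A : 'M[R]_(n, m)) : st (st A) = A.
Proof. by apply/matrixP=> i j; rewrite !mxE barK. Qed.

Lemma bar_central a : (forall x, a * x = x * a) -> forall x, bar a * x = x * bar a.
Proof. by move=> ac x; rewrite -{1}[x]barK -barM -ac barM barK. Qed.

Lemma starZ n m (a : R) (A : 'M[R]_(n, m)) : (forall x, a * x = x * a) ->
  st (a *: A) = bar a *: st A.
Proof.
by move=> ac; apply/matrixP=> i j; rewrite !mxE barM (bar_central ac).
Qed.

Lemma star_block n1 n2 m1 m2 (A : 'M[R]_(n1, m1)) (B : 'M_(n1, m2))
    (C : 'M_(n2, m1)) (D : 'M_(n2, m2)) :
  st (block_mx A B C D) = block_mx (st A) (st C) (st B) (st D).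
Proof. by rewrite /starmx tr_block_mx map_block_mx. Qed.

Lemma star_inverse n (A B : 'M[R]_n) : inverse_mx A B -> inverse_mx (st A) (st B).
Proof. by move=> [h1 h2]; split; rewrite -starM ?h1 ?h2 star1. Qed.

Lemma elementary_star n (A : 'M[R]_n) : elementary A -> elementary (st A).
Proof.
elim=> [B [i [j [x [ij ->]]]]||B C _ hB _ hC|B C _ hB i].
- apply: gen_base; exists j, i, (bar x); rewrite eq_sym; split => //.
  apply/matrixP=> a b; rewrite !mxE barD barM !bar_nat; congr (_%:R + _).
    by rewrite eq_sym.
  by rewrite andbC; case: (_ && _); rewrite ?mulr1 ?mulr0 ?mul1r ?mul0r.
- by rewrite star1; exact: gen_one.
- by rewrite starM; exact: gen_mul.
- exact: (gen_inv hB (star_inverse i)).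
Qed.
End Star.

(* Half of the hyperbolic form: [psi] is [hyp + lam *: hyp^*]. *)
Definition hyp (R : pzRingType) n : 'M[R]_(n + n) := block_mx 0 1%:M 0 0.

(** * Form parameters, isometries of quadratic forms and the group [GQ] *)

Section FormRing.
Variables (R : pzRingType) (bar : R -> R) (lam : R) (L : R -> Prop).
Hypothesis FR : is_form_ring bar lam L.
Local Notation st := (starmx bar).
Local Notation LH := (Lambda_hermitian bar lam L).
Local Notation GQ := (GQ bar lam L).

Let barP : is_involution bar := form_bar FR.
Let lamC : forall x, lam * x = x * lam := form_lam_central FR.

Lemma lam_bar : lam * bar lam = 1. Proof. exact: form_lam_unitary FR. Qed.
Lemma bar_lam : bar lam * lam = 1. Proof. by rewrite -lamC lam_bar. Qed.

Lemma bar_lamC x : bar lam * x = x * bar lam.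
Proof. exact: (bar_central barP lamC). Qed.

Lemma mulmxZr n m p (a : R) (A : 'M_(n, m)) (B : 'M_(m, p)) :
  (forall x, a * x = x * a) -> A *m (a *: B) = a *: (A *m B).
Proof.
move=> ac; apply/matrixP=> i j; rewrite !mxE big_distrr /=; apply: eq_bigr => k _.
by rewrite !mxE !mulrA ac.
Qed.

Lemma formpar0 : L 0. Proof. by case: (form_additive FR). Qed.
Lemma formparB x y : L x -> L y -> L (x - y).
Proof. by case: (form_additive FR) => _; apply. Qed.
Lemma formparN x : L x -> L (- x).
Proof. by move=> h; rewrite -sub0r; apply: formparB h; exact: formpar0. Qed.
Lemma formparD x y : L x -> L y -> L (x + y).
Proof. by move=> hx hy; rewrite -[y]opprK; apply: formparB (formparN hy). Qed.
Lemma formpar_sum I (r : seq I) (P : pred I) F :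
  (forall i, P i -> L (F i)) -> L (\sum_(i <- r | P i) F i).
Proof. by apply: big_ind; [exact: formpar0 | exact: formparD]. Qed.
Lemma formpar_trace a : L (a - lam * bar a).
Proof. by apply: (form_min FR); exists a. Qed.

Lemma LH0 n : LH (0 : 'M_n).
Proof.
split=> [|i]; last by rewrite mxE; exact: formpar0.
by rewrite (star0 barP) scaler0 oppr0.
Qed.

Lemma LHD n (A B : 'M_n) : LH A -> LH B -> LH (A + B).
Proof.
move=> [hA dA] [hB dB]; split=> [|i]; last by rewrite mxE; exact: formparD.
by rewrite (starD barP) scalerDr opprD -hA -hB.
Qed.

Lemma LHN n (A : 'M_n) : LH A -> LH (- A).
Proof.
move=> [hA dA]; split=> [|i]; last by rewrite mxE; exact: formparN.
by rewrite (starN barP) scalerN {1}hA.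
Qed.

Lemma LHB n (A B : 'M_n) : LH A -> LH B -> LH (A - B).
Proof. by move=> hA hB; apply: LHD hA (LHN hB). Qed.

Lemma starZlam n m (A : 'M_(n, m)) : st (lam *: A) = bar lam *: st A.
Proof. exact: (starZ barP). Qed.

Lemma LH_trace n (A : 'M_n) : LH (A - lam *: st A).
Proof.
split=> [|i]; last by rewrite !mxE; exact: formpar_trace.
by rewrite (starB barP) starZlam (starK barP) scalerBr scalerA lam_bar scale1r opprB.
Qed.

(* A Lambda-Hermitian matrix is a Lambda-diagonal one plus [U - lam U^*], with
   [U] strictly upper triangular; both parts are stable under congruence. *)
Lemma LH_conj n p (C : 'M_n) (Y : 'M_(n, p)) : LH C -> LH (st Y *m C *m Y).
Proof.
move=> [hC dC].
pose U : 'M_n := \matrix_(i, j) if (i < j)%N then C i j else 0.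
pose D : 'M_n := \matrix_(i, j) if i == j then C i j else 0.
have -> : C = D + (U - lam *: st U).
  apply/matrixP=> i j; rewrite {1}hC !mxE.
  have hij : - (lam * bar (C j i)) = C i j by rewrite [in RHS]hC !mxE.
  rewrite hij -val_eqE /=; case: ltngtP => [h|h|/val_inj h] /=.
  - by rewrite (bar0 barP) mulr0 subr0 add0r.
  - by rewrite sub0r add0r hij.
  - by rewrite (bar0 barP) mulr0 subr0 addr0.
rewrite mulmxDr mulmxDl; apply: LHD; last first.
  have -> : st Y *m (U - lam *: st U) *m Y =
    st Y *m U *m Y - lam *: st (st Y *m U *m Y); last exact: LH_trace.
  rewrite !(starM barP) (starK barP) mulmxBr mulmxBl mulmxZr // -scalemxAl.
  by rewrite !mulmxA.
split=> [|i].
  have hD : D = - (lam *: st D).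
    apply/matrixP=> i j; rewrite {1}/D mxE {1}hC !mxE eq_sym.
    by case: (j =P i) => // _; rewrite (bar0 barP) mulr0 oppr0.
  rewrite !(starM barP) (starK barP) {1}hD.
  by rewrite mulmxN mulNmx mulmxZr // -scalemxAl mulmxA.
rewrite mxE; apply: formpar_sum => j _; rewrite mxE (bigD1 j) //= big1 ?addr0.
  by rewrite !mxE eqxx; exact: form_conj FR _ _ _.
by move=> k kj; rewrite !mxE (negbTE kj) mulr0.
Qed.

Lemma psiE n : psi lam n = hyp R n + lam *: st (hyp R n).
Proof.
rewrite /psi /hyp star_block !(star0 barP) (star1 barP) scale_block_mx.
by rewrite !scaler0 add_block_mx !addr0 !add0r scalemx1.
Qed.

Lemma gram_polar n (s : 'M_(n + n)) (X := st s *m hyp R n *m s - hyp R n) :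
  X + lam *: st X = st s *m psi lam n *m s - psi lam n.
Proof.
rewrite /X psiE (starB barP) !(starM barP) (starK barP) mulmxDr mulmxDl.
by rewrite mulmxZr // -scalemxAl scalerBr mulmxA opprD addrACA.
Qed.

(** The diagonal of the Gram difference consists of the diagonals of [a^* c] and [b^* d], and by
    [gram_polar] its skew symmetry says that [psi] is preserved. All conditions thus become
    membership in the Lambda-Hermitian matrices, which are closed under sums and congruence;
    products and inverses are then immediate. *)
Lemma GQP n (s : 'M_(n + n)) :
  GQ s <-> inGL s /\ LH (st s *m hyp R n *m s - hyp R n).
Proof.
have EX := gram_polar s.
set X := _ - hyp R n in EX *.
have EXb : X = block_mx (st (ulsubmx s) *m dlsubmx s) (st (ulsubmx s) *m drsubmx s - 1%:M)
                     (st (ursubmx s) *m dlsubmx s) (st (ursubmx s) *m drsubmx s).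
  rewrite /X -{1 2}[s]submxK /hyp star_block !mulmx_block.
  by rewrite !(mulmx0, mul0mx, mulmx1, mul1mx, addr0, add0r) opp_block_mx add_block_mx !oppr0 !addr0.
have hd i : X (lshift n i) (lshift n i) = (st (ulsubmx s) *m dlsubmx s) i i.
  by rewrite EXb block_mxEul.
have hd' i : X (rshift n i) (rshift n i) = (st (ursubmx s) *m drsubmx s) i i.
  by rewrite EXb block_mxEdr.
have EX0 : X = - (lam *: st X) <-> st s *m psi lam n *m s = psi lam n.
  split=> [h|h].
    by apply/eqP; rewrite -subr_eq0 -EX {1}h addNr.
  by apply/eqP; rewrite -addr_eq0 EX h subrr.
split=> [[hs hp h1 h2]|[hs [h d]]]; split=> //.
- split; first exact/EX0.
  by move=> i; case: (split_ordP i) => j ->; rewrite ?hd ?hd'.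
- exact/EX0.
- by move=> i; rewrite -hd.
- by move=> i; rewrite -hd'.
Qed.

Lemma GQ1 n : GQ (1%:M : 'M_(n + n)).
Proof.
apply/GQP; split; first by exists 1%:M; exact: inverse_mx1.
by rewrite (star1 barP) mul1mx mulmx1 subrr; exact: LH0.
Qed.

(** A quadratic form is a matrix modulo Lambda-Hermitian matrices, so an isometry needs to preserve
    it only up to these. *)
Definition form_isometry n m (f : 'M[R]_n) (f' : 'M[R]_m) (g : 'M[R]_(n, m)) :=
  LH (st g *m f *m g - f').

Lemma isometryM n m p (f : 'M_n) (f' : 'M_m) (f'' : 'M_p) (g : 'M_(n, m)) (h : 'M_(m, p)) :
  form_isometry f f' g -> form_isometry f' f'' h -> form_isometry f f'' (g *m h).
Proof.
rewrite /form_isometry => hg hh.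
have -> : st (g *m h) *m f *m (g *m h) - f'' =
   st h *m (st g *m f *m g - f') *m h + (st h *m f' *m h - f'').
  by rewrite mulmxBr mulmxBl (starM barP) !mulmxA addrA addrNK.
by apply: LHD => //; exact: LH_conj.
Qed.

Lemma isometryV n (f f' g g' : 'M_n) :
  inverse_mx g g' -> form_isometry f f' g -> form_isometry f' f g'.
Proof.
move=> [h1 h2] /(LH_conj g') h; rewrite /form_isometry.
have -> : st g' *m f' *m g' - f = - (st g' *m (st g *m f *m g - f') *m g').
  rewrite mulmxBr mulmxBl opprB; congr (_ - _).
  by rewrite !mulmxA -(starM barP) h1 (star1 barP) mul1mx -mulmxA h1 mulmx1.
exact: LHN.
Qed.

Lemma GQ_isometry n (s : 'M_(n + n)) :
  GQ s <-> inGL s /\ form_isometry (hyp R n) (hyp R n) s.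
Proof. exact: GQP. Qed.

Lemma GQM n (s t : 'M_(n + n)) : GQ s -> GQ t -> GQ (s *m t).
Proof.
move=> /GQP [[s' is_] hs] /GQP [[t' it] ht]; apply/GQP; split.
  by exists (t' *m s'); exact: inverse_mxM.
exact: isometryM hs ht.
Qed.

Lemma GQV n (s t : 'M_(n + n)) : GQ s -> inverse_mx s t -> GQ t.
Proof.
move=> /GQP [_ hs] i; apply/GQP; split; first by exists s; exact: inverse_mxC.
exact: isometryV i hs.
Qed.

(* For [s] in [GQ], [s^-1 = psi^-1 s^* psi]. *)
Definition gqinv n (s : 'M[R]_(n + n)) : 'M_(n + n) :=
  block_mx (st (drsubmx s)) (bar lam *: st (ursubmx s))
           (lam *: st (dlsubmx s)) (st (ulsubmx s)).

Definition psi_inv n : 'M[R]_(n + n) := block_mx 0 (bar lam)%:M 1%:M 0.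

Lemma psi_inverse n : inverse_mx (psi lam n) (psi_inv n).
Proof.
split; rewrite /psi /psi_inv mulmx_block !(mulmx0, mul0mx, mulmx1, mul1mx, addr0, add0r);
  by rewrite -scalar_mxM ?lam_bar ?bar_lam -scalar_mx_block.
Qed.

Lemma gqinvE n (s : 'M_(n + n)) : gqinv s = psi_inv n *m st s *m psi lam n.
Proof.
rewrite -{2}[s]submxK star_block !mulmx_block.
rewrite !(mulmx0, mul0mx, mulmx1, mul1mx, addr0, add0r) !mul_scalar_mx.
have mulmx_lam k l (A : 'M[R]_(k, l)) : A *m lam%:M = lam *: A.
  by rewrite -scalemx1 mulmxZr // mulmx1.
by rewrite !mulmx_lam scalerA lam_bar scale1r.
Qed.

Lemma gqinvM n (s t : 'M_(n + n)) : gqinv (s *m t) = gqinv t *m gqinv s.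
Proof.
rewrite !gqinvE (starM barP) !mulmxA -[_ *m psi _ _ *m psi_inv n]mulmxA.
by rewrite (psi_inverse n).1 mulmx1.
Qed.

Lemma gqinvD n (s t : 'M_(n + n)) : gqinv (s + t) = gqinv s + gqinv t.
Proof. by rewrite !gqinvE (starD barP) mulmxDr mulmxDl. Qed.

Lemma gqinv1 n : gqinv (1%:M : 'M_(n + n)) = 1%:M.
Proof. by rewrite gqinvE (star1 barP) mulmx1 (psi_inverse n).2. Qed.

Lemma gqinvP n (s : 'M_(n + n)) : GQ s -> inverse_mx s (gqinv s).
Proof.
case=> [[s' [h1 h2]] hp _ _].
have gs : gqinv s *m s = 1%:M.
  by rewrite gqinvE -!mulmxA [st s *m _]mulmxA hp (psi_inverse n).2.
split=> //; have <- : s' = gqinv s; last by [].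
by rewrite -[RHS]mulmx1 -h1 mulmxA gs mul1mx.
Qed.

Lemma GQ_gqinv n (s : 'M_(n + n)) : GQ s -> GQ (gqinv s).
Proof. by move=> h; apply: (GQV h); exact: gqinvP. Qed.
End FormRing.

(** * Hyperbolic and triangular elements of [GQ] *)

Section Elementary.
Variables (R : pzRingType) (bar : R -> R) (lam : R) (L : R -> Prop).
Hypothesis FR : is_form_ring bar lam L.
Local Notation st := (starmx bar).
Local Notation LH := (Lambda_hermitian bar lam L).
Local Notation GQ := (GQ bar lam L).
Local Notation EQ := (@EQ R bar lam L _).

Let barP : is_involution bar := form_bar FR.

(** The hyperbolic matrix H(x), with the inverse [x'] of [x] carried as an argument; in products the
    second components multiply in reverse order. *)
Definition hypmx n (x x' : 'M[R]_n) : 'M[R]_(n + n) := block_mx x 0 0 (st x').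

Lemma hypmxE n (x x' : 'M[R]_n) : hypmx x x' = block_mx x 0 0 (st x').
Proof. by []. Qed.

Lemma hypmxM n (x x' y y' : 'M_n) :
  hypmx x x' *m hypmx y y' = hypmx (x *m y) (y' *m x').
Proof.
by rewrite mulmx_block !(mulmx0, mul0mx, addr0, add0r) -(starM barP).
Qed.

Lemma hypmx1 n : hypmx 1%:M 1%:M = 1%:M :> 'M_(n + n).
Proof. by rewrite /hypmx (star1 barP) -scalar_mx_block. Qed.

Lemma hypmx_inverse n (x x' : 'M_n) :
  inverse_mx x x' -> inverse_mx (hypmx x x') (hypmx x' x).
Proof. by move=> [h h']; split; rewrite hypmxM ?h ?h' hypmx1. Qed.

Lemma block_gram n (a b c d : 'M_n) (s := block_mx a b c d) :
  st s *m hyp R n *m s - hyp R n =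
  block_mx (st a *m c) (st a *m d - 1%:M) (st b *m c) (st b *m d).
Proof.
rewrite /s /hyp star_block !mulmx_block.
by rewrite !(mulmx0, mul0mx, mulmx1, mul1mx, addr0, add0r) opp_block_mx add_block_mx
  !oppr0 !addr0.
Qed.

Lemma LH_block n m (A : 'M_n) (B : 'M_(n, m)) C D : LH (block_mx A B C D) ->
  [/\ LH A, B = - (lam *: st C) & LH D].
Proof.
case; rewrite star_block scale_block_mx opp_block_mx => /eq_block_mx [hA hB _ hD] d.
split=> //; split=> // i; first by have := d (lshift m i); rewrite block_mxEul.
by have := d (rshift n i); rewrite block_mxEdr.
Qed.

Lemma block_LH n m (A : 'M_n) (C : 'M_(m, n)) D : LH A -> LH D ->
  LH (block_mx A (- (lam *: st C)) C D).
Proof.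
move=> [hA dA] [hD dD]; split; last first.
  move=> i; case: (split_ordP i) => j ->; by rewrite ?block_mxEul ?block_mxEdr.
rewrite star_block scale_block_mx opp_block_mx -hA -hD; congr block_mx.
rewrite (starN barP) (starZlam FR) (starK barP) scalerN scalerA (lam_bar FR).
by rewrite scale1r opprK.
Qed.

Lemma GQ_hypmx n (x x' : 'M_n) : inverse_mx x x' -> GQ (hypmx x x').
Proof.
move=> i; apply/(GQP FR); split; first by exists (hypmx x' x); exact: hypmx_inverse.
rewrite block_gram (star0 barP) !(mulmx0, mul0mx) -(starM barP) i.2 (star1 barP) subrr.
have := block_LH 0 (LH0 FR n) (LH0 FR n).
by rewrite (star0 barP) scaler0 oppr0.
Qed.

Lemma EQ_hypmx n (x x' : 'M_n) : elementary x -> inverse_mx x x' -> EQ (hypmx x x').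
Proof. by move=> h i; apply/gen_base/EQ_diag => //; exact: star_inverse. Qed.

Lemma LH_starP n (b : 'M_n) :
  LH (st b) <-> Lambda_hermitian bar (bar lam) (bar_image bar L) b.
Proof.
split=> -[h d]; split=> [|i].
- have -> : st b = - (lam *: b) by rewrite h (starK barP).
  by rewrite scalerN scalerA (bar_lam FR) scale1r opprK.
- by exists (st b i i) => //; rewrite mxE mxE (bar_bar barP).
- rewrite (starK barP) {2}h scalerN scalerA (lam_bar FR) scale1r opprK //.
- by have [a La e] := d i; rewrite !mxE e (bar_bar barP).
Qed.

Lemma GQ_upperP n (b : 'M_n) : LH (st b) <-> GQ (block_mx 1%:M b 0 1%:M).
Proof.
have E : st (block_mx 1%:M b 0 1%:M) *m hyp R n *m block_mx 1%:M b 0 1%:M - hyp R n =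
    block_mx 0 0 0 (st b).
  by rewrite block_gram (star1 barP) !(mulmx0, mul1mx, mulmx1) subrr.
split=> [h|/(GQP FR) []]; last by rewrite E => _ /LH_block [].
apply/(GQP FR); split; first by eexists; exact: inverse_mx_upper.
rewrite E; have := block_LH 0 (LH0 FR n) h.
by rewrite (star0 barP) scaler0 oppr0.
Qed.

Lemma GQ_lowerP n (c : 'M_n) : LH c <-> GQ (block_mx 1%:M 0 c 1%:M).
Proof.
have E : st (block_mx 1%:M 0 c 1%:M) *m hyp R n *m block_mx 1%:M 0 c 1%:M - hyp R n =
    block_mx c 0 0 0.
  by rewrite block_gram (star1 barP) (star0 barP) !(mul0mx, mul1mx, mulmx1) subrr.
split=> [h|/(GQP FR) []]; last by rewrite E => _ /LH_block [].
apply/(GQP FR); split; first by eexists; exact: inverse_mx_lower.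
rewrite E; have := block_LH 0 h (LH0 FR n).
by rewrite (star0 barP) scaler0 oppr0.
Qed.

Lemma EQ_upper_GQ n (b : 'M_n) : GQ (block_mx 1%:M b 0 1%:M) -> EQ (block_mx 1%:M b 0 1%:M).
Proof. by move=> /GQ_upperP/LH_starP h; apply/gen_base/EQ_upper. Qed.

Lemma EQ_lower_GQ n (c : 'M_n) : GQ (block_mx 1%:M 0 c 1%:M) -> EQ (block_mx 1%:M 0 c 1%:M).
Proof. by move=> /GQ_lowerP h; apply/gen_base/EQ_lower. Qed.

Lemma EQ_GQ n (s : 'M_(n + n)) : EQ s -> GQ s.
Proof.
elim=> [B []||B C _ hB _ hC|B C _ hB i].
- move=> e f he hf; have [e' ie] := elementary_inverse he.
  rewrite (inverse_mx_uniq hf (star_inverse barP ie)); exact: GQ_hypmx.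
- by move=> b /LH_starP/GQ_upperP.
- by move=> c /GQ_lowerP.
- exact: GQ1.
- exact: GQM.
- exact: GQV hB i.
Qed.

(** The off-diagonal block of the Gram difference reads [a^* d = 1], so [d] is determined by [a].
    Dividing by H(a) leaves a unipotent block in [GQ], and such a block is a generator of [EQ]. *)
Lemma GQ_upper_triangular n (a a' b d : 'M_n) : inverse_mx a a' ->
  GQ (block_mx a b 0 d) ->
  block_mx a b 0 d = hypmx a a' *m block_mx 1%:M (a' *m b) 0 1%:M /\
  EQ (block_mx 1%:M (a' *m b) 0 1%:M).
Proof.
move=> i h; have E : block_mx a b 0 d = hypmx a a' *m block_mx 1%:M (a' *m b) 0 1%:M.
  have /(GQP FR) [_] := h; rewrite block_gram => /LH_block [_ + _].
  rewrite mulmx0 (star0 barP) scaler0 oppr0 => /eqP; rewrite subr_eq0 => /eqP had.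
  have -> : d = st a' by rewrite -[LHS]mul1mx -(star1 barP) -i.1 (starM barP) -mulmxA had mulmx1.
  rewrite mulmx_block !(mulmx0, mul0mx, mulmx1, mul1mx, addr0, add0r) mulmxA i.1.
  by rewrite mul1mx.
split=> //; apply: EQ_upper_GQ.
have := GQM FR (GQ_hypmx (inverse_mxC i)) h.
by rewrite E mulmxA (hypmx_inverse i).2 mul1mx.
Qed.

Lemma GQ_lower_triangular n (a a' c d : 'M_n) : inverse_mx a a' ->
  GQ (block_mx a 0 c d) ->
  block_mx a 0 c d = hypmx a a' *m block_mx 1%:M 0 (st a *m c) 1%:M /\
  EQ (block_mx 1%:M 0 (st a *m c) 1%:M).
Proof.
move=> i h; have E : block_mx a 0 c d = hypmx a a' *m block_mx 1%:M 0 (st a *m c) 1%:M.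
  have /(GQP FR) [_] := h; rewrite block_gram => /LH_block [_ + _].
  rewrite (star0 barP) mul0mx (star0 barP) scaler0 oppr0 => /eqP; rewrite subr_eq0 => /eqP had.
  have -> : d = st a' by rewrite -[LHS]mul1mx -(star1 barP) -i.1 (starM barP) -mulmxA had mulmx1.
  rewrite mulmx_block !(mulmx0, mul0mx, mulmx1, mul1mx, addr0, add0r) mulmxA -(starM barP) i.1.
  by rewrite (star1 barP) mul1mx.
split=> //; apply: EQ_lower_GQ.
have := GQM FR (GQ_hypmx (inverse_mxC i)) h.
by rewrite E mulmxA (hypmx_inverse i).2 mul1mx.
Qed.

Lemma EQ_upper_triangular n (a b d : 'M_n) : elementary a ->
  GQ (block_mx a b 0 d) -> EQ (block_mx a b 0 d).
Proof.
move=> ea h; have [a' i] := elementary_inverse ea.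
have [-> e] := GQ_upper_triangular i h; apply: gen_mul => //; exact: EQ_hypmx.
Qed.

Lemma EQ_lower_triangular n (a c d : 'M_n) : elementary a ->
  GQ (block_mx a 0 c d) -> EQ (block_mx a 0 c d).
Proof.
move=> ea h; have [a' i] := elementary_inverse ea.
have [-> e] := GQ_lower_triangular i h; apply: gen_mul => //; exact: EQ_hypmx.
Qed.
End Elementary.

Ltac blk := rewrite ?mulmx_block ?add_block_mx ?(mulmx0, mul0mx, mulmx1, mul1mx, addr0, add0r).

Section Stab.
Variables (R : pzRingType).

Lemma stab_block n m (a b c d : 'M[R]_n) :
  stab m (block_mx a b c d) =
  block_mx (block_mx a 0 0 1%:M) (block_mx b 0 0 0) (block_mx c 0 0 0) (block_mx d 0 0 1%:M).
Proof. by rewrite /stab block_mxKul block_mxKur block_mxKdl block_mxKdr. Qed.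

Lemma stab1 n m : stab m (1%:M : 'M[R]_(n + n)) = 1%:M.
Proof. by rewrite [in LHS]scalar_mx_block stab_block block_mx0 -!scalar_mx_block. Qed.

Lemma stabM n m (s t : 'M[R]_(n + n)) : stab m (s *m t) = stab m s *m stab m t.
Proof.
by rewrite -[s]submxK -[t]submxK mulmx_block !stab_block; do 3!blk.
Qed.

Lemma stab_inverse n m (s t : 'M[R]_(n + n)) :
  inverse_mx s t -> inverse_mx (stab m s) (stab m t).
Proof. by move=> [h h']; split; rewrite -stabM ?h ?h' stab1. Qed.

Lemma stab_expr n m (s : 'M[R]_(n + n)) k : stab m (s ^+ k) = (stab m s) ^+ k.
Proof. by elim: k => [|k IH]; rewrite ?expr0 ?stab1 // !exprS -IH; exact: stabM. Qed.
End Stab.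

(** * Stable normality of the elementary subgroup *)

Section Normality.
Variables (R : pzRingType) (bar : R -> R) (lam : R) (L : R -> Prop).
Hypothesis FR : is_form_ring bar lam L.
Local Notation st := (starmx bar).
Local Notation LH := (Lambda_hermitian bar lam L).
Local Notation GQ := (GQ bar lam L).
Local Notation EQ := (@EQ R bar lam L _).
Local Notation hypmx := (hypmx bar).

Let barP : is_involution bar := form_bar FR.

Lemma LH_pad n m (A : 'M_n) : LH A -> LH (block_mx A 0 0 (0 : 'M_m)).
Proof.
move=> h; have := block_LH FR 0 h (LH0 FR m).
by rewrite (star0 barP) scaler0 oppr0.
Qed.

Lemma stab_GQ n m (s : 'M_(n + n)) : GQ s -> GQ (stab m s).
Proof.
move=> /(GQP FR) [[t i] h]; apply/(GQP FR); split; first by exists (stab m t); exact: stab_inverse.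
move: h; rewrite -[s]submxK stab_block !(block_gram bar).
rewrite !star_block !(star0 barP) !(star1 barP); do 3!blk.
have -> X : block_mx X 0 0 1%:M - 1%:M = block_mx (X - 1%:M) 0 0 0 :> 'M[R]_(n + m).
  by rewrite [in LHS](scalar_mx_block n m) opp_block_mx add_block_mx !oppr0 !addr0 subrr.
move=> /LH_block [hA -> hD].
have -> : block_mx (- (lam *: st (st (ursubmx s) *m dlsubmx s))) 0 0 (0 : 'M_m)
  = - (lam *: st (block_mx (st (ursubmx s) *m dlsubmx s) 0 0 0)).
  by rewrite star_block !(star0 barP) scale_block_mx opp_block_mx !scaler0 !oppr0.
by apply: (block_LH FR); exact: LH_pad.
Qed.

Lemma stab_hypmx n m (x x' : 'M[R]_n) :
  stab m (hypmx x x') = hypmx (block_mx x 0 0 1%:M) (block_mx x' 0 0 1%:M).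
Proof.
by rewrite stab_block block_mx0 !hypmxE star_block !(star0 barP) (star1 barP).
Qed.

Lemma stab_EQ n m (s : 'M_(n + n)) : EQ s -> EQ (stab m s).
Proof.
apply: gen_subgroup_morph; [exact: stab1 | exact: stabM|].
move=> B hB; have gB : GQ (stab m B) by apply/stab_GQ/(EQ_GQ FR)/gen_base.
case: hB gB => [e f he hf|b _|c _].
- move=> _; have [e' ie] := elementary_inverse he.
  rewrite (inverse_mx_uniq hf (star_inverse barP ie)) stab_hypmx.
  apply: (EQ_hypmx FR); first exact: elementary_block_l.
  by apply: inverse_mx_block => //; exact: inverse_mx1.
- rewrite stab_block block_mx0 -scalar_mx_block; exact: EQ_upper_GQ.
- rewrite stab_block block_mx0 -scalar_mx_block; exact: EQ_lower_GQ.
Qed.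

Variable n : nat.

(* In the basis [P, P', P^*, P'^*], the unipotent radicals of the stabilizers of
   [P'] and of [P'^*]; [GQ_n] acts on [P, P^*] and normalizes both. *)
Definition radical_upper (x p y q z : 'M[R]_n) : 'M[R]_((n + n) + (n + n)) :=
  block_mx (block_mx 1%:M 0 x 1%:M) (block_mx 0 p y z) 0 (block_mx 1%:M q 0 1%:M).
Definition radical_lower (x p y q z : 'M[R]_n) : 'M[R]_((n + n) + (n + n)) :=
  block_mx (block_mx 1%:M p 0 1%:M) 0 (block_mx 0 q x z) (block_mx 1%:M 0 y 1%:M).

Inductive radical : 'M[R]_((n + n) + (n + n)) -> Prop :=
  | Radical_upper x p y q z : GQ (radical_upper x p y q z) -> radical (radical_upper x p y q z)
  | Radical_lower x p y q z : GQ (radical_lower x p y q z) -> radical (radical_lower x p y q z).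

(** The conjugate has the same shape: the entries pairing [P'] or its dual with [P] and [P^*] are
    multiplied by [s] or [s'], while the identity on these two summands becomes [s *m s' = 1]. It is
    thus block triangular with a unitriangular, hence elementary, corner. *)
Lemma radical_conj (s s' : 'M_(n + n)) t : GQ s -> inverse_mx s s' -> radical t ->
  EQ (stab n s *m t *m stab n s').
Proof.
move=> hs is' ht.
have gt : GQ (stab n s *m t *m stab n s').
  apply: (GQM FR); last by apply/stab_GQ/(GQV FR hs).
  by apply: (GQM FR); [exact: stab_GQ | case: ht].
have := is'.1; rewrite -[s]submxK -[s']submxK in gt *.
move: (ulsubmx s) (ursubmx s) (dlsubmx s) (drsubmx s) gt => a b c d.
move: (ulsubmx s') (ursubmx s') (dlsubmx s') (drsubmx s') => a' b' c' d' gt.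
rewrite mulmx_block scalar_mx_block => /eq_block_mx [e1 e2 e3 e4]; move: gt.
case: ht => x p y q z _; rewrite !stab_block; do 4!blk; rewrite e1 e2 e3 e4 block_mx0.
- by apply: (EQ_upper_triangular FR); exact: elementary_lower.
- by apply: (EQ_lower_triangular FR); exact: elementary_upper.
Qed.

Local Notation K := (gen_subgroup radical).

Lemma K_hypmxM (x x' y y' : 'M_(n + n)) :
  K (hypmx x x') -> K (hypmx y y') -> K (hypmx (x *m y) (y' *m x')).
Proof. by move=> hx hy; rewrite -(hypmxM FR); exact: gen_mul. Qed.

Lemma K_hypmx_lower (x : 'M_n) :
  K (hypmx (block_mx 1%:M 0 x 1%:M) (block_mx 1%:M 0 (- x) 1%:M)).
Proof.
have E : hypmx (block_mx 1%:M 0 x 1%:M) (block_mx 1%:M 0 (- x) 1%:M) =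
    radical_upper x 0 0 (st (- x)) 0.
  by rewrite /radical_upper !hypmxE star_block !(star0 barP) (star1 barP) block_mx0.
by rewrite E; apply/gen_base/Radical_upper; rewrite -E; apply/(GQ_hypmx FR)/inverse_mx_lower.
Qed.

Lemma K_hypmx_upper (x : 'M_n) :
  K (hypmx (block_mx 1%:M x 0 1%:M) (block_mx 1%:M (- x) 0 1%:M)).
Proof.
have E : hypmx (block_mx 1%:M x 0 1%:M) (block_mx 1%:M (- x) 0 1%:M) =
    radical_lower 0 x (st (- x)) 0 0.
  by rewrite /radical_lower !hypmxE star_block !(star0 barP) (star1 barP) block_mx0.
by rewrite E; apply/gen_base/Radical_lower; rewrite -E; apply/(GQ_hypmx FR)/inverse_mx_upper.
Qed.

Lemma K_hypmx_elementary (e e' : 'M_n) : elementary e -> inverse_mx e e' ->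
  K (hypmx (block_mx e 0 0 1%:M) (block_mx e' 0 0 1%:M)).
Proof.
move=> h; elim: h e' => [B [i [j [x [ij ->]]]]||B C hB IB hC IC|B C _ hB i] B' iB.
(* The product is [x e_ij] in one order and zero in the other because [i != j]; so
   [commutator_block] writes the padded generator with radical elements through [P']. *)
- pose A := x *: delta_mx i i : 'M[R]_n; pose D := 1 *: delta_mx i j : 'M[R]_n.
  have DA : D *m A = 0 by rewrite mul_delta_delta0 // eq_sym.
  have AD : A *m D = x *: delta_mx i j by rewrite mul_delta_delta mulr1.
  have /inverse_mx_block /(_ (inverse_mx1 R n)) := iB; rewrite -AD.
  rewrite {1}(commutator_block DA) => iC.
  have := K_hypmxM (K_hypmxM (K_hypmx_upper A) (K_hypmx_lower D))
            (K_hypmxM (K_hypmx_upper (- A)) (K_hypmx_lower (- D))).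
  rewrite -(commutator_block DA) ; congr (K (hypmx _ _)).
  apply: inverse_mx_uniq iC; apply: inverse_mxM; apply: inverse_mxM;
    by [exact: inverse_mx_upper | exact: inverse_mx_lower].
- rewrite (inverse_mx_uniq iB (inverse_mx1 R n)) -scalar_mx_block (hypmx1 FR).
  exact: gen_one.
- have [[B2 iB2] [C2 iC2]] := (elementary_inverse hB, elementary_inverse hC).
  rewrite (inverse_mx_uniq iB (inverse_mxM iB2 iC2)).
  have := K_hypmxM (IB _ iB2) (IC _ iC2).
  by rewrite !mulmx_block; blk.
- have <- := inverse_mx_uniq (inverse_mxC i) iB.
  apply: (gen_inv (hB _ i)); apply: (hypmx_inverse FR).
  by apply: inverse_mx_block => //; exact: inverse_mx1.
Qed.

(* The swap of [P] and [P'] carries the summand [P'] of the radicals to [P]. *)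
Lemma K_swap : {w | K (hypmx w.1 w.2) /\ inverse_mx w.1 w.2 &
  w.1 = block_mx 0 1%:M (- 1%:M) 0 /\ w.2 = block_mx 0 (- 1%:M) 1%:M 0}.
Proof.
pose w := block_mx 0 1%:M (- 1%:M) 0 : 'M[R]_(n + n).
pose w' := block_mx 0 (- 1%:M) 1%:M 0 : 'M[R]_(n + n).
exists (w, w') => //=; split; last first.
  by split; rewrite /w /w'; blk; rewrite ?mulmxN ?mulNmx mulmx1 ?opprK -scalar_mx_block.
have := K_hypmxM (K_hypmxM (K_hypmx_upper 1%:M) (K_hypmx_lower (- 1%:M))) (K_hypmx_upper 1%:M).
by congr (K (hypmx _ _)); rewrite ?opprK; do 3!blk;
   rewrite ?subrr ?addNr ?mul0mx ?mulmx0 ?addr0 ?add0r ?opprK ?mulmx1.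
Qed.

(** One doubling gives room for the summand [P']: hyperbolic generators become commutators of
    radical elements, and unipotent ones are carried by the swap into the coordinate [z] of a
    radical. *)
Lemma stab_radical (s : 'M_(n + n)) : EQ s -> K (stab n s).
Proof.
apply: gen_subgroup_morph; [exact: stab1 | exact: stabM|].
have [[w w'] [Kw iw] [/= Ew Ew']] := K_swap.
have Kc t : K t -> K (hypmx w w' *m t *m hypmx w' w).
  move=> h; apply: gen_mul; first exact: gen_mul.
  by apply: (gen_inv Kw); exact: (hypmx_inverse FR).
move=> B hB; have gB : GQ B by apply/(EQ_GQ FR)/gen_base.
case: hB gB => [e f he hf|b _|c _].
- move=> _; have [e' ie] := elementary_inverse he.
  rewrite (inverse_mx_uniq hf (star_inverse barP ie)) stab_hypmx.
  exact: K_hypmx_elementary.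
- move=> /(GQ_upperP FR) hb.
  suff -> : stab n (block_mx 1%:M b 0 1%:M) =
    hypmx w w' *m radical_upper 0 0 0 0 b *m hypmx w' w.
    apply/Kc/gen_base/Radical_upper; rewrite /radical_upper -!scalar_mx_block.
    apply/(GQ_upperP FR); rewrite star_block !(star0 barP).
    by have := block_LH FR 0 (LH0 FR n) hb; rewrite (star0 barP) scaler0 oppr0.
  rewrite stab_block block_mx0 !hypmxE /radical_upper Ew Ew' !star_block !(starN barP, star0 barP, star1 barP).
  do 4!blk; rewrite ?mulmxN ?mulNmx ?mulmx1 ?mul1mx ?opprK ?oppr0 ?mulmx0 ?mul0mx ?addr0 ?add0r ?opprK ?block_mx0 //.
- move=> /(GQ_lowerP FR) hc.
  suff -> : stab n (block_mx 1%:M 0 c 1%:M) =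
    hypmx w w' *m radical_lower 0 0 0 0 c *m hypmx w' w.
    apply/Kc/gen_base/Radical_lower; rewrite /radical_lower -!scalar_mx_block.
    apply/(GQ_lowerP FR).
    by have := block_LH FR 0 (LH0 FR n) hc; rewrite (star0 barP) scaler0 oppr0.
  rewrite stab_block block_mx0 !hypmxE /radical_lower Ew Ew' !star_block !(starN barP, star0 barP, star1 barP).
  do 4!blk; rewrite ?mulmxN ?mulNmx ?mulmx1 ?mul1mx ?opprK ?oppr0 ?mulmx0 ?mul0mx ?addr0 ?add0r ?opprK ?block_mx0 //.
Qed.

(** Conjugation is multiplicative, so it suffices to conjugate the radical elements into which the
    doubled [e] decomposes. *)
Lemma stab_EQ_normal (s s' e : 'M_(n + n)) : GQ s -> inverse_mx s s' -> EQ e ->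
  EQ (stab n (s *m e *m s')).
Proof.
move=> hs i /stab_radical he; rewrite !stabM.
apply: (gen_subgroup_morph (f := fun t => stab n s *m t *m stab n s') _ _ _ he).
- by rewrite mulmx1 -stabM i.1 stab1.
- move=> B C; rewrite !mulmxA; congr (_ *m _ *m _).
  by rewrite -[_ *m stab n s' *m _]mulmxA -stabM i.2 stab1 mulmx1.
- by move=> B; exact: radical_conj.
Qed.
End Normality.

(** * Equality of classes in [K_1 GQ], its compatibility with products and with stabilization *)

Section Classes.
Variables (R : pzRingType) (bar : R -> R) (lam : R) (L : R -> Prop).
Hypothesis FR : is_form_ring bar lam L.
Local Notation GQ := (GQ bar lam L).
Local Notation EQ := (@EQ R bar lam L _).
Local Notation EQst := (EQ_stable bar lam L).
Local Notation inv := (gqinv bar lam).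

Let barP : is_involution bar := form_bar FR.

Lemma stab_stab n m d (s : 'M[R]_(n + n)) (e : ((n + m) + d = n + (m + d))%N) :
  stab (m + d) s = castmx (congr2 addn e e, congr2 addn e e) (stab d (stab m s)).
Proof.
have cast_block k k' (f : k = k') (A B C D : 'M[R]_k) :
    castmx (congr2 addn f f, congr2 addn f f) (block_mx A B C D) =
    block_mx (castmx (f, f) A) (castmx (f, f) B) (castmx (f, f) C) (castmx (f, f) D).
  by case: k' / f; rewrite !castmx_id.
rewrite -[s]submxK !stab_block cast_block.
have E (A : 'M[R]_n) (x : R) : castmx (e, e) (block_mx (block_mx A 0 0 x%:M) 0 0 x%:M) =
    block_mx A 0 0 x%:M.
  have := @block_mxA _ n m d n m d A 0 0 0 x%:M 0 0 0 x%:M.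
  rewrite !row_mx0 !col_mx0 -scalar_mx_block => ->.
  by congr castmx; congr pair; exact: eq_irrelevance.
have E0 (A : 'M[R]_n) : castmx (e, e) (block_mx (block_mx A 0 0 0) 0 0 0) =
    block_mx A 0 0 0.
  by have := E A 0; rewrite !raddf0.
by rewrite !E !E0.
Qed.

Lemma stab_EQ_mono n m m' (s : 'M_(n + n)) : (m <= m')%N ->
  EQ (stab m s) -> EQ (stab m' s).
Proof.
move=> /subnKC <- h; rewrite (stab_stab _ (esym (addnA n m (m' - m)%N))).
move: (esym _) => e; case: _ / e; rewrite castmx_id; exact: stab_EQ.
Qed.

Lemma EQst_stab n m (s : 'M_(n + n)) : EQst (stab m s) <-> EQst s.
Proof.
have e d := esym (addnA n m d).
split=> [[d h]|[d h]].
  exists (m + d)%N; rewrite (stab_stab _ (e d)); case: _ / (e d).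
  by rewrite castmx_id.
exists d; have : EQ (stab (m + d) s) by apply: stab_EQ_mono h; exact: leq_addl.
rewrite (stab_stab _ (e d)); case: _ / (e d).
by rewrite castmx_id.
Qed.

Lemma EQ_EQst n (s : 'M_(n + n)) : EQ s -> EQst s.
Proof. by move=> h; exists 0%N; exact: stab_EQ. Qed.

Lemma EQst1 n : EQst (1%:M : 'M_(n + n)).
Proof. by apply: EQ_EQst; exact: gen_one. Qed.

Lemma EQstM n (s t : 'M_(n + n)) : EQst s -> EQst t -> EQst (s *m t).
Proof.
move=> [m hs] [m' ht]; exists (m + m')%N; rewrite stabM.
by apply: gen_mul; [apply: stab_EQ_mono hs | apply: stab_EQ_mono ht];
  rewrite ?leq_addl ?leq_addr.
Qed.

Lemma EQstV n (s t : 'M_(n + n)) : EQst s -> inverse_mx s t -> EQst t.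
Proof. by move=> [m hs] i; exists m; apply: (gen_inv hs); exact: stab_inverse. Qed.

Lemma EQst_conj n (s s' e : 'M_(n + n)) : GQ s -> inverse_mx s s' -> EQst e ->
  EQst (s *m e *m s').
Proof.
move=> hs i [m he]; apply/(EQst_stab m); exists (n + m)%N; rewrite !stabM.
rewrite -!stabM; have := stab_EQ_normal FR (stab_GQ FR m hs) (stab_inverse m i) he.
by rewrite -!stabM.
Qed.

(** Whitehead's argument: in double size the elementary swap [W] moves [T] to the second summand,
    where it commutes with [S]. Since [W T W^-1] is [T] times a stably elementary [E], normality
    lets [E] be collected and the commutator of [S] and [T] is stably elementary. *)
Lemma EQst_commutator n (s s' t t' : 'M_(n + n)) :
  GQ s -> inverse_mx s s' -> GQ t -> inverse_mx t t' ->
  EQst (s *m t *m s' *m t').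
Proof.
move=> hs is' ht it'.
pose w := block_mx 0 1%:M (- 1%:M) 0 : 'M[R]_(n + n).
pose w' := block_mx 0 (- 1%:M) 1%:M 0 : 'M[R]_(n + n).
have ew : elementary w.
  have := gen_mul (gen_mul (elementary_upper (1%:M : 'M[R]_n)) (elementary_lower (- 1%:M : 'M[R]_n)))
    (elementary_upper (1%:M : 'M[R]_n)).
  by congr elementary; do 3!blk; rewrite ?subrr ?addNr ?mul0mx ?mulmx0 ?addr0 ?add0r.
have iw : inverse_mx w w'.
  by split; rewrite /w /w'; blk; rewrite ?mulmxN ?mulNmx mulmx1 ?opprK -scalar_mx_block.
pose W := hypmx bar w w'; pose W' := hypmx bar w' w.
have iW : inverse_mx W W' by exact: (hypmx_inverse FR).
have eW : EQst W by apply/EQ_EQst/(EQ_hypmx FR).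
have gW : GQ W by exact: (GQ_hypmx FR).
pose S := stab n s; pose S' := stab n s'; pose T := stab n t; pose T' := stab n t'.
have iS : inverse_mx S S' by exact: stab_inverse.
have iT : inverse_mx T T' by exact: stab_inverse.
have gS : GQ S by exact: stab_GQ.
have gT : GQ T by exact: stab_GQ.
have ET : W *m T *m W' = block_mx (block_mx 1%:M 0 0 (ulsubmx t)) (block_mx 0 0 0 (ursubmx t))
                                (block_mx 0 0 0 (dlsubmx t)) (block_mx 1%:M 0 0 (drsubmx t)).
  rewrite /T /W /W' !hypmxE /w /w' !star_block !(starN barP, star0 barP, star1 barP).
  rewrite -[t in LHS]submxK stab_block; do 4!blk.
  by rewrite ?mulmxN ?mulNmx ?mulmx1 ?mul1mx ?opprK ?oppr0 ?mulmx0 ?mul0mx ?addr0 ?add0r ?opprK.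
have comm : S *m (W *m T *m W') = (W *m T *m W') *m S.
  by rewrite ET /S -[s]submxK stab_block; do 2!blk.
apply/(EQst_stab n); rewrite !stabM -/S -/S' -/T -/T'.
(* [W T W^-1] differs from [T] by an elementary factor on the right *)
pose E := T' *m W *m T *m W'; pose E' := W *m T' *m W' *m T.
have iE : inverse_mx E E'.
  have -> : E = T' *m (W *m T *m W') by rewrite !mulmxA.
  have -> : E' = (W *m T' *m W') *m T by [].
  apply: inverse_mxM; first exact: inverse_mxC.
  have -> : W *m T' *m W' = W *m (T' *m W') by rewrite mulmxA.
  apply: inverse_mxM; last exact: inverse_mxC.
  exact: inverse_mxM.
have eE : EQst E.
  apply: EQstM (EQstV eW iW); apply: EQst_conj (inverse_mxC iT) eW; exact: (GQV FR gT).
have TE : W *m T *m W' = T *m E by rewrite /E !mulmxA iT.1 mul1mx.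
move: E E' iE eE TE => E E' iE eE TE.
have eE' : EQst (S *m E' *m S') by apply: (EQst_conj gS iS); exact: EQstV eE iE.
have ST : S *m T = T *m (E *m (S *m E')).
  by rewrite TE in comm; rewrite !mulmxA -comm -!mulmxA iE.1 mulmx1.
have -> : S *m T *m S' *m T' = T *m (E *m (S *m E' *m S')) *m T'.
  by rewrite ST !mulmxA.
by apply: (EQst_conj gT iT); exact: EQstM.
Qed.

(** The inverse is the closed formula [gqinv], so that the relation is defined for all matrices; it
    means equality of classes only on [GQ]. *)
Definition eqK n (s t : 'M[R]_(n + n)) := EQst (inv s *m t).

Lemma eqKE n (s t : 'M_(n + n)) : eqK s t = EQst (inv s *m t).
Proof. by []. Qed.

Lemma eqK_refl n (s : 'M_(n + n)) : GQ s -> eqK s s.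
Proof. by move=> h; rewrite /eqK (gqinvP FR h).2; exact: EQst1. Qed.

Lemma gqinv_eq n (s t : 'M_(n + n)) : GQ s -> inverse_mx s t -> inv s = t.
Proof. by move=> h; apply: inverse_mx_uniq; exact: (gqinvP FR). Qed.

Lemma gqinvK n (s : 'M_(n + n)) : GQ s -> inv (inv s) = s.
Proof.
by move=> h; apply: gqinv_eq; [exact: GQ_gqinv | exact/inverse_mxC/(gqinvP FR)].
Qed.

Lemma eqK_sym n (s t : 'M_(n + n)) : GQ s -> GQ t -> eqK s t -> eqK t s.
Proof.
move=> hs ht h; apply: (EQstV h); rewrite -{2}[s](gqinvK hs).
by apply: inverse_mxM; [apply: (gqinvP FR (GQ_gqinv FR hs)) | apply: (gqinvP FR)].
Qed.

Lemma eqK_trans n (s t u : 'M_(n + n)) : GQ t -> eqK s t -> eqK t u -> eqK s u.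
Proof.
move=> ht h1 h2; have := EQstM h1 h2.
by rewrite mulmxA -[_ *m t *m inv t]mulmxA (gqinvP FR ht).1 mulmx1.
Qed.

Lemma eqK_mul n (s s' t t' : 'M_(n + n)) : GQ s -> GQ t ->
  GQ s' -> eqK s s' -> eqK t t' -> eqK (s *m t) (s' *m t').
Proof.
move=> gs gt gs' hs ht; rewrite /eqK (gqinvM FR).
have -> : inv t *m inv s *m (s' *m t') =
  (inv t *m (inv s *m s') *m t) *m (inv t *m t').
  rewrite !mulmxA; congr (_ *m _); rewrite -[RHS]mulmxA (gqinvP FR gt).1 mulmx1 //.
apply: EQstM ht; apply: EQst_conj hs; first exact: GQ_gqinv.
exact/inverse_mxC/(gqinvP FR).
Qed.

Lemma eqK_mulC n (s t : 'M_(n + n)) : GQ s -> GQ t -> eqK (s *m t) (t *m s).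
Proof.
move=> gs gt; rewrite /eqK (gqinvM FR) mulmxA.
have := EQst_commutator (GQ_gqinv FR gt) (inverse_mxC (gqinvP FR gt))
    (GQ_gqinv FR gs) (inverse_mxC (gqinvP FR gs)).
by [].
Qed.

Lemma eqK_conj n (s t t' : 'M_(n + n)) : GQ s -> GQ t -> inverse_mx t t' ->
  eqK (t' *m s *m t) s.
Proof.
move=> gs gt it; have gt' := GQV FR gt it.
have h := eqK_mulC (GQM FR gt' gs) gt.
by rewrite !mulmxA it.1 mul1mx in h.
Qed.

Lemma GQX n (s : 'M_(n + n)) k : GQ s -> GQ (s ^+ k).
Proof.
by move=> h; elim: k => [|k IH]; rewrite ?expr0 ?exprS; [exact: GQ1 | exact: (GQM FR)].
Qed.

Lemma eqKX n (s t : 'M_(n + n)) k : GQ s -> GQ t -> eqK s t -> eqK (s ^+ k) (t ^+ k).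
Proof.
move=> gs gt h; elim: k => [|k IH]; rewrite ?expr0 ?exprS.
  by apply: eqK_refl; exact: GQ1.
by apply: eqK_mul => //; exact: GQX.
Qed.

Lemma eqK1 n (s : 'M_(n + n)) : GQ s -> eqK 1%:M s <-> EQst s.
Proof. by move=> h; rewrite /eqK (gqinv_eq (GQ1 FR n) (inverse_mx1 R _)) mul1mx. Qed.

Lemma eqK_cancel n (s s' t t' : 'M_(n + n)) : GQ s -> GQ s' -> GQ t -> GQ t' ->
  eqK s s' -> eqK (s *m t) (s' *m t') -> eqK t t'.
Proof.
move=> gs gs' gt gt' h h2.
have h' : eqK (inv s) (inv s').
  rewrite /eqK gqinvK //; have := eqK_sym gs gs' h; rewrite /eqK => h3.
  have := EQst_conj gs' (gqinvP FR gs') h3.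
  by rewrite mulmxA (gqinvP FR gs').1 mul1mx.
have := eqK_mul (GQ_gqinv FR gs) (GQM FR gs gt) (GQ_gqinv FR gs') h' h2.
by rewrite !mulmxA (gqinvP FR gs).2 (gqinvP FR gs').2 !mul1mx.
Qed.

Lemma eqKXM n (s t : 'M_(n + n)) k : GQ s -> GQ t ->
  eqK ((s *m t) ^+ k) (s ^+ k *m t ^+ k).
Proof.
move=> gs gt; have gst := GQM FR gs gt; elim: k => [|k IH].
  by rewrite !expr0 mulmx1; apply: eqK_refl; exact: GQ1.
have gX (u : 'M_(n + n)) : GQ u -> GQ (u ^+ k) by exact: GQX.
have gsX := gX s gs; have gtX := gX t gt; have gstX := gX _ gst.
rewrite !exprSr -!mulmxE.
move: (s ^+ k) (t ^+ k) ((s *m t) ^+ k) gsX gtX gstX IH => S T ST gS gT gST IH.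
have g1 : GQ (S *m T *m (s *m t)) by exact: (GQM FR (GQM FR gS gT) gst).
apply: (eqK_trans g1).
  exact: (eqK_mul gST gst (GQM FR gS gT) IH (eqK_refl gst)).
have -> : S *m T *m (s *m t) = S *m (T *m s) *m t by rewrite !mulmxA.
have -> : S *m s *m (T *m t) = S *m (s *m T) *m t by rewrite !mulmxA.
have h := eqK_mul gS (GQM FR gT gs) gS (eqK_refl gS) (eqK_mulC gT gs).
exact: (eqK_mul (GQM FR gS (GQM FR gT gs)) gt (GQM FR gS (GQM FR gs gT)) h (eqK_refl gt)).
Qed.

Lemma eqK_stab n m (s t : 'M_(n + n)) : GQ s -> eqK (stab m s) (stab m t) <-> eqK s t.
Proof.
move=> gs; have -> : eqK (stab m s) (stab m t) = EQst (stab m (inv s *m t)).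
  rewrite /eqK (gqinv_eq (stab_GQ FR m gs) (stab_inverse m (gqinvP FR gs))).
  by rewrite stabM.
exact: EQst_stab.
Qed.
End Classes.

(** * Classes of isometries of quadratic forms *)

Section Isometries.
Variables (R : pzRingType) (bar : R -> R) (lam : R) (L : R -> Prop).
Hypothesis FR : is_form_ring bar lam L.
Local Notation st := (starmx bar).
Local Notation LH := (Lambda_hermitian bar lam L).
Local Notation GQ := (GQ bar lam L).
Local Notation EQ := (@EQ R bar lam L _).
Local Notation eqK := (eqK bar lam L).
Local Notation hypmx := (hypmx bar).
Local Notation form_isometry := (form_isometry bar lam L).

Let barP : is_involution bar := form_bar FR.
Let lamC : forall x, lam * x = x * lam := form_lam_central FR.

Lemma eqK_EQl n (e s : 'M_(n + n)) : EQ e -> GQ s -> eqK (e *m s) s.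
Proof.
move=> he hs; have ge := EQ_GQ FR he.
rewrite -[X in eqK _ X]mul1mx; apply: (eqK_mul FR) => //.
- exact: GQ1 FR _.
- apply: (eqK_sym FR) => //; first exact: GQ1 FR _.
  by apply/(eqK1 FR ge); exact: EQ_EQst.
- exact: eqK_refl.
Qed.

Lemma eqK_EQr n (e s : 'M_(n + n)) : EQ e -> GQ s -> eqK (s *m e) s.
Proof.
move=> he hs; have ge := EQ_GQ FR he.
apply: (eqK_trans FR _ (eqK_mulC FR hs ge)); first exact: (GQM FR).
exact: eqK_EQl.
Qed.

(** Block Gauss elimination inside [GQ]: [c *m a'] is the congruence transform of the
    Lambda-Hermitian matrix [a^* c] by [a'], so the lower unipotent factor that clears [c] is
    elementary, and a triangular matrix remains. *)
Lemma eqK_hypmx n (a a' b c d : 'M_n) : inverse_mx a a' ->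
  GQ (block_mx a b c d) -> eqK (block_mx a b c d) (hypmx a a').
Proof.
move=> i hs.
have gl : GQ (block_mx 1%:M 0 (c *m a') 1%:M).
  apply/(GQ_lowerP FR); have /(GQP FR) [_] := hs.
  rewrite block_gram => /LH_block [/(LH_conj FR a') h _ _].
  by rewrite !mulmxA -(starM barP) i.1 (star1 barP) mul1mx in h.
have gl' : GQ (block_mx 1%:M 0 (- (c *m a')) 1%:M).
  by apply: (GQV FR gl); exact: inverse_mx_lower.
have E : block_mx 1%:M 0 (- (c *m a')) 1%:M *m block_mx a b c d =
         block_mx a b 0 (d - c *m a' *m b).
  blk; rewrite !mulNmx -[_ *m a' *m a]mulmxA i.2 mulmx1 addNr.
  by rewrite [- _ + d]addrC.
have gt := GQM FR gl' hs; rewrite E in gt.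
have [E2 u] := GQ_upper_triangular FR i gt.
have -> : block_mx a b c d = block_mx 1%:M 0 (c *m a') 1%:M *m
    (hypmx a a' *m block_mx 1%:M (a' *m b) 0 1%:M).
  by rewrite -E2 -E mulmxA (inverse_mx_lower (c *m a')).1 mul1mx.
have gh := GQ_hypmx FR i.
have gu := GQM FR gh (EQ_GQ FR u).
apply: (eqK_trans FR gu (eqK_EQl (EQ_lower_GQ FR gl) gu)).
exact: eqK_EQr.
Qed.

(** The matrix [psi] itself lies in [GQ] and exchanges the two Lagrangians; conjugating by it
    exchanges the diagonal blocks. Consequently the conjugate transpose of [x] has the class
    opposite to that of [x]. *)
Lemma hypmx_star n (x x' : 'M_n) : inverse_mx x x' ->
  eqK (hypmx (st x') (st x)) (hypmx x x').
Proof.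
move=> i; pose p' := psi_inv bar lam n.
have scl k l (A : 'M[R]_(k, l)) : A *m lam%:M = lam *: A.
  by rewrite -scalemx1 (mulmxZr _ _ lamC) mulmx1.
have ip : inverse_mx (psi lam n) p' by exact: (psi_inverse FR).
have gp : GQ (psi lam n).
  apply/(GQP FR); split; first by exists p'.
  rewrite /psi block_gram !(star0 barP) (star1 barP); blk.
  have := block_LH FR lam%:M (LH0 FR n) (LH0 FR n).
  by rewrite (star_scalar barP) -[_ *: _]mul_scalar_mx -scalar_mxM (lam_bar FR).
have <- : p' *m hypmx x x' *m psi lam n = hypmx (st x') (st x).
  rewrite /psi /p' /psi_inv !hypmxE (starK barP) !mulmx_block.
  rewrite !(mulmx0, mul0mx, mulmx1, mul1mx, addr0, add0r).
  by rewrite scl mul_scalar_mx scalerA (lam_bar FR) scale1r.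
exact: (eqK_conj FR (GQ_hypmx FR i) gp ip).
Qed.

Definition polar m (f : 'M[R]_m) := f + lam *: st f.

(* A nonsingular quadratic form [f], of polar form [p] and with [E = p^-1 f]. *)
Record nonsingular m (f p p' E : 'M[R]_m) : Prop := Nonsingular {
  ns_polar : polar f = p;
  ns_inverse : inverse_mx p p';
  ns_form : p *m E = f }.

(* The diagonal and [{((1 - E) y, - E y)}] are complementary Lagrangians of
   [f] + [- f], which is therefore hyperbolic. *)
Definition frame m (p' E : 'M[R]_m) : 'M[R]_(m + m) :=
  block_mx 1%:M ((1%:M - E) *m p') 1%:M (- (E *m p')).
Definition frame_inv m (p E : 'M[R]_m) : 'M[R]_(m + m) :=
  block_mx E (1%:M - E) p (- p).
Definition iota_form m (p p' E t : 'M[R]_m) :=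
  frame_inv p E *m block_mx t 0 0 1%:M *m frame p' E.

Section Frame.
Variables (m : nat) (f p p' E : 'M[R]_m).
Hypothesis ns : nonsingular f p p' E.

Lemma frame_inverse : inverse_mx (frame p' E) (frame_inv p E).
Proof.
have [_ [i1 i2] _] := ns; split; rewrite /frame /frame_inv; blk; rewrite ?mulmxN ?mulNmx ?opprK.
  by rewrite -!mulmxA i2 !mulmx1 !subrr !addrNK [E + _]addrC addrNK -scalar_mx_block.
rewrite [E + _]addrC addrNK subrr !mulmxA -[X in block_mx _ _ _ X]mulmxDl -mulmxDr.
have -> : E *m (1%:M - E) = (1%:M - E) *m E by rewrite mulmxBr mulmxBl mulmx1 mul1mx.
by rewrite addrNK mulmx1 i1 subrr -scalar_mx_block.
Qed.

Lemma star_polar : st p = bar lam *: p.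
Proof.
rewrite -(ns_polar ns) /polar (starD barP) (starZlam FR) (starK barP) scalerDr scalerA.
by rewrite (bar_lam FR) scale1r addrC.
Qed.

(* [1 - E] is the adjoint of [E]. *)
Lemma star_adjoint : st E *m p = p *m (1%:M - E).
Proof.
apply/eqP; rewrite mulmxBr mulmx1 -subr_eq0 opprB addrA subr_eq0; apply/eqP.
rewrite -{3}(ns_polar ns) /polar -(ns_form ns) addrC (starM barP) star_polar.
by rewrite (mulmxZr _ _ (bar_lamC FR)) scalerA (lam_bar FR) scale1r.
Qed.

Lemma frame_isometry : form_isometry (block_mx f 0 0 (- f)) (hyp R m) (frame p' E).
Proof.
rewrite /form_isometry /frame star_block !(star1 barP); do 2!blk.
rewrite ?mulmxN ?mulNmx subrr (starN barP) !(starM barP) ?mulmxN ?mulNmx ?opprK.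
rewrite opp_block_mx add_block_mx !oppr0 !addr0.
have <- : - (lam *: st (st p' *m f)) = f *m ((1%:M - E) *m p') + f *m (E *m p') - 1%:M.
  rewrite -mulmxDr -mulmxDl addrNK mul1mx -(ns_inverse ns).1 -(ns_polar ns) /polar.
  by rewrite (starM barP) (starK barP) scalemxAl mulmxDl opprD addNKr.
have -> : st p' *m st (1%:M - E) *m f + st p' *m st E *m f = st p' *m f.
  by rewrite (starB barP) (star1 barP) -mulmxDl -mulmxDr addrNK mulmx1.
have star_adjoint' : st (1%:M - E) *m p = p *m E.
  by rewrite (starB barP) (star1 barP) mulmxBl star_adjoint mul1mx mulmxBr mulmx1 subKr.
(* Moving the adjoints across [p] turns both sides into [p E E (1 - E)]. This makes the second
   summand of the frame Lagrangian. *)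
have K : st (1%:M - E) *m f *m (1%:M - E) = st E *m f *m E.
  rewrite -(ns_form ns) !mulmxA star_adjoint star_adjoint' -!mulmxA; congr (_ *m _).
  by rewrite !(mulmxBr, mulmxBl, mulmx1, mul1mx) !mulmxA.
have -> : st p' *m st (1%:M - E) *m f *m ((1%:M - E) *m p') =
    st p' *m st E *m f *m (E *m p').
  transitivity (st p' *m (st (1%:M - E) *m f *m (1%:M - E)) *m p').
    by rewrite !mulmxA.
  by rewrite K !mulmxA.
by rewrite subrr; apply: (block_LH FR); exact: LH0.
Qed.

Lemma iota_form1 : iota_form p p' E 1%:M = 1%:M.
Proof. by rewrite /iota_form -scalar_mx_block mulmx1 frame_inverse.2. Qed.

Lemma iota_formM t t' :
  iota_form p p' E (t *m t') = iota_form p p' E t *m iota_form p p' E t'.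
Proof.
rewrite /iota_form !mulmxA; congr (_ *m _).
rewrite -[_ *m frame _ _ *m frame_inv _ _]mulmxA frame_inverse.1 mulmx1.
by rewrite -[RHS]mulmxA; congr (_ *m _); blk.
Qed.

Lemma iota_formX t k : iota_form p p' E (t ^+ k) = iota_form p p' E t ^+ k.
Proof. by elim: k => [|k IH]; rewrite ?expr0 ?iota_form1 // !exprS -IH; exact: iota_formM. Qed.

(** The block to remember is the upper left one, [1 + E (t - 1)]: once it is invertible, [eqK_hypmx]
    gives the class. The explicit blocks also let [iota_form] pass from scalar matrices over a
    matrix ring to the matrices themselves. *)
Lemma iota_formE t : iota_form p p' E t =
  block_mx (1%:M + E *m (t - 1%:M)) (E *m (t - 1%:M) *m (1%:M - E) *m p')
           (p *m (t - 1%:M)) (p *m (1%:M + (t - 1%:M) *m (1%:M - E)) *m p').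
Proof.
have EE : E *m (1%:M - E) = (1%:M - E) *m E by rewrite mulmxBr mulmxBl mulmx1 mul1mx.
rewrite /iota_form /frame /frame_inv; do 2!blk; rewrite ?mulmxN ?mulNmx opprK.
congr block_mx.
- by rewrite mulmxBr mulmx1 addrCA [X in _ + X]addrC.
- rewrite !mulmxA -EE -mulmxBl -mulmxBl; congr (_ *m _ *m _).
  by rewrite mulmxBr mulmx1.
- by rewrite mulmxBr mulmx1.
rewrite !mulmxA -mulmxDl; congr (_ *m _); rewrite -[p *m t *m _]mulmxA -mulmxDr.
by congr (_ *m _); rewrite mulmxBl mul1mx opprB addrCA; congr (_ + _); rewrite addrC addrNK.
Qed.

Lemma iota_form_inverse t t' : inverse_mx t t' ->
  inverse_mx (iota_form p p' E t) (iota_form p p' E t').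
Proof. by move=> [h h']; split; rewrite -iota_formM ?h ?h' iota_form1. Qed.

Lemma LH_block_diag n n' (A : 'M_n) (B : 'M_n') : LH A -> LH B -> LH (block_mx A 0 0 B).
Proof.
move=> hA hB; have := block_LH FR 0 hA hB.
by rewrite (star0 barP) scaler0 oppr0.
Qed.

Lemma iota_form_GQ t t' : inverse_mx t t' -> form_isometry f f t ->
  GQ (iota_form p p' E t).
Proof.
move=> i h; apply/(GQ_isometry FR); split.
  by exists (iota_form p p' E t'); exact: iota_form_inverse.
apply: (isometryM FR (f' := block_mx f 0 0 (- f))); last exact: frame_isometry.
apply: (isometryM FR (f' := block_mx f 0 0 (- f))); first exact: (isometryV FR frame_inverse frame_isometry).
rewrite /form_isometry star_block !(star0 barP) (star1 barP); do 2!blk.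
rewrite opp_block_mx add_block_mx !oppr0 !addr0 opprK addNr.
by apply: LH_block_diag => //; exact: LH0.
Qed.
End Frame.

(* Two hyperbolic frames of the same quadratic space differ by an element of [GQ]. *)
Lemma frame_change m (F G G' H H' T : 'M_(m + m)) :
  inverse_mx G G' -> form_isometry F (hyp R m) G ->
  inverse_mx H H' -> form_isometry F (hyp R m) H ->
  GQ (G' *m T *m G) -> eqK (H' *m T *m H) (G' *m T *m G).
Proof.
move=> iG fG iH fH gT.
have gq : GQ (G' *m H).
  apply/(GQ_isometry FR); split.
    by exists (H' *m G); apply: inverse_mxM => //; exact: inverse_mxC.
  exact: (isometryM FR (isometryV FR iG fG) fH).
have iq : inverse_mx (G' *m H) (H' *m G).
  by apply: inverse_mxM => //; exact: inverse_mxC.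
have := eqK_conj FR gT gq iq.
by rewrite !mulmxA -[H' *m G *m G']mulmxA iG.1 mulmx1 -[_ *m G *m G']mulmxA iG.1 mulmx1.
Qed.

Lemma iota_form_congr m (f p p' E f1 p1 p1' E1 g g' t t' : 'M_m) :
  nonsingular f p p' E -> nonsingular f1 p1 p1' E1 ->
  inverse_mx g g' -> form_isometry f f1 g ->
  inverse_mx t t' -> form_isometry f f t ->
  eqK (iota_form p1 p1' E1 (g' *m t *m g)) (iota_form p p' E t).
Proof.
move=> ns ns1 ig fg it ft.
pose gg := block_mx g 0 0 g; pose gg' := block_mx g' 0 0 g'.
have igg : inverse_mx gg gg' by exact: inverse_mx_block.
have -> : iota_form p1 p1' E1 (g' *m t *m g) =
  (frame_inv p1 E1 *m gg') *m block_mx t 0 0 1%:M *m (gg *m frame p1' E1).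
  rewrite /iota_form !mulmxA; congr (_ *m _); rewrite -!mulmxA; congr (_ *m _).
  by rewrite /gg /gg'; do 2!blk; rewrite ig.2 !mulmxA.
apply: (frame_change (F := block_mx f 0 0 (- f))).
- exact: (frame_inverse ns).
- exact: (frame_isometry ns).
- by apply: inverse_mxM => //; exact: (frame_inverse ns1).
- apply: (isometryM FR _ (frame_isometry ns1)).
  rewrite /form_isometry star_block !(star0 barP); do 2!blk.
  rewrite opp_block_mx add_block_mx !oppr0 !addr0 mulmxN mulNmx.
  apply: LH_block_diag => //; rewrite -opprD; exact: LHN.
- exact: iota_form_GQ it ft.
Qed.

Lemma iota_form_hyp n p p' E (s : 'M_(n + n)) : nonsingular (hyp R n) p p' E ->
  GQ s -> eqK (iota_form p p' E s) (stab n s).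
Proof.
move=> ns gs; have := gs => /(GQ_isometry FR) [[s' is'] fs].
(* A second frame for [hyp + (- hyp)]: it exchanges the two middle summands and changes the sign of
   the last, which turns [- hyp] into [hyp]. In it [s + 1] is literally the stabilization of [s]. *)
pose Q : 'M[R]_((n + n) + (n + n)) :=
  block_mx (block_mx 1%:M 0 0 0) (block_mx 0 0 1%:M 0)
           (block_mx 0 1%:M 0 0) (block_mx 0 0 0 (- 1%:M)).
pose Q' : 'M[R]_((n + n) + (n + n)) :=
  block_mx (block_mx 1%:M 0 0 0) (block_mx 0 0 1%:M 0)
           (block_mx 0 1%:M 0 0) (block_mx 0 0 0 (- 1%:M)).
have one : 1%:M = block_mx (block_mx 1%:M 0 0 1%:M) 0 0 (block_mx 1%:M 0 0 1%:M) :> 'M[R]_((n + n) + (n + n)).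
  by rewrite -!scalar_mx_block.
have iQ : inverse_mx Q Q'.
  by split; rewrite /Q /Q' one; do 3!blk; rewrite ?mulmxN ?mulNmx ?mulmx1 ?opprK ?block_mx0.
have E1 : stab n s = Q' *m block_mx s 0 0 1%:M *m Q.
  rewrite -[s]submxK stab_block /Q /Q' [X in _ *m block_mx _ 0 0 X *m _](scalar_mx_block n n).
  do 4!blk; rewrite ?mulmxN ?mulNmx ?mulmx1 ?mul1mx ?opprK ?oppr0 //.
apply: (eqK_sym FR); [exact: stab_GQ | exact: (iota_form_GQ ns is' fs) |].
rewrite E1; apply: (frame_change (F := block_mx (hyp R n) 0 0 (- hyp R n))).
- exact: (frame_inverse ns).
- exact: (frame_isometry ns).
- exact: iQ.
- rewrite /form_isometry /Q /hyp !star_block !(starN barP, star0 barP, star1 barP).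
  rewrite opp_block_mx oppr0; do 4!blk.
  rewrite ?mulmxN ?mulNmx ?mulmx1 ?opprK ?oppr0 ?block_mx0 ?mulmx0 -scalar_mx_block subrr.
  exact: LH0.
- exact: (iota_form_GQ ns is' fs).
Qed.

Lemma iota_form_sum m n (p p' E : 'M_m) (q q' D : 'M_n) t : inverse_mx q q' ->
  iota_form (block_mx p 0 0 q) (block_mx p' 0 0 q') (block_mx E 0 0 D) (block_mx t 0 0 1%:M)
  = stab n (iota_form p p' E t).
Proof.
move=> [qq _].
rewrite !iota_formE stab_block (scalar_mx_block m n) !opp_block_mx !add_block_mx subrr !oppr0 !addr0.
do 4!blk; rewrite ?add_block_mx ?addr0 ?add0r ?subrr; do 2!blk.
by rewrite qq.
Qed.
End Isometries.

(** * The lattice E_8 *)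

Section IntegerMatrices.
Definition rows_entry (s : seq (seq int)) (i j : nat) : int := nth 0 (nth [::] s i) j.
Definition rows_mx m n (s : seq (seq int)) : 'M[int]_(m, n) :=
  \matrix_(i, j) rows_entry s i j.

(** Matrices are finite functions and do not evaluate well; a product of lists of rows can be
    checked by [vm_compute]. *)
Definition rows_mulb (m n p : nat) (s t u : seq (seq int)) :=
  all (fun i => all (fun j =>
    foldr +%R 0 [seq rows_entry s i k * rows_entry t k j | k <- iota 0 n]
      == rows_entry u i j) (iota 0 p)) (iota 0 m).

Lemma rows_mulP m n p s t u : rows_mulb m n p s t u ->
  rows_mx m n s *m rows_mx n p t = rows_mx m p u.
Proof.
move=> /allP h; apply/matrixP => i j.
have /h /allP/(_ (val j)) : val i \in iota 0 m by rewrite mem_iota /=.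
rewrite mem_iota /= ltn_ord => /(_ isT) /eqP.
rewrite foldrE big_map !mxE => <-.
rewrite -[iota 0 n](_ : index_iota 0 n = _); last by rewrite /index_iota subn0.
by rewrite big_mkord; apply: eq_bigr => k _; rewrite !mxE.
Qed.

Lemma tr_rows_mx m n s t :
  all (fun i => all (fun j => rows_entry s i j == rows_entry t j i) (iota 0 n)) (iota 0 m) ->
  (rows_mx m n s)^T = rows_mx n m t.
Proof.
move=> /allP h; apply/matrixP => j i; rewrite !mxE.
have /h /allP/(_ (val j)) : val i \in iota 0 m by rewrite mem_iota /=.
by rewrite mem_iota /= ltn_ord => /(_ isT) /eqP.
Qed.

Lemma rows_mx_add m n s t u :
  all (fun i => all (fun j => rows_entry s i j + rows_entry t i j == rows_entry u i j)
    (iota 0 n)) (iota 0 m) ->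
  rows_mx m n s + rows_mx m n t = rows_mx m n u.
Proof.
move=> /allP h; apply/matrixP => i j; rewrite !mxE.
have /h /allP/(_ (val j)) : val i \in iota 0 m by rewrite mem_iota /=.
by rewrite mem_iota /= ltn_ord => /(_ isT) /eqP.
Qed.

Lemma rows_mx1 n s :
  all (fun i => all (fun j => rows_entry s i j == (i == j)%:R) (iota 0 n)) (iota 0 n) ->
  rows_mx n n s = 1%:M.
Proof.
move=> /allP h; apply/matrixP => i j; rewrite !mxE.
have /h /allP/(_ (val j)) : val i \in iota 0 n by rewrite mem_iota /=.
by rewrite mem_iota /= ltn_ord => /(_ isT) /eqP.
Qed.

Let id_rows n := [seq [seq (i == j)%:R : int | j <- iota 0 n] | i <- iota 0 n].

Lemma rows_mul1 n s t :
  rows_mulb n n n s t (id_rows n) ->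
  all (fun i => all (fun j => rows_entry (id_rows n) i j == (i == j)%:R) (iota 0 n)) (iota 0 n) ->
  rows_mx n n s *m rows_mx n n t = 1%:M.
Proof. by move=> /rows_mulP -> /rows_mx1. Qed.

Let half_rows : seq (seq int) :=
  [:: [:: 1; 0; 0; 1; 0; 0; 0; 0]; [:: 0; 1; -1; 0; 0; 0; 0; 0];
      [:: 0; 0; 1; -1; 0; 0; 0; 0]; [:: 0; 0; 0; 1; -1; 0; 0; 0];
      [:: 0; 0; 0; 0; 1; -1; 0; 0]; [:: 0; 0; 0; 0; 0; 1; -1; 0];
      [:: 0; 0; 0; 0; 0; 0; 1; -1]; [:: 0; 0; 0; 0; 0; 0; 0; 1]].
Let half_rows_tr : seq (seq int) :=
  [:: [:: 1; 0; 0; 0; 0; 0; 0; 0]; [:: 0; 1; 0; 0; 0; 0; 0; 0];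
      [:: 0; -1; 1; 0; 0; 0; 0; 0]; [:: 1; 0; -1; 1; 0; 0; 0; 0];
      [:: 0; 0; 0; -1; 1; 0; 0; 0]; [:: 0; 0; 0; 0; -1; 1; 0; 0];
      [:: 0; 0; 0; 0; 0; -1; 1; 0]; [:: 0; 0; 0; 0; 0; 0; -1; 1]].
Let gram_rows : seq (seq int) :=
  [:: [:: 2; 0; 0; 1; 0; 0; 0; 0]; [:: 0; 2; -1; 0; 0; 0; 0; 0];
      [:: 0; -1; 2; -1; 0; 0; 0; 0]; [:: 1; 0; -1; 2; -1; 0; 0; 0];
      [:: 0; 0; 0; -1; 2; -1; 0; 0]; [:: 0; 0; 0; 0; -1; 2; -1; 0];
      [:: 0; 0; 0; 0; 0; -1; 2; -1]; [:: 0; 0; 0; 0; 0; 0; -1; 2]].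
Let inv_rows : seq (seq int) :=
  [:: [:: 8; -5; -10; -15; -12; -9; -6; -3]; [:: -5; 4; 7; 10; 8; 6; 4; 2];
      [:: -10; 7; 14; 20; 16; 12; 8; 4]; [:: -15; 10; 20; 30; 24; 18; 12; 6];
      [:: -12; 8; 16; 24; 20; 15; 10; 5]; [:: -9; 6; 12; 18; 15; 12; 8; 4];
      [:: -6; 4; 8; 12; 10; 8; 6; 3]; [:: -3; 2; 4; 6; 5; 4; 3; 2]].
Let base_rows : seq (seq int) :=
  [:: [:: 3; 1; 0; 0; 0; 0; 0; 0; 0]; [:: 1; 1; 1; 0; 0; 0; 0; 0; 0];
      [:: 1; 1; -1; 1; 0; 0; 0; 0; 0]; [:: 1; 1; 0; -1; 1; 0; 0; 0; 0];
      [:: 1; 0; 0; 0; -1; 1; 0; 0; 0]; [:: 1; 0; 0; 0; 0; -1; 1; 0; 0];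
      [:: 1; 0; 0; 0; 0; 0; -1; 1; 0]; [:: 1; 0; 0; 0; 0; 0; 0; -1; 1];
      [:: 1; 0; 0; 0; 0; 0; 0; 0; -1]].
Let base_rows_tr := [seq [seq rows_entry base_rows j i | j <- iota 0 9] | i <- iota 0 9].
Let base_inv_rows : seq (seq int) :=
  [:: [:: 3; -1; -1; -1; -1; -1; -1; -1; -1]; [:: -8; 3; 3; 3; 3; 3; 3; 3; 3];
      [:: 5; -1; -2; -2; -2; -2; -2; -2; -2]; [:: 10; -3; -3; -4; -4; -4; -4; -4; -4];
      [:: 15; -5; -5; -5; -6; -6; -6; -6; -6]; [:: 12; -4; -4; -4; -4; -5; -5; -5; -5];
      [:: 9; -3; -3; -3; -3; -3; -4; -4; -4]; [:: 6; -2; -2; -2; -2; -2; -2; -3; -3];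
      [:: 3; -1; -1; -1; -1; -1; -1; -1; -2]].
Let diag_rows : seq (seq int) :=
  [seq [seq if i == j then (if i == 0%N then -1 else 1) else 0 : int | j <- iota 0 9] | i <- iota 0 9].
Let base_rows_tr_diag :=
  [seq [seq (if j == 0%N then - rows_entry base_rows j i else rows_entry base_rows j i)
    | j <- iota 0 9] | i <- iota 0 9].
Let split_rows : seq (seq int) :=
  (-1 :: nseq 8 0) :: [seq 0 :: r | r <- gram_rows].

(* [e8] is the Gram matrix [e8_half + e8_half^T] of the roots
   [e_0 + e_1 + e_2 + e_3] and [e_i - e_(i+1)], a basis of the orthogonal of
   [v = 3 e_0 + e_1 + ... + e_8], of norm [-1], in the lattice Z^(8,1) with
   form [diag(-1, 1, ..., 1)]; the columns of [e8_base] are [v] and the roots. *)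
Definition e8 : 'M[int]_8 := rows_mx 8 8 gram_rows.
Definition e8_half : 'M[int]_8 := rows_mx 8 8 half_rows.
Definition e8_inv : 'M[int]_8 := rows_mx 8 8 inv_rows.
Definition e8_base : 'M[int]_(1 + 8) := rows_mx 9 9 base_rows.
Definition e8_base_inv : 'M[int]_(1 + 8) := rows_mx 9 9 base_inv_rows.

Lemma e8_halfD : e8_half + e8_half^T = e8.
Proof.
rewrite (@tr_rows_mx 8 8 _ half_rows_tr); last by vm_compute.
by apply: rows_mx_add; vm_compute.
Qed.

Lemma e8_tr : e8^T = e8.
Proof. by apply: tr_rows_mx; vm_compute. Qed.

Lemma e8_inverse : inverse_mx e8 e8_inv.
Proof. by split; apply: rows_mul1; vm_compute. Qed.

Lemma e8_base_inverse : inverse_mx e8_base e8_base_inv.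
Proof. by split; apply: (@rows_mul1 9); vm_compute. Qed.

(** An explicit instance of the uniqueness of odd indefinite unimodular lattices of given signature,
    here (8, 1). By [e8_base_inverse] the change of basis is integral in both directions. *)
Lemma e8_base_gram : e8_base^T *m block_mx (-1)%:M 0 0 1%:M *m e8_base =
  block_mx (-1)%:M 0 0 e8.
Proof.
have -> : block_mx (-1)%:M 0 0 1%:M = rows_mx 9 9 diag_rows :> 'M[int]_(1 + 8).
  apply/matrixP => i j.
  by case: (split_ordP i) => i' ->; case: (split_ordP j) => j' ->;
    rewrite ?(block_mxEul, block_mxEur, block_mxEdl, block_mxEdr) !mxE;
    move: i' j' => [[|[|[|[|[|[|[|[|?]]]]]]]] ?] // [[|[|[|[|[|[|[|[|?]]]]]]]] ?].
have -> : block_mx (-1)%:M 0 0 e8 = rows_mx 9 9 split_rows :> 'M[int]_(1 + 8).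
  apply/matrixP => i j.
  by case: (split_ordP i) => i' ->; case: (split_ordP j) => j' ->;
    rewrite ?(block_mxEul, block_mxEur, block_mxEdl, block_mxEdr) !mxE;
    move: i' j' => [[|[|[|[|[|[|[|[|?]]]]]]]] ?] // [[|[|[|[|[|[|[|[|?]]]]]]]] ?].
rewrite /e8_base (@tr_rows_mx 9 9 _ base_rows_tr); last by vm_compute.
by rewrite (@rows_mulP 9 9 9 _ _ base_rows_tr_diag) ?(@rows_mulP 9 9 9 _ _ split_rows) //; vm_compute.
Qed.
End IntegerMatrices.

Lemma nilpotent_inverse (R : pzRingType) (x : R) k : x ^+ k = 0 ->
  let y := \sum_(i < k) (- x) ^+ i in (1 + x) * y = 1 /\ y * (1 + x) = 1.
Proof.
move=> xk y; have right_inv : (1 + x) * y = 1.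
  have := subrX1 (- x) k; rewrite exprNn xk mulr0 sub0r => /(congr1 (fun z => - z)).
  by rewrite opprK -mulNr opprB opprK.
have : GRing.comm (1 + x) y.
  by apply: commr_sum => i _; apply: commrX; apply: commrN; apply/commr_sym/commrD;
    [exact: commr1 | exact: commr_refl].
by rewrite /GRing.comm => <-.
Qed.

(** * Tensor products of a unary form with integral lattices, and the comparison of iota with H *)

Section IntegerForms.
Variables (R : pzRingType) (bar : R -> R) (lam : R) (L : R -> Prop).
Hypothesis FR : is_form_ring bar lam L.
Local Notation st := (starmx bar).
Local Notation LH := (Lambda_hermitian bar lam L).
Local Notation GQ := (GQ bar lam L).
Local Notation eqK := (eqK bar lam L).
Local Notation hypmx := (hypmx bar).
Local Notation form_isometry := (form_isometry bar lam L).
Local Notation nonsingular := (nonsingular bar lam).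

Let barP : is_involution bar := form_bar FR.
Let lamC : forall x, lam * x = x * lam := form_lam_central FR.

(** The tensor product of a ring element with an integer matrix. Integers are central and fixed by
    [bar], so products, conjugate transposes and forms can be computed factor by factor. *)
Definition intscale m n (x : R) (D : 'M[int]_(m, n)) : 'M[R]_(m, n) :=
  x *: map_mx intr D.
Local Notation sc := intscale.

Lemma bar_int (z : int) : bar z%:~R = z%:~R.
Proof.
have h (k : nat) : bar k%:R = k%:R.
  by elim: k => [|k IH]; rewrite ?(bar0 barP) // mulrS (bar_add barP) IH (bar1 barP).
by case: z => k; rewrite ?NegzE ?mulrNz ?(barN barP) -pmulrn h.
Qed.

Lemma intscaleM m n p x y (A : 'M_(m, n)) (B : 'M_(n, p)) :
  sc x A *m sc y B = sc (x * y) (A *m B).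
Proof.
rewrite /sc map_mxM /= -scalemxAl -scalerA; congr (_ *: _).
apply/matrixP=> i j; rewrite !mxE big_distrr /=; apply: eq_bigr => k _.
by rewrite !mxE !mulrA (commr_int y (A i k)).
Qed.

Lemma intscale_star m n x (A : 'M_(m, n)) : st (sc x A) = sc (bar x) A^T.
Proof.
by apply/matrixP=> i j; rewrite !mxE (bar_mul barP) bar_int -commr_int.
Qed.

Lemma intscale1 n x : sc x (1%:M : 'M_n) = x%:M.
Proof. by rewrite /sc map_mx1 scalemx1. Qed.

Lemma intscale0 m n x : sc x (0 : 'M_(m, n)) = 0.
Proof. by rewrite /sc map_mx0 scaler0. Qed.

Lemma intscaleD m n x (A B : 'M_(m, n)) : sc x (A + B) = sc x A + sc x B.
Proof. by rewrite /sc map_mxD scalerDr. Qed.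

Lemma intscaleDl m n x y (A : 'M_(m, n)) : sc (x + y) A = sc x A + sc y A.
Proof. by rewrite /sc scalerDl. Qed.

Lemma intscaleN m n x (A : 'M_(m, n)) : sc x (- A) = sc (- x) A.
Proof. by rewrite /sc map_mxN scalerN scaleNr. Qed.

Lemma intscale_block m1 m2 n1 n2 x (A : 'M_(m1, n1)) (B : 'M_(m1, n2))
    (C : 'M_(m2, n1)) (D : 'M_(m2, n2)) :
  sc x (block_mx A B C D) = block_mx (sc x A) (sc x B) (sc x C) (sc x D).
Proof. by rewrite /sc map_block_mx scale_block_mx. Qed.

Lemma intscaleX n x (A : 'M_n) k : sc x A ^+ k = sc (x ^+ k) (A ^+ k).
Proof.
elim: k => [|k IH]; first by rewrite !expr0 intscale1.
by rewrite !exprS IH; exact: intscaleM.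
Qed.

Lemma intscale_inverse n x y (A B : 'M_n) : x * y = 1 -> y * x = 1 ->
  inverse_mx A B -> inverse_mx (sc x A) (sc y B).
Proof. by move=> xy yx [h h']; split; rewrite intscaleM ?h ?h' ?xy ?yx intscale1. Qed.

Lemma form_int x (z : int) : L x -> L (x * z%:~R).
Proof.
move=> h; have hn k : L (x *+ k).
  elim: k => [|k IH]; first by rewrite mulr0n; exact: formpar0 FR.
  rewrite mulrS. exact: (formparD FR h IH).
rewrite mulrzr; case: z => k; first exact: hn.
by rewrite NegzE mulrNz; apply: (formparN FR); exact: hn.
Qed.

Lemma intscale_LH n x (D : 'M_n) : L x -> D^T = D -> LH (sc x D).
Proof.
move=> h s; split=> [|i]; last by rewrite !mxE; exact: form_int.
by rewrite intscale_star s /sc scalerA -scaleNr -(form_max FR h).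
Qed.

Variables (f p p' E t t' : R).
Hypotheses (f_polar : f + lam * bar f = p) (pp' : p * p' = 1) (p'p : p' * p = 1).
Hypotheses (pE : p * E = f) (tt' : t * t' = 1) (t't : t' * t = 1).
Hypothesis t_isom : L (bar t * f * t - f).

Lemma intscale_nonsingular n (D D' : 'M_n) : D^T = D -> inverse_mx D D' ->
  nonsingular (sc f D) (sc p D) (sc p' D') (sc E 1%:M).
Proof.
move=> s i; split.
- by rewrite /polar intscale_star s /sc scalerA -scalerDl f_polar.
- exact: intscale_inverse.
- by rewrite intscaleM pE mulmx1.
Qed.

(** For an idempotent [e] this is [t] on the image of [e] and the identity on the image of
    [1 - e]. *)
Definition slot n (e : 'M[int]_n) : 'M[R]_n := 1%:M + sc (t - 1) e.
Definition slot' n (e : 'M[int]_n) : 'M[R]_n := 1%:M + sc (t' - 1) e.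

Lemma slotM n (e e' : 'M_n) : e *m e' = 0 -> slot e *m slot e' = slot (e + e').
Proof.
move=> h; rewrite /slot mulmxDr mulmx1 mulmxDl mul1mx intscaleM h intscale0 addr0.
by rewrite intscaleD addrA.
Qed.

Lemma slot_inverse n (e : 'M_n) : e *m e = e -> inverse_mx (slot e) (slot' e).
Proof.
have gen x y : x * y = 1 -> e *m e = e ->
    (1%:M + sc (x - 1) e) *m (1%:M + sc (y - 1) e) = 1%:M.
  move=> h h2; rewrite mulmxDr mulmx1 mulmxDl mul1mx intscaleM h2 -addrA -!intscaleDl.
  have -> : x - 1 + (y - 1 + (x - 1) * (y - 1)) = 0.
    by rewrite mulrBl mul1r [y - 1 + _]addrC addrNK mulrBr h mulr1 addrA addrNK subrr.
  by rewrite /sc scale0r addr0.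
by move=> h; split; apply: gen.
Qed.

Lemma slot_isometry n (D e : 'M_n) : D^T = D -> e^T = e -> e *m e = e ->
  D *m e = e *m D -> form_isometry (sc f D) (sc f D) (slot e).
Proof.
move=> sD se ee De; rewrite /form_isometry.
suff -> : st (slot e) *m sc f D *m slot e - sc f D =
    sc (bar t * f * t - f) (D *m e).
  by apply: intscale_LH => //; rewrite trmx_mul sD se.
rewrite /slot (starD barP) (star1 barP) intscale_star se mulmxDl mul1mx.
rewrite intscaleM -De mulmxDr mulmx1 mulmxDl !intscaleM -mulmxA ee.
rewrite -[sc f D + _ + _]addrA [sc f D + _]addrC addrK -!intscaleDl; congr intscale.
rewrite -mulrDl (barB barP) (bar1 barP) mulrBl mul1r [f + _]addrC addrNK.
by rewrite mulrBr mulr1 addrC addrA addrNK.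
Qed.

Lemma slot0 n : slot (0 : 'M_n) = 1%:M.
Proof. by rewrite /slot intscale0 addr0. Qed.

Lemma slot1 n : slot (1%:M : 'M_n) = t%:M.
Proof. by rewrite /slot intscale1 -raddfD /= addrC addrNK. Qed.

Lemma slot'1 n : slot' (1%:M : 'M_n) = t'%:M.
Proof. by rewrite /slot' intscale1 -raddfD /= addrC addrNK. Qed.

(** Its class is the iota class of [t] acting on the part of [f] times the lattice [D] cut out by
    [e]; the part is orthogonal to its complement when [e] is symmetric and commutes with [D]. *)
Definition J n (D D' e : 'M[int]_n) :=
  iota_form (sc p D) (sc p' D') (sc E 1%:M) (slot e).

Lemma J_GQ n (D D' e : 'M_n) : D^T = D -> inverse_mx D D' ->
  e^T = e -> e *m e = e -> D *m e = e *m D -> GQ (J D D' e).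
Proof.
move=> sD iD se ee De.
exact: (iota_form_GQ FR (intscale_nonsingular sD iD) (slot_inverse ee) (slot_isometry sD se ee De)).
Qed.

Lemma JM n (D D' e e' : 'M_n) : D^T = D -> inverse_mx D D' -> e *m e' = 0 ->
  J D D' e *m J D D' e' = J D D' (e + e').
Proof.
move=> sD iD h.
by rewrite /J -(iota_formM (intscale_nonsingular sD iD)) slotM.
Qed.

Lemma J_congr n (D D' D1 D1' e g g' : 'M_n) : D^T = D -> inverse_mx D D' ->
  inverse_mx D1 D1' -> inverse_mx g g' -> g^T *m D *m g = D1 ->
  e^T = e -> e *m e = e -> D *m e = e *m D ->
  eqK (J D1 D1' (g' *m e *m g)) (J D D' e).
Proof.
move=> sD iD iD1 ig gD se ee De.
have sD1 : D1^T = D1 by rewrite -gD !trmx_mul trmxK sD mulmxA.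
have -> : J D1 D1' (g' *m e *m g) =
    iota_form (sc p D1) (sc p' D1') (sc E 1%:M) (sc 1 g' *m slot e *m sc 1 g).
  congr iota_form; rewrite /slot mulmxDr mulmxDl mulmx1 !intscaleM !mul1r mulr1 ig.2.
  by rewrite intscale1.
apply: (iota_form_congr FR (intscale_nonsingular sD iD) (intscale_nonsingular sD1 iD1)
  (intscale_inverse _ _ ig) _ (slot_inverse ee)); rewrite ?mulr1 //.
  rewrite /form_isometry intscale_star (bar1 barP) !intscaleM mul1r mulr1 gD subrr.
  exact: LH0 FR _.
exact: slot_isometry.
Qed.

Lemma J_stab m n (d d' e : 'M_m) (H H' : 'M_n) : inverse_mx H H' ->
  J (block_mx d 0 0 H) (block_mx d' 0 0 H') (block_mx e 0 0 0) = stab n (J d d' e).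
Proof.
move=> iH; have ip : inverse_mx (sc p H) (sc p' H') by exact: intscale_inverse.
rewrite /J -(iota_form_sum (sc p d) (sc p' d') (sc E 1%:M) (sc E 1%:M) (slot e) ip).
have -> : slot (block_mx e 0 0 0) = block_mx (slot e) 0 0 1%:M :> 'M_(m + n).
  by rewrite /slot intscale_block !intscale0 (scalar_mx_block m n) add_block_mx !addr0.
have -> : sc E 1%:M = block_mx (sc E 1%:M) 0 0 (sc E 1%:M) :> 'M_(m + n).
  by rewrite (scalar_mx_block m n) intscale_block !intscale0.
by rewrite !intscale_block !intscale0.
Qed.

Lemma hypmx_slot_GQ n (e : 'M_n) : e *m e = e -> GQ (hypmx (slot e) (slot' e)).
Proof. by move=> ee; apply: (GQ_hypmx FR); exact: slot_inverse. Qed.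

Lemma hypmx_slot_conj n (e g g' : 'M_n) : inverse_mx g g' -> e *m e = e ->
  eqK (hypmx (slot (g' *m e *m g)) (slot' (g' *m e *m g))) (hypmx (slot e) (slot' e)).
Proof.
move=> ig ee; have ig1 : inverse_mx (sc 1 g) (sc 1 g').
  by apply: intscale_inverse; rewrite ?mulr1.
have <- : sc 1 g' *m slot e *m sc 1 g = slot (g' *m e *m g).
  by rewrite /slot mulmxDr mulmxDl mulmx1 !intscaleM !mul1r mulr1 ig.2 intscale1.
have <- : sc 1 g' *m (slot' e *m sc 1 g) = slot' (g' *m e *m g).
  by rewrite /slot' mulmxDl mulmxDr mul1mx !intscaleM !mul1r mulr1 ig.2 intscale1 mulmxA.
rewrite -!(hypmxM FR).
exact: (eqK_conj FR (hypmx_slot_GQ ee) (GQ_hypmx FR ig1) (hypmx_inverse FR ig1)).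
Qed.

Lemma hypmx_slotM n (e e' : 'M_n) : e *m e' = 0 -> e' *m e = 0 ->
  hypmx (slot e) (slot' e) *m hypmx (slot e') (slot' e') =
  hypmx (slot (e + e')) (slot' (e + e')).
Proof.
move=> h h'; rewrite (hypmxM FR) slotM //; congr (hypmx _ _).
rewrite /slot' mulmxDr mulmx1 mulmxDl mul1mx intscaleM h' intscale0 addr0.
by rewrite intscaleD -addrA [sc _ e' + _]addrC.
Qed.

Lemma eqK_chain n (r s : nat -> 'M[R]_(n + n)) (u : 'M[R]_(n + n)) k : GQ u -> r 0%N = 1%:M ->
  (forall i, (i < k)%N -> r i.+1 = r i *m s i) ->
  (forall i, (i < k)%N -> GQ (s i)) -> (forall i, (i < k)%N -> eqK (s i) u) ->
  GQ (r k) /\ eqK (r k) (u ^+ k).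
Proof.
move=> gu r0; elim: k => [|k IH] rs gs su.
  by rewrite r0 expr0; split; [exact: (GQ1 FR) | exact: (eqK_refl FR (GQ1 FR n))].
have [|||gr er] := IH; try by move=> i ik; auto using ltnW.
rewrite rs // exprSr; have gsk := gs _ (ltnSn k); split; first exact: (GQM FR).
exact: (eqK_mul FR gr gsk (GQX FR _ gu) er (su _ (ltnSn k))).
Qed.

Local Notation Z9 := 'M[int]_(1 + 8).
Let D1 : Z9 := block_mx (-1)%:M 0 0 1%:M.
Let D8 : Z9 := block_mx (-1)%:M 0 0 e8.
Let D8' : Z9 := block_mx (-1)%:M 0 0 e8_inv.
Let last8 (e : 'M[int]_8) : Z9 := block_mx 0 0 0 e.
Let first1 : Z9 := block_mx 1%:M 0 0 0.

Let N1_inverse : inverse_mx ((-1)%:M : 'M[int]_1) (-1)%:M.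
Proof. by split; rewrite -scalar_mxM mulrNN mulr1. Qed.

Let D1_inverse : inverse_mx D1 D1.
Proof. by apply: inverse_mx_block; [exact: N1_inverse | exact: inverse_mx1]. Qed.

Let D8_inverse : inverse_mx D8 D8'.
Proof. by apply: inverse_mx_block; [exact: N1_inverse | exact: e8_inverse]. Qed.

Let D1_tr : D1^T = D1. Proof. by rewrite tr_block_mx !trmx0 !tr_scalar_mx. Qed.
Let D8_tr : D8^T = D8. Proof. by rewrite tr_block_mx !trmx0 tr_scalar_mx e8_tr. Qed.

Let last8_comm (e : 'M_8) : D1 *m last8 e = last8 e *m D1.
Proof. by do 2!blk. Qed.

Let last8M (e e' : 'M_8) : last8 e *m last8 e' = last8 (e *m e').
Proof. by blk. Qed.

Let J_one : 'M[R]_(1 + 1) := J 1%:M 1%:M 1%:M.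

Let J_one_GQ : GQ J_one.
Proof. by apply: J_GQ; rewrite ?trmx1 ?mulmx1 //; exact: inverse_mx1. Qed.

(* The basis vectors [e_0] and [e_i] are exchanged to bring the i-th slot first. *)
Let X (i : 'I_8) : Z9 := tperm_mx (lshift 8 0) (rshift 1 i).

Let X_inverse i : inverse_mx (X i) (X i).
Proof. by split; rewrite /X /tperm_mx -perm_mxM tperm2 perm_mx1. Qed.

Let X_delta i a b : X i *m delta_mx a b *m X i =
  delta_mx (tperm (lshift 8 0) (rshift 1 i) a) (tperm (lshift 8 0) (rshift 1 i) b).
Proof.
rewrite -xrowE -xcolE; apply/matrixP=> x y; rewrite !mxE.
by rewrite !(can2_eq (tpermK _ _) (tpermK _ _)).
Qed.

Let last8_delta i : last8 (delta_mx i i) = delta_mx (rshift 1 i) (rshift 1 i).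
Proof.
by apply/matrixP=> a b; case: (split_ordP a) => a' ->; case: (split_ordP b) => b' ->;
  rewrite ?(block_mxEul, block_mxEur, block_mxEdl, block_mxEdr) !mxE !eq_shift ?andbF.
Qed.

Let first1_delta : first1 = delta_mx (lshift 8 0) (lshift 8 0).
Proof.
by apply/matrixP=> a b; case: (split_ordP a) => a' ->; case: (split_ordP b) => b' ->;
  rewrite ?(block_mxEul, block_mxEur, block_mxEdl, block_mxEdr) !mxE !eq_shift ?andbF // !ord1.
Qed.

Let X_last8 i : X i *m last8 (delta_mx i i) *m X i = first1.
Proof. by rewrite last8_delta X_delta tpermR first1_delta. Qed.

Let dd (i : 'I_8) : (delta_mx i i : 'M[int]_8) *m delta_mx i i = delta_mx i i.
Proof. by rewrite mul_delta_mx. Qed.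

Let slot_last8 (e : 'M_8) : e^T = e -> e *m e = e ->
  (last8 e)^T = last8 e /\ last8 e *m last8 e = last8 e.
Proof. by move=> h h'; rewrite tr_block_mx !trmx0 h last8M h'. Qed.

Let J_slot (i : 'I_8) : eqK (J D1 D1 (last8 (delta_mx i i))) (stab 8 J_one).
Proof.
(* Exchanging [e_0] with the i-th vector moves the entry -1 of the form to place i; [H] is the Gram
   matrix left beside the slot of norm 1. *)
pose H : 'M[int]_8 := 1%:M - delta_mx i i *+ 2.
have HH : inverse_mx H H.
  suff h : H *m H = 1%:M by [].
  rewrite /H mulr2n mulmxBl mul1mx mulmxBr mulmx1 mulmxDl !mulmxDr dd.
  by rewrite opprB addrK addrNK.
have XDX : (X i)^T *m D1 *m X i = block_mx 1%:M 0 0 H.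
  have -> : D1 = 1%:M - first1 *+ 2.
    rewrite /D1 /first1 (scalar_mx_block 1 8) mulr2n add_block_mx opp_block_mx add_block_mx.
    by rewrite !(addr0, oppr0) opprD addrA subrr add0r raddfN.
  rewrite tr_tperm_mx mulmxBr mulmx1 mulmxBl (X_inverse i).1 mulr2n mulmxDr mulmxDl.
  rewrite -(X_last8 i) !mulmxA (X_inverse i).1 mul1mx -!mulmxA (X_inverse i).1 mulmx1.
  rewrite /last8 (scalar_mx_block 1 8) add_block_mx opp_block_mx add_block_mx.
  by rewrite !(addr0, oppr0) -mulr2n.
have [h1 h2] := slot_last8 (trmx_delta _ i i) (dd i).
have iB : inverse_mx (block_mx 1%:M 0 0 H : Z9) (block_mx 1%:M 0 0 H).
  by apply: inverse_mx_block => //; exact: inverse_mx1.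
have := J_congr D1_tr D1_inverse iB (X_inverse i) XDX h1 h2 (last8_comm _).
rewrite X_last8 /first1 (J_stab _ _ _ HH) => h.
apply: (eqK_sym FR) h; last by apply: J_GQ D1_tr D1_inverse h1 h2 (last8_comm _).
exact: (stab_GQ FR).
Qed.

Let hypmx_slot (i : 'I_8) :
  eqK (hypmx (slot (last8 (delta_mx i i))) (slot' (last8 (delta_mx i i))))
      (stab 8 (hypmx (t%:M : 'M_1) t'%:M)).
Proof.
have [h1 h2] := slot_last8 (trmx_delta _ i i) (dd i).
have := hypmx_slot_conj (X_inverse i) h2; rewrite X_last8.
have -> : hypmx (slot first1) (slot' first1) = stab 8 (hypmx (t%:M : 'M_1) t'%:M).
  rewrite (stab_hypmx FR) -slot1 -slot'1 /slot /slot' /first1 intscale_block !intscale0.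
  by rewrite (scalar_mx_block 1 8) !add_block_mx !addr0 intscale_block !intscale0 add_block_mx !addr0.
move=> h; apply: (eqK_sym FR) h; last exact: hypmx_slot_GQ.
apply: (stab_GQ FR); apply: (GQ_hypmx FR).
by split; rewrite -scalar_mxM ?tt' ?t't.
Qed.

Let pid_delta (i : 'I_8) : pid_mx i.+1 = pid_mx i + delta_mx i i :> 'M[int]_8.
Proof.
apply/matrixP=> a b; rewrite !mxE -!val_eqE /= ltnS leq_eqVlt.
case: (eqVneq (nat_of_ord a) b) => [<-|ab] /=; first by rewrite andbb; case: ltngtP.
case: andP => // -[/eqP ai /eqP bi]; by rewrite ai bi eqxx in ab.
Qed.

Let pid_mul_delta (i : 'I_8) : pid_mx i *m delta_mx i i = 0 :> 'M[int]_8 /\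
  delta_mx i i *m pid_mx i = 0 :> 'M[int]_8.
Proof.
split; apply/matrixP=> a b; rewrite !mxE big1 // => c _; rewrite !mxE -!val_eqE /=.
  case: (val c =P i) => [->|_]; last by rewrite mulr0.
  by case: (val a =P i) => [->|_]; rewrite ?ltnn ?mul0r.
case: (val c =P i) => [->|_]; last by rewrite andbF mul0r.
by rewrite ltnn andbF mulr0.
Qed.

Let J_rest : GQ (J D1 D1 (last8 1%:M)) /\ eqK (J D1 D1 (last8 1%:M)) (stab 8 J_one ^+ 8).
Proof.
pose s i := J D1 D1 (last8 (delta_mx (inord i) (inord i))).
pose r k := J D1 D1 (last8 (pid_mx k)).
have <- : r 8%N = J D1 D1 (last8 1%:M) by rewrite /r pid_mx_1.
apply: (@eqK_chain _ r s).
- exact: (stab_GQ FR).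
- rewrite /r pid_mx_0 /last8 block_mx0 /J slot0.
  exact: (iota_form1 (intscale_nonsingular D1_tr D1_inverse)).
- move=> i i8; rewrite /r /s; set j : 'I_8 := inord i.
  have -> : i = j by rewrite inordK.
  rewrite pid_delta (JM D1_tr D1_inverse).
    by rewrite /last8 add_block_mx !addr0.
  by rewrite last8M (pid_mul_delta _).1 /last8 block_mx0.
- move=> i i8; have [h1 h2] := slot_last8 (trmx_delta _ (inord i) (inord i)) (dd (inord i)).
  exact: J_GQ D1_tr D1_inverse h1 h2 (last8_comm _).
by move=> i i8; exact: J_slot.
Qed.

Let hypmx_rest : GQ (hypmx (slot (last8 1%:M)) (slot' (last8 1%:M))) /\
  eqK (hypmx (slot (last8 1%:M)) (slot' (last8 1%:M)))
      (stab 8 (hypmx (t%:M : 'M_1) t'%:M) ^+ 8).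
Proof.
pose s i := hypmx (slot (last8 (delta_mx (inord i) (inord i))))
                  (slot' (last8 (delta_mx (inord i) (inord i)))).
pose r k := hypmx (slot (last8 (pid_mx k))) (slot' (last8 (pid_mx k))).
have <- : r 8%N = hypmx (slot (last8 1%:M)) (slot' (last8 1%:M)) by rewrite /r pid_mx_1.
apply: (@eqK_chain _ r s).
- apply: (stab_GQ FR); apply: (GQ_hypmx FR).
  by split; rewrite -scalar_mxM ?tt' ?t't.
- by rewrite /r pid_mx_0 /last8 block_mx0 slot0 /slot' intscale0 addr0 (hypmx1 FR).
- move=> i i8; rewrite /r /s; set j : 'I_8 := inord i.
  have -> : i = j by rewrite inordK.
  rewrite pid_delta hypmx_slotM ?last8M ?(pid_mul_delta _).1 ?(pid_mul_delta _).2 /last8 ?block_mx0 //.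
  by rewrite add_block_mx !addr0.
- move=> i i8; apply: hypmx_slot_GQ.
  by rewrite last8M dd.
by move=> i i8; exact: hypmx_slot.
Qed.

Let rest_ok (D := D8) : (last8 1%:M)^T = last8 1%:M /\ last8 1%:M *m last8 1%:M = last8 1%:M.
Proof. by apply: slot_last8; rewrite ?trmx1 ?mulmx1. Qed.

Let D8_last8 : D8 *m last8 1%:M = last8 1%:M *m D8.
Proof. by do 2!blk. Qed.

(* The lattices [<-1> + Z^8] and [<-1> + E_8] are isometric, and the classes of
   [t] on their first summands agree. *)
Let J_e8 : eqK (J D1 D1 (last8 1%:M)) (J D8 D8' (last8 1%:M)).
Proof.
have [r1 r2] := rest_ok.
have f1 : first1^T = first1 by rewrite tr_block_mx !trmx0 trmx1.
have f2 : first1 *m first1 = first1 by rewrite /first1; blk.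
have f3 H : block_mx (-1)%:M 0 0 H *m first1 = first1 *m block_mx (-1)%:M 0 0 H.
  by rewrite /first1; do 2!blk.
have fr : first1 *m last8 1%:M = 0 by rewrite /first1 /last8; blk; rewrite block_mx0.
have fD : first1 + last8 1%:M = 1%:M.
  by rewrite /first1 /last8 add_block_mx !addr0 !add0r -scalar_mx_block.
have g1 : GQ (J D1 D1 first1) by exact: (J_GQ D1_tr D1_inverse f1 f2 (f3 _)).
have g8 : GQ (J D8 D8' first1) by exact: (J_GQ D8_tr D8_inverse f1 f2 (f3 _)).
have h1 : GQ (J D1 D1 (last8 1%:M)) by exact: (J_GQ D1_tr D1_inverse r1 r2 (last8_comm _)).
have h8 : GQ (J D8 D8' (last8 1%:M)) by exact: (J_GQ D8_tr D8_inverse r1 r2 D8_last8).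
apply: (eqK_cancel FR g1 g8 h1 h8).
  rewrite /first1 (J_stab _ _ _ (inverse_mx1 _ 8)) (J_stab _ _ _ e8_inverse).
  apply: (eqK_refl FR); apply: (stab_GQ FR); apply: J_GQ; rewrite ?trmx1 ?mulmx1 ?mul1mx ?tr_scalar_mx //.
rewrite (JM D1_tr D1_inverse fr) (JM D8_tr D8_inverse fr) fD.
(* The idempotent 1 is fixed by every change of basis, so the isometry of lattices compares [t] on
   the two total spaces; no compatibility with the splittings is required. *)
have := J_congr D1_tr D1_inverse D8_inverse e8_base_inverse e8_base_gram (trmx1 _ _) (mulmx1 _) (etrans (mulmx1 _) (esym (mul1mx _))).
rewrite mulmx1 e8_base_inverse.2 => h; apply: (eqK_sym FR) h.
  by apply: (J_GQ D8_tr D8_inverse); rewrite ?trmx1 ?mulmx1 ?mul1mx.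
by apply: (J_GQ D1_tr D1_inverse); rewrite ?trmx1 ?mulmx1 ?mul1mx.
Qed.

Variable k : nat.
Hypothesis t_unipotent : (t - 1) ^+ k = 0.

(** For the representative [p] times [e8_half] of the form [f] times E_8, the endomorphism E is the
    integer matrix [W]. It commutes with [t - 1], so the upper left block [b0] is unipotent together
    with [t]. *)
Let W : 'M[int]_8 := e8_inv *m e8_half.
Let b0 : 'M[R]_8 := 1%:M + sc (t - 1) W.
Let b : 'M[R]_(1 + 8) := block_mx 1%:M 0 0 b0.

Let b_inverse : exists b', inverse_mx b b'.
Proof.
have [|h h'] := @nilpotent_inverse _ (sc (t - 1) W) k.
  by rewrite intscaleX t_unipotent /sc scale0r.
eexists (block_mx 1%:M 0 0 _); apply: inverse_mx_block; first exact: inverse_mx1.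
by split; [exact: h | exact: h'].
Qed.

Let lam_bar_p : lam * bar p = p.
Proof.
rewrite -f_polar (bar_add barP) (bar_mul barP) (bar_bar barP) mulrDr -(bar_lamC FR) mulrA.
by rewrite (lam_bar FR) mul1r addrC.
Qed.

Let J_hyp b' : inverse_mx b b' -> eqK (J D8 D8' (last8 1%:M)) (hypmx b b').
Proof.
move=> ib.
pose f1 : 'M[R]_(1 + 8) := block_mx (sc f (-1)%:M) 0 0 (sc p e8_half).
pose E1 : 'M[R]_(1 + 8) := block_mx (sc E 1%:M) 0 0 (sc 1 W).
have ns1 : nonsingular f1 (sc p D8) (sc p' D8') E1.
  split.
  - rewrite /f1 /polar star_block !(star0 barP) scale_block_mx add_block_mx !scaler0 !addr0.
    rewrite /D8 intscale_block !intscale0 !intscale_star tr_scalar_mx /sc !scalerA.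
    rewrite lam_bar_p -!scalerDl f_polar -scalerDr -map_mxD e8_halfD //.
  - exact: intscale_inverse.
  - rewrite /D8 /E1 /f1 intscale_block !intscale0; blk.
    by rewrite !intscaleM pE !mulmx1 mulr1 /W mulmxA e8_inverse.1 mul1mx.
have [r1 r2] := rest_ok.
have iso : form_isometry (sc f D8) f1 1%:M.
  rewrite /form_isometry (star1 barP) mul1mx mulmx1 /D8 /f1 intscale_block !intscale0.
  rewrite opp_block_mx add_block_mx !oppr0 !addr0 subrr.
  apply: (LH_block_diag FR); first exact: LH0 FR _.
  (* Evenness is used here: with [e8] split into a half and its transpose, the two representatives
     differ by a trace, hence by a Lambda-Hermitian matrix. *)
  have -> : sc f e8 - sc p e8_half = sc f e8_half^T - lam *: st (sc f e8_half^T).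
    rewrite intscale_star trmxK -e8_halfD intscaleD -f_polar intscaleDl.
    by rewrite opprD addrA [sc f e8_half + _]addrC addrK /sc scalerA.
  exact: LH_trace.
have := iota_form_congr FR (intscale_nonsingular D8_tr D8_inverse) ns1 (inverse_mx1 _ _) iso
  (slot_inverse r2) (slot_isometry D8_tr r1 r2 D8_last8).
rewrite mul1mx mulmx1 -/(J D8 D8' (last8 1%:M)).
have g8 : GQ (J D8 D8' (last8 1%:M)) by exact: (J_GQ D8_tr D8_inverse r1 r2 D8_last8).
have iso1 : form_isometry f1 f1 (slot (last8 1%:M)).
  have i1 := isometryV FR (inverse_mx1 R _) iso.
  have := isometryM FR (isometryM FR i1 (slot_isometry D8_tr r1 r2 D8_last8)) iso.
  by rewrite mul1mx mulmx1.
have g1 := iota_form_GQ FR ns1 (slot_inverse r2) iso1.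
move=> /(eqK_sym FR g1 g8) h; apply: (eqK_trans FR g1 h).
move: g1; rewrite iota_formE.
suff -> : 1%:M + E1 *m (slot (last8 1%:M) - 1%:M) = b by exact: (eqK_hypmx FR).
have -> : slot (last8 1%:M) - 1%:M = sc (t - 1) (last8 1%:M) by rewrite /slot [LHS]addrC addKr.
rewrite /E1 /last8 intscale_block !intscale0; blk.
rewrite intscaleM mulmx1 mul1r (scalar_mx_block 1 8) add_block_mx !addr0 //.
Qed.

Let bar_t_p : bar t * p * t = p.
Proof.
have h := form_max FR t_isom; rewrite /Lambda_max in h.
have e : bar (bar t * f * t - f) = bar t * bar f * t - bar f.
  by rewrite (barB barP) !(bar_mul barP) (bar_bar barP) mulrA.
have : bar t * f * t - f + lam * bar (bar t * f * t - f) = 0 by rewrite {1}h addNr.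
have e2 : lam * (bar t * bar f * t) = bar t * (lam * bar f) * t.
  by rewrite !mulrA (lamC (bar t)).
rewrite e mulrBr e2 addrACA -opprD -mulrDl -mulrDr f_polar => /eqP.
by rewrite subr_eq0 => /eqP.
Qed.

(** For the polar form the adjoint of [t] is [t'] and that of [W] is [1 - W]. So the adjoint of [b0]
    is [1 + (t' - 1)(1 - W)], and multiplying by [t] gives [t + (1 - t)(1 - W) = 1 + (t - 1) W]. *)
Let b_adjoint (P := block_mx 1%:M 0 0 (sc p e8)) (P' := block_mx 1%:M 0 0 (sc p' e8_inv)) :
  slot (last8 1%:M) *m (P' *m st b *m P) = b.
Proof.
have hp : p' * (bar t - 1) * p = t' - 1.
  rewrite mulrBr mulrBl mulr1 p'p; congr (_ - _).
  have e : bar t * p = p * t' by rewrite -{2}bar_t_p -mulrA tt' mulr1.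
  by rewrite -mulrA e mulrA p'p mul1r.
have hW : e8_inv *m W^T *m e8 = 1%:M - W.
  have s' : e8_inv^T = e8_inv.
    apply: (inverse_mx_uniq _ e8_inverse); have [i1 i2] := e8_inverse.
    by split; rewrite -{1}e8_tr -trmx_mul ?i1 ?i2 trmx1.
  rewrite /W trmx_mul s' -!mulmxA e8_inverse.2 mulmx1.
  apply/eqP; rewrite -subr_eq0 opprB addrA -mulmxDr addrC [_^T + _]addrC e8_halfD.
  by rewrite e8_inverse.2 addNr.
rewrite /P /P' /b star_block !(star0 barP) (star1 barP); do 2!blk.
rewrite /b0 (starD barP) (star1 barP) intscale_star mulmxDr mulmx1 mulmxDl !intscaleM hW p'p.
rewrite (barB barP) (bar1 barP) hp e8_inverse.2 intscale1.
rewrite /slot /last8 intscale_block !intscale0 (scalar_mx_block 1 8) add_block_mx !addr0; blk.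
congr block_mx; rewrite mulmxDl mul1mx mulmxDr mulmx1 intscaleM mul1mx -addrA; congr (_ + _).
have e : t' - 1 + (t - 1) * (t' - 1) = - (t - 1).
  by rewrite mulrBl mul1r addrC addrNK mulrBr tt' mulr1 opprB.
by rewrite addrCA -intscaleDl e -intscaleN opprB -intscaleD [1%:M + _]addrC addrNK.
Qed.

Let hypmx_square b' : inverse_mx b b' -> eqK (hypmx b b' *m hypmx b b')
  (hypmx (slot (last8 1%:M)) (slot' (last8 1%:M))).
Proof.
move=> ib; have [r1 r2] := rest_ok.
pose P := block_mx 1%:M 0 0 (sc p e8) : 'M[R]_(1 + 8).
pose P' := block_mx 1%:M 0 0 (sc p' e8_inv) : 'M[R]_(1 + 8).
have iP : inverse_mx P P'.
  by apply: inverse_mx_block; [exact: inverse_mx1 | exact: intscale_inverse e8_inverse].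
have isb := star_inverse barP ib.
pose S := hypmx (slot (last8 1%:M)) (slot' (last8 1%:M)).
pose Bs := hypmx (st b) (st b'); pose Bs' := hypmx (st b') (st b).
pose G := hypmx (P' *m st b *m P) (P' *m (st b' *m P)).
have gS : GQ S by exact: hypmx_slot_GQ.
have gBs : GQ Bs by exact: (GQ_hypmx FR isb).
have gBs' : GQ Bs' by exact: (GQ_hypmx FR (inverse_mxC isb)).
have gB : GQ (hypmx b b') by exact: (GQ_hypmx FR ib).
have iG : inverse_mx (P' *m st b *m P) (P' *m (st b' *m P)).
  exact: (inverse_mxM (inverse_mxM (inverse_mxC iP) isb) iP).
have gG : GQ G by exact: (GQ_hypmx FR iG).
have EG : G = hypmx P' P *m Bs *m hypmx P P' by rewrite !(hypmxM FR).
(* The adjoint of [b] is conjugate to the conjugate transpose, whose class is opposite to that of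
   [b] by [hypmx_star]; hence [G] cancels one of the two factors H(b). *)
have GBs : eqK G Bs.
  by rewrite EG; exact: (eqK_conj FR gBs (GQ_hypmx FR iP) (hypmx_inverse FR iP)).
have BSG : hypmx b b' = S *m G.
  rewrite /S /G (hypmxM FR) b_adjoint; congr (hypmx _ _).
  apply: (inverse_mx_uniq ib); rewrite -{1}b_adjoint.
  by apply: inverse_mxM (slot_inverse r2) iG.
have BBs : eqK (hypmx b b') Bs' by apply: (eqK_sym FR) (hypmx_star FR ib).
have GB : eqK (G *m hypmx b b') 1%:M.
  have <- : Bs *m Bs' = 1%:M by rewrite (hypmxM FR) isb.1 (hypmx1 FR).
  exact: (eqK_mul FR gG gB gBs GBs BBs).
rewrite {1}BSG -mulmxA -[X in eqK _ X]mulmx1.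
exact: (eqK_mul FR gS (GQM FR gG gB) gS (eqK_refl FR gS) GB).
Qed.

Lemma unipotent_hyperbolic :
  eqK (iota_form (p%:M : 'M_1) p'%:M E%:M t%:M ^+ 16) (hypmx (t%:M : 'M_1) t'%:M ^+ 8).
Proof.
have -> : iota_form (p%:M : 'M_1) p'%:M E%:M t%:M = J_one.
  by rewrite /J_one /J slot1 !intscale1.
have [b' ib] := b_inverse.
have [gJ eJ] := J_rest; have [gh eh] := hypmx_rest.
have [r1 r2] := rest_ok.
have g8 : GQ (J D8 D8' (last8 1%:M)) by exact: (J_GQ D8_tr D8_inverse r1 r2 D8_last8).
have gb : GQ (hypmx b b') by exact: (GQ_hypmx FR).
have gH : GQ (hypmx (t%:M : 'M_1) t'%:M).
  by apply: (GQ_hypmx FR); split; rewrite -scalar_mxM ?tt' ?t't.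
have gs1 := stab_GQ FR 8 J_one_GQ; have gs2 := stab_GQ FR 8 gH.
have gX1 := GQX FR 8 gs1; have gX2 := GQX FR 8 gs2.
have h1 : eqK (stab 8 J_one ^+ 8) (hypmx b b').
  apply: (eqK_trans FR gJ); first exact: (eqK_sym FR).
  exact: (eqK_trans FR g8 J_e8 (J_hyp ib)).
have h2 := eqKX FR 2 gX1 gb h1; rewrite -exprM /= in h2.
apply: (iffLR (@eqK_stab _ _ _ _ FR _ 8 _ _ (GQX FR 16 J_one_GQ))); rewrite !stab_expr.
have gb2 := GQX FR 2 gb.
apply: (eqK_trans FR gb2 h2); rewrite expr2 in gb2 *.
exact: (eqK_trans FR gh (hypmx_square ib) eh).
Qed.
End IntegerForms.

(** * Roots of unipotents *)

Section UnipotentRoots.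
(** [P] is a commutative subring. Constructing the root inside it allows bicommutants to be used, so
    that the root inherits whatever commutation the nilpotent element has. *)
Variables (A : pzRingType) (P : A -> Prop).
Hypotheses (P1 : P 1) (P_sub : forall x y, P x -> P y -> P (x - y))
  (P_mul : forall x y, P x -> P y -> P (x * y))
  (P_comm : forall x y, P x -> P y -> x * y = y * x).

Let PB x y (hx : P x) (hy : P y) : P (x - y) := P_sub hx hy.
Let PM x y (hx : P x) (hy : P y) : P (x * y) := P_mul hx hy.
Let PC x y (hx : P x) (hy : P y) : x * y = y * x := P_comm hx hy.

Let P0 : P 0. Proof. by rewrite -(subrr 1); exact: PB. Qed.
Let PN x : P x -> P (- x). Proof. by rewrite -sub0r; exact: PB. Qed.
Let PD x y : P x -> P y -> P (x + y).
Proof. by move=> hx hy; rewrite -[y]opprK; apply: PB => //; exact: PN. Qed.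
Let PX x n : P x -> P (x ^+ n).
Proof. by move=> h; elim: n => [|n IH]; rewrite ?expr0 ?exprS //; exact: PM. Qed.

Lemma binomial_remainder x k : P x ->
  exists2 w, P w & (1 + x) ^+ k = 1 + x *+ k + x ^+ 2 * w.
Proof.
move=> Px; elim: k => [|k [w Pw IH]].
  by exists 0; rewrite ?expr0 ?mulr0n ?mulr0 ?addr0.
exists (1 *+ k + w + w * x).
  apply: PD; last exact: PM.
  by apply: PD => //; elim: k {IH} => [|k IH]; rewrite ?mulr0n // mulrS; exact: PD.
rewrite exprSr IH mulrDr mulr1 2![in LHS]mulrDl mul1r mulrSr.
rewrite [in RHS]mulrDr [in RHS]mulrDr mulr_natr mulrA.
have -> : x *+ k * x = x ^+ 2 *+ k by rewrite expr2 mulrnAl.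
rewrite !addrA; congr (_ + _).
rewrite -!addrA; congr (_ + (_ + _)).
by rewrite addrCA [x + _]addrC; rewrite addrA [_ + x]addrC; rewrite addrCA addrC -addrA.
Qed.

Let P_nat n : P n%:R.
Proof. by elim: n => [|n IH]; rewrite ?mulr0n // mulrS; exact: PD. Qed.

Let P_inverse x m : P x -> x ^+ m = 0 -> exists2 y, P y & (1 + x) * y = 1.
Proof.
move=> Px /nilpotent_inverse [h _]; eexists; last exact: h.
by elim/big_ind: _ => // i _; apply: PX; exact: PN.
Qed.

(* Newton's iteration: [1 + N^j z = (1 + c N^j z)^k (1 + N^(j+1) z')]. *)
Lemma unipotent_root (N c : A) k m : P N -> P c -> k%:R * c = 1 -> N ^+ m = 0 ->
  exists T y, [/\ P y, T = 1 + N * y & T ^+ k = 1 + N].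
Proof.
move=> PN' Pc kc Nm.
have nil x i : P x -> (N ^+ i.+1 * x) ^+ m = 0.
  move=> Px; rewrite exprMn_comm; last by apply: PC => //; exact: PX.
  by rewrite exprAC Nm exprS mul0r mul0r.
(* [d] bounds the number of iterations left; at [d = 0] the inequality gives [N ^+ j.+1 = 0] and the
   root is 1. *)
suff h d j z : P z -> (m <= d + j.+1)%N ->
    exists T y, [/\ P y, T = 1 + N * y & T ^+ k = 1 + N ^+ j.+1 * z].
  by have := h m 0%N 1 P1; rewrite expr1 mulr1 addn1; apply; exact: leqnSn.
elim: d j z => [|d IH] j z Pz mj.
  exists 1, 0; split=> //; rewrite ?mulr0 ?addr0 // expr1n.
  by rewrite add0n in mj; rewrite -(subnKC mj) exprD Nm !mul0r addr0.
pose a := N ^+ j.+1 * z * c.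
have PNj : P (N ^+ j.+1) by exact: PX.
have Pa : P a by apply: PM => //; exact: PM.
have [w Pw Ew] := binomial_remainder k Pa.
have an : a *+ k = N ^+ j.+1 * z.
  by rewrite /a -mulrnAr -[c]mulr1 -mulrnAr -(PC _ Pc) // kc mulr1.
have [i Pi Ei] : exists2 y, P y & (1 + a) * y = 1.
  by apply: (P_inverse Pa (m := m)); rewrite /a -mulrA; apply: nil; exact: PM.
(* The error [a ^+ 2 * w] must be divisible by [N ^+ j.+2]: one factor [a] supplies [N ^+ j.+1], the
   other, equal to [N * a1], one more [N]. *)
pose a1 := N ^+ j * z * c; pose q := z * c * a1 * w.
have Pa1 : P a1 by exact: (PM (PM (PX j PN') Pz) Pc).
have aN : a = N * a1 by rewrite /a /a1 exprS -!mulrA.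
have Pq : P q by exact: (PM (PM (PM Pz Pc) Pa1) Pw).
have a2 : a ^+ 2 * w = N ^+ j.+2 * q.
  have -> : a ^+ 2 * w = N ^+ j.+1 * (z * c * N) * a1 * w by rewrite expr2 {2}aN /a !mulrA.
  by rewrite (PC (PM Pz Pc) PN') /q [in RHS]exprSr !mulrA.
have Pk : P ((1 + a) ^+ k) by apply: PX; exact: PD.
have ik : (1 + a) ^+ k * i ^+ k = 1.
  by rewrite -exprMn_comm ?Ei ?expr1n //; apply: PC => //; exact: PD.
have [||T [y [Py ET ETk]]] := IH j.+1 (- (i ^+ k * q)); last 1 first.
- exists ((1 + a) * T), (y + (a1 + a1 * (N * y))); split.
  + exact: (PD Py (PD Pa1 (PM Pa1 (PM PN' Py)))).
  + by rewrite ET aN mulrDl mul1r !mulrDr !mulr1 !mulrA !addrA.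
  rewrite exprMn_comm; last first.
    by apply: PC; rewrite ?ET; apply: PD => //; exact: PM.
  rewrite ETk mulrDr mulr1 !mulrN mulrA (PC Pk (PX j.+2 PN')) -mulrA [_ ^+ k * (_ * q)]mulrA.
  by rewrite ik mul1r Ew a2 addrK an.
- by apply: PN; apply: PM => //; exact: PX.
- by rewrite addnS -addSn.
Qed.
End UnipotentRoots.

(** * Band matrices and evaluation at shifts *)

Section BandMatrices.
Variables (A : pzRingType) (m : nat).
Implicit Types Z W : 'M[A]_m.

(** The identities between shifts hold exactly for one-sided infinite matrices and up to errors near
    the boundary for finite ones. Counting subdiagonals, nonzero top rows and reliable first columns
    controls how far these errors spread in products; [band 0] means upper triangular. *)
Definition band s Z := forall i j : 'I_m, (j + s < i)%N -> Z i j = 0.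
Definition top_rows r Z := forall i j : 'I_m, (r <= i)%N -> Z i j = 0.
Definition eq_cols c Z W := forall i j : 'I_m, (j < c)%N -> Z i j = W i j.
Definition central_mx Z := forall x : A, x%:M *m Z = Z *m x%:M.

Lemma bandM s t Z W : band s Z -> band t W -> band (s + t) (Z *m W).
Proof.
move=> hZ hW i j h; rewrite mxE big1 // => k _.
have [ki|ki] := ltnP (k + s) i; first by rewrite hZ ?mul0r.
by rewrite hW ?mulr0 // -(ltn_add2r s) (leq_trans _ ki) // -addnA [(t + s)%N]addnC.
Qed.

Lemma band1 : band 0 1%:M.
Proof. by move=> i j; rewrite addn0 mxE -val_eqE /= => /ltn_eqF; rewrite eq_sym => ->. Qed.

Lemma bandB s Z W : band s Z -> band s W -> band s (Z - W).
Proof. by move=> hZ hW i j h; rewrite !mxE hZ // hW // subrr. Qed.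

Lemma bandX Z n : band 1 Z -> band n (Z ^+ n).
Proof.
move=> h; elim: n => [|n IH]; first exact: band1.
by rewrite exprS -add1n; exact: bandM.
Qed.

Lemma band_sum (I : Type) (r : seq I) (P : pred I) (F : I -> 'M[A]_m) s :
  (forall i, P i -> band s (F i)) -> band s (\sum_(i <- r | P i) F i).
Proof.
move=> h; elim/big_ind: _ => // [i j _|Z W hZ hW i j ij]; first by rewrite mxE.
by rewrite mxE hZ ?hW ?addr0.
Qed.

Lemma top_rowsM s r Z W : band s Z -> top_rows r W -> top_rows (r + s) (Z *m W).
Proof.
move=> hZ hW i j h; rewrite mxE big1 // => k _.
have [rk|kr] := leqP r k; first by rewrite hW ?mulr0.
by rewrite hZ ?mul0r // (leq_trans _ h) // ltn_add2r.
Qed.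

Lemma top_rowsMr r Z W : top_rows r Z -> top_rows r (Z *m W).
Proof. by move=> h i j ri; rewrite mxE big1 // => k _; rewrite h ?mul0r. Qed.

Lemma top_rows_mono r s Z : (r <= s)%N -> top_rows r Z -> top_rows s Z.
Proof. by move=> rs h i j si; apply: h; exact: leq_trans rs si. Qed.

Lemma top_rowsD r Z W : top_rows r Z -> top_rows r W -> top_rows r (Z + W).
Proof. by move=> hZ hW i j h; rewrite mxE hZ // hW // addr0. Qed.

Lemma top_rows_sum (I : Type) (r : seq I) (P : pred I) (F : I -> 'M[A]_m) s :
  (forall i, P i -> top_rows s (F i)) -> top_rows s (\sum_(i <- r | P i) F i).
Proof.
move=> h; elim/big_ind: _ => // [i j _|Z W hZ hW i j ij]; first by rewrite mxE.
by rewrite mxE hZ ?hW ?addr0.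
Qed.

Lemma eq_colsM s c Z Z' W : eq_cols (c + s) Z Z' -> band s W ->
  eq_cols c (Z *m W) (Z' *m W).
Proof.
move=> h hW i j jc; rewrite !mxE; apply: eq_bigr => k _.
have [kj|jk] := ltnP (j + s) k; first by rewrite hW ?mulr0.
by rewrite h // (leq_ltn_trans jk) // ltn_add2r.
Qed.

Lemma eq_colsMl c Z W W' : eq_cols c W W' -> eq_cols c (Z *m W) (Z *m W').
Proof. by move=> h i j jc; rewrite !mxE; apply: eq_bigr => k _; rewrite h. Qed.

Lemma eq_cols_trans c Z Z' Z'' : eq_cols c Z Z' -> eq_cols c Z' Z'' -> eq_cols c Z Z''.
Proof. by move=> h h' i j jc; rewrite h // h'. Qed.

Lemma eq_cols_mono c d Z W : (d <= c)%N -> eq_cols c Z W -> eq_cols d Z W.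
Proof. by move=> dc h i j jd; apply: h; exact: leq_trans dc. Qed.

Lemma eq_cols_sum (I : Type) (r : seq I) (P : pred I) (F G : I -> 'M[A]_m) c :
  (forall i, P i -> eq_cols c (F i) (G i)) ->
  eq_cols c (\sum_(i <- r | P i) F i) (\sum_(i <- r | P i) G i).
Proof.
move=> h i j jc; rewrite !summxE; apply: eq_bigr => k Pk; exact: h.
Qed.

Lemma central_mxM Z W : central_mx Z -> central_mx W -> central_mx (Z *m W).
Proof. by move=> hZ hW x; rewrite mulmxA hZ -mulmxA hW mulmxA. Qed.

Lemma central_mxX Z n : central_mx Z -> central_mx (Z ^+ n).
Proof.
move=> h; elim: n => [|n IH]; last by rewrite exprS; exact: central_mxM.
by move=> x; rewrite expr0 mulmx1 mul1mx.
Qed.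

Lemma central_entries Z : (forall i j x, x * Z i j = Z i j * x) -> central_mx Z.
Proof.
move=> h x; apply/matrixP=> i j; rewrite mul_scalar_mx !mxE h (bigD1 j) //= big1 ?addr0.
  by rewrite mxE eqxx mulr1n.
by move=> k kj; rewrite mxE (negbTE kj) mulr0n mulr0.
Qed.

Definition shiftl : 'M[A]_m := \matrix_(i, j) (i.+1 == j :> nat)%:R.
Definition shiftr : 'M[A]_m := \matrix_(i, j) (i == j.+1 :> nat)%:R.

Lemma mul_shiftl Z (i j i' : 'I_m) : i.+1 = i' :> nat -> (shiftl *m Z) i j = Z i' j.
Proof.
move=> h; rewrite mxE (bigD1 i') //= big1 ?addr0; first by rewrite mxE h eqxx mul1r.
by move=> k ki; rewrite mxE h val_eqE eq_sym (negbTE ki) mul0r.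
Qed.

Lemma mul_shiftl0 Z (i j : 'I_m) : (m <= i.+1)%N -> (shiftl *m Z) i j = 0.
Proof.
move=> h; rewrite mxE big1 // => k _; rewrite mxE.
by rewrite gtn_eqF ?mul0r // (leq_trans (ltn_ord k)).
Qed.

Lemma mul_shiftr_col Z (i j j' : 'I_m) : j.+1 = j' :> nat -> (Z *m shiftr) i j = Z i j'.
Proof.
move=> h; rewrite mxE (bigD1 j') //= big1 ?addr0; first by rewrite mxE h eqxx mulr1.
by move=> k kj; rewrite mxE h val_eqE (negbTE kj) mulr0.
Qed.

Lemma mul_shiftr_col0 Z (i j : 'I_m) : (m <= j.+1)%N -> (Z *m shiftr) i j = 0.
Proof.
move=> h; rewrite mxE big1 // => k _; rewrite mxE.
by rewrite ltn_eqF ?mulr0 // (leq_trans (ltn_ord k)).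
Qed.

Lemma mul_shiftl_col Z (i j j' : 'I_m) : j'.+1 = j :> nat -> (Z *m shiftl) i j = Z i j'.
Proof.
move=> h; rewrite mxE (bigD1 j') //= big1 ?addr0; first by rewrite mxE h eqxx mulr1.
by move=> k kj; rewrite mxE -h eqSS val_eqE (negbTE kj) mulr0.
Qed.

Lemma mul_shiftl_col0 Z (i j : 'I_m) : j = 0%N :> nat -> (Z *m shiftl) i j = 0.
Proof. by move=> h; rewrite mxE big1 // => k _; rewrite mxE h mulr0. Qed.

(* [trunc = shiftl shiftr] kills the last basis vector. *)
Definition trunc := shiftl *m shiftr.

Lemma truncE (i j : 'I_m) : trunc i j = ((i == j) && (i.+1 < m)%N)%:R.
Proof.
rewrite /trunc; have [h|h] := ltnP i.+1 m.
  by rewrite (@mul_shiftl _ i _ (Ordinal h)) // mxE /= eqSS andbT.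
by rewrite mul_shiftl0 // andbF.
Qed.

Lemma mul_trunc Z (i j : 'I_m) : (trunc *m Z) i j = (if (i.+1 < m)%N then Z i j else 0).
Proof.
rewrite mxE (bigD1 i) //= big1 ?addr0; first by rewrite truncE eqxx /=; case: ifP; rewrite ?mul1r ?mul0r.
by move=> k ki; rewrite truncE eq_sym (negbTE ki) mul0r.
Qed.

Lemma mul_trunc_col Z (i j : 'I_m) : (Z *m trunc) i j = (if (j.+1 < m)%N then Z i j else 0).
Proof.
rewrite mxE (bigD1 j) //= big1 ?addr0; first by rewrite truncE eqxx /=; case: ifP; rewrite ?mulr1 ?mulr0.
by move=> k ki; rewrite truncE (negbTE ki) mulr0.
Qed.

Lemma band_shiftl : band 0 shiftl.
Proof. by move=> i j; rewrite addn0 mxE => h; rewrite gtn_eqF // ltnW. Qed.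

Lemma band_shiftr : band 1 shiftr.
Proof. by move=> i j; rewrite addn1 mxE => h; rewrite gtn_eqF. Qed.

Lemma central_shiftl : central_mx shiftl.
Proof. by apply: central_entries => i j x; rewrite mxE; exact: commr_nat. Qed.

Lemma central_shiftr : central_mx shiftr.
Proof. by apply: central_entries => i j x; rewrite mxE; exact: commr_nat. Qed.

Lemma shiftr_exp n (i j : 'I_m) : (shiftr ^+ n) i j = (i == (j + n)%N :> nat)%:R.
Proof.
elim: n i j => [|n IH] i j; first by rewrite expr0 addn0 mxE -val_eqE.
rewrite exprSr; have [h|h] := ltnP j.+1 m.
  by rewrite (@mul_shiftr_col _ _ j (Ordinal h)) // IH /= addSnnS.
rewrite mul_shiftr_col0 // ltn_eqF // (leq_trans (ltn_ord i)) //.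
by rewrite (leq_trans h) // addnS ltnS leq_addr.
Qed.

Lemma shiftl_exp n (i j : 'I_m) : (shiftl ^+ n) i j = ((i + n)%N == j :> nat)%:R.
Proof.
elim: n i j => [|n IH] i j; first by rewrite expr0 addn0 mxE -val_eqE.
rewrite exprS; have [h|h] := ltnP i.+1 m.
  by rewrite (@mul_shiftl _ i _ (Ordinal h)) // IH /= addSnnS.
rewrite mul_shiftl0 // gtn_eqF // (leq_trans (ltn_ord j)) //.
by rewrite (leq_trans h) // addnS ltnS leq_addr.
Qed.

Lemma shiftl_nilpotent : shiftl ^+ m = 0.
Proof.
apply/matrixP=> i j; rewrite shiftl_exp mxE gtn_eqF //.
by rewrite (leq_trans (ltn_ord j)) // leq_addl.
Qed.
End BandMatrices.

(** Chosen components [comp] and a degree bound [bnd], past which they vanish, make evaluation at a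
    matrix a finite sum of explicit terms. *)
Record grading (A : pzRingType) (G : nat -> A -> Prop) (comp : nat -> A -> A)
    (bnd : A -> nat) : Prop := Grading {
  gr_comp : forall i x, G i (comp i x);
  gr_compE : forall i x, G i x -> forall n, comp n x = if n == i then x else 0;
  gr_compD : forall n x y, comp n (x + y) = comp n x + comp n y;
  gr_sum : forall x g, (bnd x <= g)%N -> x = \sum_(i < g) comp i x;
  gr_mul : forall i j x y, G i x -> G j y -> G (i + j)%N (x * y);
  gr_one : G 0%N 1 }.

Section Grading.
Variables (A : pzRingType) (G : nat -> A -> Prop) (comp : nat -> A -> A) (bnd : A -> nat).
Hypothesis gr : grading G comp bnd.

Lemma comp_out x i : (bnd x <= i)%N -> comp i x = 0.
Proof.
move=> h; apply: (addrI x); rewrite addr0 {1}(gr_sum gr h).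
by rewrite [in RHS](gr_sum gr (leqW h)) big_ord_recr.
Qed.

Lemma comp0 n : comp n 0 = 0.
Proof. by apply: (addrI (comp n 0)); rewrite -(gr_compD gr) !addr0. Qed.

Lemma comp_bigsum n (I : Type) (r : seq I) (P : pred I) F :
  comp n (\sum_(i <- r | P i) F i) = \sum_(i <- r | P i) comp n (F i).
Proof. exact: (big_morph _ (gr_compD gr n) (comp0 n)). Qed.

Lemma comp0M x y : comp 0 (x * y) = comp 0 x * comp 0 y.
Proof.
have hx := gr_sum gr (leqnSn (bnd x)); have hy := gr_sum gr (leqnSn (bnd y)).
have E i j : comp 0 (comp i x * comp j y) = if 0%N == (i + j)%N then comp i x * comp j y else 0.
  exact: (gr_compE gr (gr_mul gr (gr_comp gr i x) (gr_comp gr j y))).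
rewrite {1}hx {1}hy big_distrlr /= comp_bigsum (bigD1 ord0) //= [X in _ + X]big1 ?addr0.
  rewrite comp_bigsum (bigD1 ord0) //= [X in _ + X]big1 ?addr0 ?E // => j.
  rewrite -val_eqE /= => j0.
  by rewrite E add0n eq_sym (negbTE j0).
move=> i; rewrite -val_eqE /= => i0; rewrite comp_bigsum big1 // => j _.
by rewrite E eq_sym addn_eq0 (negbTE i0).
Qed.

Lemma comp01 : comp 0 1 = 1.
Proof. by rewrite (gr_compE gr (gr_one gr)). Qed.

Section Evaluation.
Variables (m : nat) (B : 'M[A]_m).
Hypothesis cB : central_mx B.

(* The ring morphism [x_0 + x_1 + ... |-> x_0 + x_1 B + x_2 B^2 + ...]. *)
Definition gr_eval (x : A) : 'M[A]_m := \sum_(i < bnd x) (comp i x)%:M *m B ^+ i.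

Lemma gr_evalE x g : (bnd x <= g)%N -> gr_eval x = \sum_(i < g) (comp i x)%:M *m B ^+ i.
Proof.
move=> h; rewrite /gr_eval (big_ord_widen _ (fun i => (comp i x)%:M *m B ^+ i) h).
rewrite big_mkcond; apply: eq_bigr => i _; case: ltnP => // hi.
by rewrite comp_out // raddf0 mul0mx.
Qed.

Lemma gr_evalD x y : gr_eval (x + y) = gr_eval x + gr_eval y.
Proof.
pose g := maxn (bnd (x + y)) (maxn (bnd x) (bnd y)).
rewrite !(@gr_evalE _ g) ?leq_max ?leqnn ?orbT //.
rewrite -big_split; apply: eq_bigr => i _ /=.
by rewrite (gr_compD gr) raddfD mulmxDl.
Qed.

Lemma gr_eval0 : gr_eval 0 = 0.
Proof. by apply: (addrI (gr_eval 0)); rewrite -gr_evalD !addr0. Qed.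

Lemma gr_eval_sum (I : Type) (r : seq I) (P : pred I) F :
  gr_eval (\sum_(i <- r | P i) F i) = \sum_(i <- r | P i) gr_eval (F i).
Proof. exact: (big_morph _ gr_evalD gr_eval0). Qed.

Lemma gr_eval_hom i x : G i x -> gr_eval x = x%:M *m B ^+ i.
Proof.
move=> h; rewrite (@gr_evalE _ (maxn (bnd x) i.+1)) ?leq_maxl //.
rewrite (bigD1 (Ordinal (leq_maxr (bnd x) i.+1))) //= big1 ?addr0 => [|j].
  by rewrite (gr_compE gr h) eqxx.
by rewrite -val_eqE /= => ji; rewrite (gr_compE gr h) (negbTE ji) raddf0 mul0mx.
Qed.

Lemma gr_eval1 : gr_eval 1 = 1%:M.
Proof. by rewrite (gr_eval_hom (gr_one gr)) expr0 mulmx1. Qed.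

Lemma gr_evalM x y : gr_eval (x * y) = gr_eval x *m gr_eval y.
Proof.
rewrite {1}(gr_sum gr (leqnn (bnd x))) {1}(gr_sum gr (leqnn (bnd y))) big_distrlr /=.
rewrite (gr_eval_sum _ xpredT) [in RHS]/gr_eval mulmx_suml; apply: eq_bigr => i _.
rewrite (gr_eval_sum _ xpredT) mulmx_sumr; apply: eq_bigr => j _.
rewrite (gr_eval_hom (gr_mul gr (gr_comp gr i x) (gr_comp gr j y))).
rewrite scalar_mxM exprD -!mulmxA; congr (_ *m _); rewrite !mulmxA; congr (_ *m _).
exact: (central_mxX i cB).
Qed.

Lemma gr_evalX x n : gr_eval (x ^+ n) = gr_eval x ^+ n.
Proof. by elim: n => [|n IH]; rewrite ?expr0 ?gr_eval1 // !exprS gr_evalM IH. Qed.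

Lemma gr_eval_inverse x y : x * y = 1 -> y * x = 1 ->
  inverse_mx (gr_eval x) (gr_eval y).
Proof. by move=> xy yx; split; rewrite -gr_evalM ?xy ?yx gr_eval1. Qed.

Lemma gr_eval_band x g : band 1 B -> (bnd x <= g.+1)%N -> band g (gr_eval x).
Proof.
move=> hB h; rewrite (gr_evalE h); apply: band_sum => i _.
rewrite mul_scalar_mx => a b ab; rewrite mxE (bandX (n := i) hB) ?mulr0 //.
by apply: leq_ltn_trans ab; rewrite leq_add2l -ltnS.
Qed.
End Evaluation.

(** The evaluation at [shiftr] is the lower triangular Toeplitz matrix of the components: its first
    column lists them and its first row is [comp 0 x] followed by zeros. *)
Lemma gr_eval_shiftr m x (i j : 'I_m) :
  gr_eval (shiftr A m) x i j = if (j <= i)%N then comp (i - j) x else 0.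
Proof.
pose g := maxn (bnd x) m.
rewrite (@gr_evalE _ _ _ g) ?leq_maxl // summxE.
have E (k : 'I_g) : ((comp k x)%:M *m shiftr A m ^+ k) i j =
    if i == (j + k)%N :> nat then comp k x else 0.
  rewrite mul_scalar_mx mxE shiftr_exp; case: ifP; by rewrite ?mulr1 ?mulr0.
rewrite (eq_bigr _ (fun k _ => E k)); have [ji|ij] := leqP j i; last first.
  by rewrite big1 // => k _; rewrite ltn_eqF // (leq_trans ij) // leq_addr.
have lt : (i - j < g)%N.
  by rewrite (leq_ltn_trans (leq_subr _ _)) // leq_max ltn_ord orbT.
rewrite (bigD1 (Ordinal lt)) //= big1 ?addr0 => [|k]; first by rewrite subnKC // eqxx.
rewrite -val_eqE /= => h; case: eqP => // e; case/negP: h.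
by rewrite e addKn.
Qed.
End Grading.

Lemma inverse_mx_corner (R : pzRingType) n m (x x' : 'M[R]_n) (z z' : 'M_(n, m)) :
  inverse_mx (block_mx x z 0 1%:M) (block_mx x' z' 0 1%:M) -> inverse_mx x x'.
Proof.
rewrite /inverse_mx !mulmx_block !(mulmx0, mul0mx, addr0, add0r) !(scalar_mx_block n m).
by move=> [/eq_block_mx [-> _ _ _] /eq_block_mx [-> _ _ _]].
Qed.

Lemma eq_cols_corner (R : pzRingType) n m (Z W : 'M[R]_(n + m)) : eq_cols n Z W ->
  ulsubmx W = ulsubmx Z /\ dlsubmx W = dlsubmx Z.
Proof. by move=> h; split; apply/matrixP=> i j; rewrite !mxE h //=. Qed.

(** * The quotient of two evaluations as a finite commutator *)

Section TruncatedCommutator.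
Variables (A : pzRingType) (G : nat -> A -> Prop) (comp : nat -> A -> A) (bnd : A -> nat).
Hypothesis gr : grading G comp bnd.
Variables (g : nat) (t t' : A).
Hypotheses (tt' : t * t' = 1) (t't : t' * t = 1).
Hypotheses (bt : (bnd t <= g.+1)%N) (bt' : (bnd t' <= g.+1)%N).

(** The difference of the two evaluations occupies [g] rows and multiplication by [L'] spreads it to
    [2 * g], whence the corner size [a], with 1 added for the slot of [unit_corner]. The [g] further
    columns absorb the truncation error. *)
Let a := (1 + 2 * g)%N.
Let m := (a + g)%N.
Let X := shiftl A m.
Let Y := shiftr A m.

Let L := gr_eval comp bnd Y t.
Let L' := gr_eval comp bnd Y t'.

Let L_inverse : inverse_mx L L'.
Proof. exact: (gr_eval_inverse gr (@central_shiftr A m) tt' t't). Qed.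

Let L'_band : band g L'.
Proof. exact: (gr_eval_band gr (@band_shiftr A m) bt'). Qed.

Variables (u u' : 'M[A]_m).
Hypotheses (uu' : inverse_mx u u') (u_band : band 0 u) (u'_band : band 0 u').
Hypotheses (uX : u *m X = X *m u) (cu : central_mx u) (cu' : central_mx u').

(* [B] is [u^-1 Y u] corrected in its last column, so as to differ from [Y] in the
   first row only. *)
Definition conj_shift := u' *m Y *m u *m trunc A m.
Local Notation B := conj_shift.
Let F := gr_eval comp bnd B t.
Let F' := gr_eval comp bnd B t'.

Lemma central_conj_shift : central_mx B.
Proof.
do !apply: central_mxM => //; [exact: central_shiftr | exact: central_shiftl | exact: central_shiftr].
Qed.

(** [X *m D = 0] says that all rows of [D] but the first vanish. It holds because [u] commutes with
    [X], [X *m Y] is [trunc], and the last row of the upper triangular [u] is zero before its last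
    column. The triangular [u'] keeps the first row in place. *)
Lemma conj_shift_top : top_rows 1 (B - Y).
Proof.
pose D := Y *m u *m trunc A m - u *m Y.
have XD : X *m D = 0.
  have -> : X *m D = trunc A m *m (u *m trunc A m) - u *m trunc A m.
    by rewrite /D mulmxBr !mulmxA -uX -[u *m X *m Y]mulmxA.
  apply/matrixP=> i j; rewrite [LHS]mxE [X in _ + X]mxE mul_trunc mul_trunc_col mxE.
  case: ltnP => im; case: ltnP => jm; rewrite ?subrr ?sub0r ?oppr0 // u_band ?oppr0 //.
  by rewrite addn0 -ltnS; exact: (leq_trans jm im).
have -> : B - Y = u' *m D.
  by rewrite /D /conj_shift mulmxBr !mulmxA uu'.2 mul1mx.
rewrite -[1%N]addn0; apply: (top_rowsM u'_band) => i j i0.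
have i0m : (i.-1 < m)%N by rewrite (leq_ltn_trans (leq_pred i)).
by rewrite -(@mul_shiftl _ _ D (Ordinal i0m) j) ?XD ?mxE //= prednK.
Qed.

Lemma conj_shift_band : band 1 B.
Proof.
have bY : band 1 Y by exact: band_shiftr.
have bt0 : band 0 (trunc A m).
  by move=> i j; rewrite addn0 truncE => ji; rewrite -val_eqE /= gtn_eqF.
exact: (bandM (bandM (bandM u'_band bY) u_band) bt0).
Qed.

Lemma conj_shiftX_top i : top_rows i (B ^+ i - Y ^+ i).
Proof.
elim: i => [|i IH]; first by rewrite !expr0 subrr => a' b _; rewrite mxE.
have -> : B ^+ i.+1 - Y ^+ i.+1 = B *m (B ^+ i - Y ^+ i) + (B - Y) *m Y ^+ i.
  by rewrite !exprS mulmxBr mulmxBl addrA addrNK.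
apply: top_rowsD; first by rewrite -addn1; exact: (top_rowsM conj_shift_band).
by apply: top_rowsMr; apply: top_rows_mono conj_shift_top.
Qed.

(** The truncation spoils the last column only, and each further factor, having one subdiagonal,
    lets the error reach one more column to the left. *)
Lemma conj_shiftX_cols i : (i <= m)%N -> eq_cols (m - i) (B ^+ i) (u' *m Y ^+ i *m u).
Proof.
elim: i => [|i IH] im; first by rewrite !expr0 mulmx1 uu'.2.
have step : eq_cols (m - 1) B (u' *m Y *m u).
  move=> b c cm; rewrite /conj_shift mul_trunc_col; case: ltnP => // mc.
  by move: cm; rewrite ltnNge subn1 -ltnS (leq_trans _ mc) // prednK.
have -> : u' *m Y ^+ i.+1 *m u = (u' *m Y *m u) *m (u' *m Y ^+ i *m u).
  by rewrite exprS !mulmxA -[_ *m u *m u']mulmxA uu'.1 mulmx1.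
rewrite exprS; apply: (eq_cols_trans (Z' := B *m (u' *m Y ^+ i *m u))).
  apply: eq_colsMl; apply: eq_cols_mono (IH (ltnW im)).
  by rewrite leq_sub2l.
apply: (eq_colsM (s := i)).
  by have -> : (m - i.+1 + i = m - 1)%N by rewrite -[in RHS](subnK im) addnS subn1.
by have := bandM (bandM u'_band (bandX (n := i) (@band_shiftr A m))) u_band; rewrite add0n addn0.
Qed.

Lemma eval_conj_shift_top y : (bnd y <= g.+1)%N ->
  top_rows g (gr_eval comp bnd B y - gr_eval comp bnd Y y).
Proof.
move=> hb; rewrite !(gr_evalE gr _ hb) -sumrB; apply: top_rows_sum => i _.
rewrite -mulmxBr mul_scalar_mx => b c bg; rewrite mxE (conj_shiftX_top (i := i)) ?mulr0 //.
by apply: leq_trans bg; rewrite -ltnS.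
Qed.

Lemma eval_conj_shift_cols : eq_cols a F (u' *m L *m u).
Proof.
have -> : u' *m L *m u = \sum_(i < g.+1) (comp i t)%:M *m (u' *m Y ^+ i *m u).
  rewrite /L (gr_evalE gr _ bt) mulmx_sumr mulmx_suml; apply: eq_bigr => i _.
  by rewrite !mulmxA -cu'.
rewrite /F (gr_evalE gr _ bt); apply: eq_cols_sum => i _; apply: eq_colsMl.
have ig : (i <= g)%N by rewrite -ltnS.
have im : (i <= m)%N by apply: leq_trans ig _; exact: leq_addl.
apply: eq_cols_mono (conj_shiftX_cols im).
by rewrite /m -addnBA // leq_addr.
Qed.

Lemma add1_top_rows (Z : 'M[A]_(a + g)) : top_rows a Z ->
  exists x z, 1%:M + Z = block_mx x z 0 1%:M.
Proof.
move=> h; exists (ulsubmx (1%:M + Z)), (ursubmx (1%:M + Z)).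
rewrite -[LHS]submxK; congr block_mx; apply/matrixP=> i j.
  by rewrite !mxE h ?addr0 ?eq_shift //= leq_addr.
by rewrite !mxE h ?addr0 ?eq_shift //= leq_addr.
Qed.

(** [L' *m F] is 1 plus [L' *m (F - L)], whose nonzero rows are among the first [2 * g <= a]. So the
    quotient is block triangular with identity lower right corner, and its hyperbolic class is that
    of the corner [x]. *)
Lemma eval_quotient_block : exists x x' z z',
  [/\ L' *m F = block_mx x z 0 1%:M :> 'M_(a + g), F' *m L = block_mx x' z' 0 1%:M :> 'M_(a + g),
      inverse_mx x x' & inverse_mx (L' *m F) (F' *m L)].
Proof.
have iF : inverse_mx F F' by exact: (gr_eval_inverse gr central_conj_shift tt' t't).
have ga : (g + g <= a)%N by rewrite /a addnn mul2n add1n.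
have h1 : top_rows a (L' *m (F - L)).
  apply: (top_rows_mono ga); apply: (top_rowsM L'_band); exact: eval_conj_shift_top.
have F'_band : band g F' by exact: (gr_eval_band gr conj_shift_band bt').
have h2 : top_rows a (F' *m (L - F)).
  apply: (top_rows_mono ga); apply: (top_rowsM F'_band).
  by move=> i j gi; rewrite -opprB mxE eval_conj_shift_top ?oppr0.
have e1 : L' *m F = 1%:M + L' *m (F - L) by rewrite mulmxBr L_inverse.2 addrC addrNK.
have e2 : F' *m L = 1%:M + F' *m (L - F) by rewrite mulmxBr iF.2 addrC addrNK.
have i12 : inverse_mx (L' *m F) (F' *m L) by apply: inverse_mxM iF; exact: inverse_mxC.
have [x [z ex]] := add1_top_rows h1; have [x' [z' ex']] := add1_top_rows h2.
exists x, x', z, z'; split=> //; rewrite ?e1 ?e2 //.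
by apply: (@inverse_mx_corner _ _ _ x x' z z'); rewrite -ex -ex' -e1 -e2.
Qed.

(** On the first [a] columns [F] cannot be distinguished from the true conjugate of [L]; so [x] is
    also the corner of a commutator, and commutators depend multiplicatively on [u]. *)
Lemma commutator_corner (W : 'M_(a + g) := L' *m (u' *m L *m u)) :
  ulsubmx W = ulsubmx (L' *m F : 'M_(a + g)) /\ dlsubmx W = 0.
Proof.
have [x [x' [z [z' [e _ _ _]]]]] := eval_quotient_block.
have h : eq_cols a (L' *m F) W by apply: eq_colsMl; exact: eval_conj_shift_cols.
have [-> ->] := eq_cols_corner h; split=> //.
by rewrite e block_mxKdl.
Qed.
End TruncatedCommutator.

(** * The commutator corner for [1 - X] *)

Section UnitCorner.
Variables (A : pzRingType) (G : nat -> A -> Prop) (comp : nat -> A -> A) (bnd : A -> nat).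
Hypothesis gr : grading G comp bnd.
Variables (g : nat) (t t' : A).
Hypotheses (tt' : t * t' = 1) (t't : t' * t = 1).
Hypotheses (bt : (bnd t <= g.+1)%N) (bt' : (bnd t' <= g.+1)%N).

Let a := (1 + 2 * g)%N.
Let m := (a + g)%N.
Let X := shiftl A m.
Let Y := shiftr A m.
Let L := gr_eval comp bnd Y t.
Let L' := gr_eval comp bnd Y t'.
Variable v' : 'M[A]_m.
Hypothesis iv : inverse_mx (1%:M - X) v'.

Let Lband : band g L.
Proof. exact: (gr_eval_band gr (@band_shiftr A m) bt). Qed.

(** [L] commutes with [Y], so [(X L - L X) Y] is the commutator of [trunc] with [L]; it is zero away
    from the boundary, and multiplying by [Y] on the right merely shifts columns. *)
Let XL_cols (i j : 'I_m) : (0 < j)%N -> (j < m - g)%N -> (X *m L - L *m X) i j = 0.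
Proof.
move=> j0 jm; have jm1 : (j.-1 < m)%N by rewrite (leq_ltn_trans (leq_pred j)).
rewrite -(@mul_shiftr_col _ _ _ i (Ordinal jm1) j) ?prednK // -/Y.
have LY : L *m Y = Y *m L.
  have h1 : gr_eval comp bnd Y t *m Y = Y *m gr_eval comp bnd Y t; last by [].
  rewrite /gr_eval mulmx_suml mulmx_sumr; apply: eq_bigr => k _.
  rewrite mulmxA -(@central_shiftr A m) -!mulmxA; congr (_ *m _).
  by rewrite -[_ *m Y]/(_ * Y) -[Y *m _]/(Y * _) -exprS -exprSr.
rewrite mulmxBl -mulmxA LY mulmxA -[L *m X *m Y]mulmxA -/(trunc A m).
rewrite mxE [X in _ + X]mxE mul_trunc mul_trunc_col /= prednK //.
have jlt : (j < m)%N by [].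
rewrite jlt; case: ltnP => im; first by rewrite subrr.
rewrite Lband ?subr0 //= -ltnS -addSn prednK //.
by rewrite ltn_subRL addnC in jm; exact: leq_trans jm im.
Qed.

Let v'_row (j : 'I_m) (i0 : 'I_m) : i0 = 0%N :> nat -> v' i0 j = 1.
Proof.
move=> h0; have e : v' = 1%:M + v' *m X.
  by have := iv.2; rewrite mulmxBr mulmx1 => /eqP; rewrite subr_eq => /eqP.
case: j => j; elim: j => [|j IH] jm.
  rewrite e mxE mul_shiftl_col0 // addr0 mxE -val_eqE /= h0 //.
rewrite e mxE (@mul_shiftl_col _ _ _ i0 _ (Ordinal (ltnW jm))) // IH.
by rewrite mxE -val_eqE /= h0 add0r.
Qed.

(** The commutator is [1 + L' v' (X L - L X)], so in the corner only the first column differs from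
    the identity. Its top entry is [comp 0 t'], the first row of [L'], times the sum of the first
    column of [L], that is [t]: the first row of the inverse [v'] of [1 - X] consists of ones. *)
Lemma unit_corner : exists c,
  ulsubmx (L' *m (v' *m L *m (1%:M - X)) : 'M_(a + g)) =
  block_mx (comp 0 t' * t)%:M 0 c 1%:M :> 'M_(1 + 2 * g).
Proof.
set W := L' *m _; pose i0 : 'I_m := lshift g (lshift (2 * g) ord0).
have W_cols (i j : 'I_m) : (0 < j)%N -> (j < a)%N -> W i j = (i == j)%:R.
  move=> j0 ja; have -> : W = 1%:M + L' *m v' *m (X *m L - L *m X).
    have -> : X *m L - L *m X = L *m (1%:M - X) - (1%:M - X) *m L.
      by rewrite mulmxBr mulmx1 mulmxBl mul1mx opprB [RHS]addrC addrA addrNK.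
    rewrite mulmxBr -[L' *m v' *m (_ *m L)]mulmxA [v' *m (_ *m L)]mulmxA iv.2 mul1mx.
    rewrite (gr_eval_inverse gr (@central_shiftr A m) tt' t't).2 [RHS]addrC addrNK.
    by rewrite /W !mulmxA.
  rewrite mxE [X in _ + X]mxE big1 ?addr0 ?mxE // => k _.
  by rewrite XL_cols ?mulr0 // /m addnK.
have W00 : W i0 i0 = comp 0 t' * t.
  rewrite mxE (bigD1 i0) //= big1 ?addr0 => [|k]; last first.
    rewrite -val_eqE /= => k0; rewrite (gr_eval_shiftr gr) leqn0 (negbTE k0) mul0r //.
  rewrite (gr_eval_shiftr gr) /= subnn; congr (_ * _).
  rewrite mulmxBr mulmx1 mxE [X in _ + X]mxE mul_shiftl_col0 // subr0 mxE.
  rewrite [RHS](gr_sum gr (g := m)); last first.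
    by rewrite (leq_trans bt) // /m /a add1n addSn ltnS leq_addl.
  by apply: eq_bigr => j _; rewrite v'_row // mul1r (gr_eval_shiftr gr) /= subn0.
exists (dlsubmx (ulsubmx (W : 'M_(a + g)) : 'M_(1 + 2 * g))).
move: W W_cols W00; rewrite /m /a => W W_cols W00.
have W_cols' i (j : 'I_(2 * g)) :
    W i (lshift g (rshift 1 j)) = (i == lshift g (rshift 1 j))%:R.
  by apply: W_cols => //; exact: (ltn_ord (rshift 1 j)).
rewrite -[LHS]submxK; congr block_mx; apply/matrixP=> i j; rewrite !mxE ?W_cols'.
- by rewrite !ord1 eqxx mulr1n -W00.
- by rewrite -val_eqE /= ord1.
- by rewrite -!val_eqE /= !add1n eqSS.
Qed.
End UnitCorner.

Section Corners.
Variables (R : pzRingType) (n m : nat).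
Implicit Types P Q : 'M[R]_(n + m).

Lemma ulsubmxM P Q : dlsubmx Q = 0 -> ulsubmx (P *m Q) = ulsubmx P *m ulsubmx Q.
Proof.
move=> h; rewrite -{1}[P]submxK -{1}[Q]submxK h mulmx_block block_mxKul.
by rewrite mulmx0 addr0.
Qed.

Lemma dlsubmxM P Q : dlsubmx P = 0 -> dlsubmx Q = 0 -> dlsubmx (P *m Q) = 0.
Proof.
move=> hP hQ; rewrite -[P]submxK -[Q]submxK hP hQ mulmx_block block_mxKdl.
by rewrite mulmx0 mul0mx addr0.
Qed.

Lemma band0_dlsubmx P : band 0 P -> dlsubmx P = 0.
Proof.
move=> h; apply/matrixP=> i j; rewrite !mxE h // addn0 /=.
by rewrite (leq_trans (ltn_ord j)) // leq_addr.
Qed.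

Lemma ulsubmx1 : ulsubmx (1%:M : 'M[R]_(n + m)) = 1%:M.
Proof. by rewrite (scalar_mx_block n m) block_mxKul. Qed.

Lemma dlsubmx1 : dlsubmx (1%:M : 'M[R]_(n + m)) = 0.
Proof. by rewrite (scalar_mx_block n m) block_mxKdl. Qed.
End Corners.

Section GradedK1.
Variables (A : pzRingType) (bar : A -> A) (lam : A) (La : A -> Prop).
Hypothesis FR : is_form_ring bar lam La.
Local Notation GQ := (GQ bar lam La).
Local Notation EQst := (EQ_stable bar lam La).
Local Notation eqK := (eqK bar lam La).
Local Notation hypmx := (hypmx bar).

Variables (G : nat -> A -> Prop) (comp : nat -> A -> A) (bnd : A -> nat).
Hypothesis gr : grading G comp bnd.

Lemma hypmxX n (x x' : 'M_n) k : hypmx x x' ^+ k = hypmx (x ^+ k) (x' ^+ k).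
Proof.
elim: k => [|k IH]; first by rewrite !expr0 (hypmx1 FR).
by rewrite exprS IH [x ^+ k.+1]exprS [x' ^+ k.+1]exprSr; exact: (hypmxM FR).
Qed.

Lemma hypmx_upper_block n m (x x' : 'M_n) (z : 'M_(n, m)) y : inverse_mx x x' ->
  inverse_mx (block_mx x z 0 1%:M) y ->
  eqK (hypmx (block_mx x z 0 1%:M) y) (stab m (hypmx x x')).
Proof.
move=> ix iy; have iu := inverse_mx_upper z.
have ib : inverse_mx (block_mx x 0 0 1%:M) (block_mx x' 0 0 1%:M : 'M_(n + m)).
  by apply: inverse_mx_block => //; exact: inverse_mx1.
have e : block_mx x z 0 1%:M = block_mx 1%:M z 0 1%:M *m block_mx x 0 0 1%:M.
  by blk.
have -> : hypmx (block_mx x z 0 1%:M) y = hypmx (block_mx 1%:M z 0 1%:M) (block_mx 1%:M (- z) 0 1%:M)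
    *m stab m (hypmx x x').
  rewrite (stab_hypmx FR) (hypmxM FR) -e; congr (hypmx _ _).
  by apply: (inverse_mx_uniq iy); rewrite e; exact: (inverse_mxM iu ib).
apply: (eqK_EQl FR); last by apply: (stab_GQ FR); exact: (GQ_hypmx FR ix).
by apply: (EQ_hypmx FR) => //; exact: elementary_upper.
Qed.

Lemma hypmx_lower_block n m (x x' : 'M_n) (c : 'M_(m, n)) y : inverse_mx x x' ->
  inverse_mx (block_mx x 0 c 1%:M) y ->
  eqK (hypmx (block_mx x 0 c 1%:M) y) (stab m (hypmx x x')).
Proof.
move=> ix iy; have iu := inverse_mx_lower (c *m x').
have ib : inverse_mx (block_mx x 0 0 1%:M) (block_mx x' 0 0 1%:M : 'M_(n + m)).
  by apply: inverse_mx_block => //; exact: inverse_mx1.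
have e : block_mx x 0 c 1%:M = block_mx 1%:M 0 (c *m x') 1%:M *m block_mx x 0 0 1%:M.
  by blk; rewrite -mulmxA ix.2 mulmx1.
have -> : hypmx (block_mx x 0 c 1%:M) y =
    hypmx (block_mx 1%:M 0 (c *m x') 1%:M) (block_mx 1%:M 0 (- (c *m x')) 1%:M)
    *m stab m (hypmx x x').
  rewrite (stab_hypmx FR) (hypmxM FR) -e; congr (hypmx _ _).
  by apply: (inverse_mx_uniq iy); rewrite e; exact: (inverse_mxM iu ib).
apply: (eqK_EQl FR); last by apply: (stab_GQ FR); exact: (GQ_hypmx FR ix).
by apply: (EQ_hypmx FR) => //; exact: elementary_lower.
Qed.

Variables (t t' c : A) (k : nat).
Hypotheses (tt' : t * t' = 1) (t't : t' * t = 1).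
Hypotheses (kc : k%:R * c = 1) (c_central : forall x, x * c = c * x).
(** The torsion is assumed after evaluation: [A] is an arbitrary graded ring here, and it is the
    structure of a matrix ring that will supply it, through [gr_eval_elementary]. *)
Hypothesis t_torsion : forall m (B : 'M[A]_m), central_mx B ->
  EQst (hypmx (gr_eval comp bnd B (t ^+ k)) (gr_eval comp bnd B (t' ^+ k))).

(** The root is taken among the upper triangular matrices in the bicommutant of [X]. This ring is
    commutative, its members commute with [X], and they commute with scalars because [X] does; it
    contains [c] as [c] is central. *)
Lemma shift_root m (X := shiftl A m) : exists u u',
  [/\ inverse_mx u u', band 0 u, band 0 u', u *m X = X *m u
    & [/\ central_mx u, central_mx u' & u ^+ k = 1%:M - X]].
Proof.
pose P (Z : 'M[A]_m) := (forall W, W *m X = X *m W -> Z *m W = W *m Z) /\ band 0 Z.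
have P1 : P 1 by split=> [W _|]; [rewrite mul1mx mulmx1 | exact: band1].
have PB x y : P x -> P y -> P (x - y).
  move=> [h1 h2] [h3 h4]; split=> [W hW|]; last exact: bandB.
  by rewrite mulmxBl mulmxBr h1 ?h3.
have PM x y : P x -> P y -> P (x * y).
  move=> [h1 h2] [h3 h4]; split=> [W hW|].
    by rewrite -mulmxA h3 // mulmxA h1 // mulmxA.
  by rewrite -[0%N]addn0; exact: bandM.
have PX : P X by split=> [W ->|] //; exact: band_shiftl.
have PC x y : P x -> P y -> x * y = y * x.
  by move=> [h1 _] [h2 _]; apply: h1; rewrite (h2 X).
have P0 : P 0 by rewrite -(subrr 1); exact: PB.
have PN x : P x -> P (- x) by rewrite -sub0r; exact: PB.
have PD x y : P x -> P y -> P (x + y).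
  by move=> hx hy; rewrite -[y]opprK; apply: PB => //; exact: PN.
have cC x : c * x = x * c by rewrite c_central.
have Pc : P c%:M.
  split=> [W _|i j]; first by rewrite mul_scalar_mx -scalemx1 (mulmxZr _ _ cC) mulmx1.
  by rewrite addn0 mxE -val_eqE /= => ji; rewrite gtn_eqF.
have kcm : k%:R * c%:M = 1 :> 'M[A]_m.
  by rewrite mulr_natl -raddfMn /= -mulr_natl kc.
have Xm : (- X) ^+ m = 0 by rewrite exprNn shiftl_nilpotent mulr0.
have [u [y [Py eu uk]]] := unipotent_root P1 PB PM PC (PN _ PX) Pc kcm Xm.
have PNy : P (- X * y) by apply: PM => //; exact: PN.
have Nym : (- X * y) ^+ m = 0.
  by rewrite exprMn_comm ?Xm ?mul0r //; apply: PC => //; exact: PN.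
have [i1 i2] := nilpotent_inverse Nym; set u' := \sum_(i < m) _ in i1 i2.
have Pu : P u.
  by rewrite eu; exact: PD.
have Pu' : P u'.
  rewrite /u'; elim/big_ind: _ => [|Z W hZ hW|i _].
  - by [].
  - exact: PD.
  - by elim: (nat_of_ord i) => [|j IH]; rewrite ?expr0 // exprS; apply: PM => //; exact: PN.
have cX W : P W -> central_mx W.
  by move=> [h _] x; rewrite h //; exact: (@central_shiftl A m).
exists u, u'; split; [|exact: Pu.2|exact: Pu'.2|exact: Pu.1|].
- by rewrite eu; split; [exact: i1 | exact: i2].
- by split; [exact: cX|exact: cX|].
Qed.

(* Both [F] and [L] below are images of [t] under ring morphisms, so the class of
   the corner of [L^-1 F] is killed by [k]; but it is multiplicative in [u], and
   for [u^k = 1 - X] it is the class of [t_0^-1 t]. *)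
Lemma graded_torsion :
  eqK (hypmx (comp 0 t)%:M (comp 0 t')%:M : 'M_(1 + 1)) (hypmx t%:M t'%:M).
Proof.
pose g := maxn (bnd t) (bnd t').
have bt : (bnd t <= g.+1)%N by rewrite leqW ?leq_maxl.
have bt' : (bnd t' <= g.+1)%N by rewrite leqW ?leq_maxr.
pose a := (1 + 2 * g)%N; pose m := (a + g)%N.
have [u [u' [iu bu bu' uX [cu cu' uk]]]] := shift_root m.
pose L := gr_eval comp bnd (shiftr A m) t; pose L' := gr_eval comp bnd (shiftr A m) t'.
pose B := conj_shift u u'.
pose F := gr_eval comp bnd B t; pose F' := gr_eval comp bnd B t'.
have cB : central_mx B by exact: central_conj_shift.
have iL : inverse_mx L L' by exact: (gr_eval_inverse gr (@central_shiftr A m) tt' t't).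
have iF : inverse_mx F F' by exact: (gr_eval_inverse gr cB tt' t't).
have [x [x' [z [z' [eLF eFL ix iLF]]]]] :=
  eval_quotient_block gr tt' t't bt bt' iu bu bu' uX cu cu'.
rewrite -/L -/L' -/B -/F -/F' in eLF eFL iLF.
have gH n (y y' : 'M_n) (i : inverse_mx y y') : GQ (hypmx y y') by exact: (GQ_hypmx FR i).
(* the class of [x] is killed by [k] *)
have cY : central_mx (shiftr A m) by exact: central_shiftr.
have trivial_eval M : central_mx M ->
    EQst (hypmx (gr_eval comp bnd M t) (gr_eval comp bnd M t') ^+ k).
  move=> cM; rewrite hypmxX -!(gr_evalX gr cM); exact: t_torsion.
have xk : eqK (hypmx x x' ^+ k) 1%:M.
  have gx := gH _ _ _ ix; have gLF := gH _ _ _ iLF.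
  have e1 : eqK (hypmx (L' *m F) (F' *m L)) (stab g (hypmx x x')).
    by move: iLF; rewrite eLF => i; exact: hypmx_upper_block.
  have gF := gH _ _ _ iF; have gL := gH _ _ _ (inverse_mxC iL).
  have e2 : eqK (hypmx (L' *m F) (F' *m L) ^+ k) 1%:M.
    rewrite -(hypmxM FR); have g1 := GQX FR k gL; have g2 := GQX FR k gF.
    apply: (eqK_trans FR (GQM FR g1 g2) (eqKXM FR k gL gF)).
    apply: (eqK_sym FR (GQ1 FR _) (GQM FR g1 g2)); apply/(eqK1 FR (GQM FR g1 g2)).
    apply: (EQstM FR _ (trivial_eval _ _ cB)).
    apply: (EQstV (trivial_eval _ _ cY)); rewrite !hypmxX; apply: (hypmx_inverse FR).
    by rewrite -!(gr_evalX gr cY); apply: (gr_eval_inverse gr cY);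
      rewrite -exprMn_comm ?tt' ?t't ?expr1n // /GRing.comm tt' t't.
  apply: (iffLR (@eqK_stab _ _ _ _ FR _ g _ _ (GQX FR k gx))).
  rewrite (stab_expr g (hypmx x x') k) (stab1 A a g).
  have gs := stab_GQ FR g gx.
  have h3 := eqK_sym FR (GQX FR k gLF) (GQX FR k gs) (eqKX FR k gLF gs e1).
  exact: (eqK_trans FR (GQX FR k gLF) h3 e2).
(* These commutators satisfy [W (j + 1) = W 1 * (u' W j u)]. All factors are block upper triangular,
   so the relation descends to the corners, where conjugation does not change classes: the corner of
   [W j] has [j] times the class of [x]. *)
pose W j : 'M_(a + g) := L' *m (u' ^+ j *m L *m u ^+ j).
have [W1 dW1] : ulsubmx (W 1%N) = x /\ dlsubmx (W 1%N) = 0.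
  have [] := commutator_corner gr tt' t't bt bt' iu bu bu' uX cu cu'.
  by rewrite -/L -/L' -/B -/F eLF block_mxKul /W !expr1; split.
have du := band0_dlsubmx bu; have du' := band0_dlsubmx bu'.
pose v : 'M_a := ulsubmx (u : 'M_(a + g)); pose v' : 'M_a := ulsubmx (u' : 'M_(a + g)).
have iv : inverse_mx v v'.
  by split; rewrite -ulsubmxM ?du ?du' ?iu.1 ?iu.2 ?ulsubmx1.
have WS j : W j.+1 = W 1%N *m (u' *m W j *m u).
  rewrite /W !expr1 exprS exprSr !mulmxA; congr (_ *m _).
  rewrite -[_ *m u *m u']mulmxA iu.1 mulmx1 -[_ *m L *m L']mulmxA iL.1 mulmx1.
  by rewrite -!mulmxA.
have Wj j : exists y y', [/\ inverse_mx y y', ulsubmx (W j) = y,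
   dlsubmx (W j) = 0 & eqK (hypmx y y') (hypmx x x' ^+ j)].
  elim: j => [|j [y [y' [iy ey dy hy]]]].
    exists 1%:M, 1%:M; rewrite /W !expr0 mul1mx mulmx1 iL.2 ulsubmx1 dlsubmx1 (hypmx1 FR).
    by split; [exact: inverse_mx1 | | | exact: (eqK_refl FR (GQ1 FR _))].
  exists (x *m (v' *m y *m v)), ((v' *m (y' *m v)) *m x').
  have iyv : inverse_mx (v' *m y *m v) (v' *m (y' *m v)).
    exact: (inverse_mxM (inverse_mxM (inverse_mxC iv) iy) iv).
  have dyv : dlsubmx (u' *m W j *m u) = 0 by exact: (dlsubmxM (dlsubmxM du' dy) du).
  split.
  - exact: inverse_mxM.
  - by rewrite WS (ulsubmxM _ dyv) W1 (ulsubmxM _ du) (ulsubmxM _ dy) ey.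
  - by rewrite WS; exact: (dlsubmxM dW1 dyv).
  rewrite -(hypmxM FR) exprS.
  have gx := gH _ _ _ ix; have gy := gH _ _ _ iy.
  apply: (eqK_mul FR gx (gH _ _ _ iyv) gx (eqK_refl FR gx)).
  rewrite -!(hypmxM FR).
  exact: (eqK_trans FR gy (eqK_conj FR gy (gH _ _ _ iv) (hypmx_inverse FR iv)) hy).
have [y [y' [iy ey _ hy]]] := Wj k.
(* At [j = k] the power of [u] is [1 - X], so the corner killed above is the one computed by
   [unit_corner]. *)
have iX : inverse_mx (1%:M - shiftl A m) (u' ^+ k).
  rewrite -uk; split; have e : GRing.comm u u' by rewrite /GRing.comm [u * u']iu.1 [u' * u]iu.2.
    by rewrite -[_ *m _]/(_ * _) -exprMn_comm // [u * u']iu.1 expr1n.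
  by rewrite -[_ *m _]/(_ * _) -exprMn_comm // [u' * u]iu.2 expr1n.
have [c0 ec] := unit_corner gr tt' t't bt iX.
rewrite /W uk ec in ey.
have h0 : comp 0 t * comp 0 t' = 1 by rewrite -(comp0M gr) tt' (comp01 gr).
have h0' : comp 0 t' * comp 0 t = 1 by rewrite -(comp0M gr) t't (comp01 gr).
have it : inverse_mx (t%:M : 'M_1) t'%:M by split; rewrite -scalar_mxM ?tt' ?t't.
have it0 : inverse_mx ((comp 0 t)%:M : 'M_1) (comp 0 t')%:M.
  by split; rewrite -scalar_mxM ?h0 ?h0'.
have iw := inverse_mxM (inverse_mxC it0) it; have gw := gH _ _ _ iw.
rewrite eqKE (gqinv_eq FR (gH _ _ _ it0) (hypmx_inverse FR it0)) (hypmxM FR).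
apply/(EQst_stab FR (2 * g)).
have gw' := stab_GQ FR (2 * g) gw; apply/(eqK1 FR gw').
have e3 : eqK (hypmx y y') (stab (2 * g) (hypmx ((comp 0 t')%:M *m t%:M) (t'%:M *m (comp 0 t)%:M))).
  by move: iy; rewrite -ey scalar_mxM; exact: hypmx_lower_block.
have e4 := eqK_sym FR (gH _ _ _ iy) gw' e3.
have e5 := eqK_trans FR (gH _ _ _ iy) e4 hy.
exact: (eqK_sym FR gw' (GQ1 FR _) (eqK_trans FR (GQX FR k (gH _ _ _ ix)) e5 xk)).
Qed.
End GradedK1.

(** * Degree zero components *)

Section GradedRing.
Variables (R : pzRingType) (G : nat -> R -> Prop).
Hypothesis grR : is_graded_ring G.

Lemma hom0 i : G i 0. Proof. by case: (grad_additive grR i). Qed.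
Lemma homB i x y : G i x -> G i y -> G i (x - y).
Proof. by case: (grad_additive grR i) => _; apply. Qed.
Lemma homD i x y : G i x -> G i y -> G i (x + y).
Proof. by move=> hx hy; rewrite -[y]opprK; apply: homB => //; rewrite -sub0r; apply: homB => //; exact: hom0. Qed.

(** The grading is given by predicates; a choice principle extracts actual components from the
    existence of decompositions. *)
Lemma hom_decomposition x : {mf : nat * (nat -> R) |
  (forall i, G i (mf.2 i)) /\ x = \sum_(i < mf.1) mf.2 i}.
Proof.
apply: constructive_indefinite_description.
by have [/(_ x) [/(_ I) [m [f h]] _] _] := grad_sum grR; exists (m, f).
Qed.

Definition ring_bnd x := (sval (hom_decomposition x)).1.
Definition ring_comp i x :=
  if (i < ring_bnd x)%N then (sval (hom_decomposition x)).2 i else 0.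

Lemma ring_comp_hom i x : G i (ring_comp i x).
Proof.
rewrite /ring_comp; case: ifP => _; last exact: hom0.
by case: (svalP (hom_decomposition x)).
Qed.

Lemma ring_comp_sum x g : (ring_bnd x <= g)%N -> x = \sum_(i < g) ring_comp i x.
Proof.
move=> h; have [_ {1}->] := svalP (hom_decomposition x).
rewrite -/(ring_bnd x) (big_ord_widen _ (fun i => (sval (hom_decomposition x)).2 i) h).
by rewrite big_mkcond.
Qed.

Lemma hom_uniq m (f f' : nat -> R) : (forall i, G i (f i)) -> (forall i, G i (f' i)) ->
  \sum_(i < m) f i = \sum_(i < m) f' i -> forall i, (i < m)%N -> f i = f' i.
Proof.
move=> hf hf' e i im; apply/eqP; rewrite -subr_eq0; apply/eqP.
have [_ h] := grad_sum grR.
apply: (h m (fun i => f i - f' i)) => //; first by move=> j; exact: homB.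
by rewrite sumrB e subrr.
Qed.

Lemma ring_comp_uniq x m (f : nat -> R) : (forall i, G i (f i)) ->
  (forall i, (m <= i)%N -> f i = 0) -> x = \sum_(i < m) f i -> forall i, ring_comp i x = f i.
Proof.
move=> hf f0 e i; pose M := maxn (maxn m (ring_bnd x)) i.+1.
apply: (@hom_uniq M (ring_comp^~ x)) => //; first by move=> j; exact: ring_comp_hom.
  rewrite -ring_comp_sum ?leq_max ?leqnn ?orbT // e.
  have mM : (m <= M)%N by rewrite !leq_max leqnn.
  rewrite (big_ord_widen _ f mM) big_mkcond; apply: eq_bigr => j _.
  by case: ltnP => // /f0.
by rewrite leq_maxr.
Qed.

Lemma ring_grading : grading G ring_comp ring_bnd.
Proof.
split.
- exact: ring_comp_hom.
- move=> i x h; apply: (@ring_comp_uniq x i.+1) => [j|j ij|].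
  + by case: eqP => [->|_] //; exact: hom0.
  + by rewrite gtn_eqF.
  rewrite (bigD1 ord_max) //= eqxx big1 ?addr0 // => j.
  by rewrite -val_eqE /= => /negbTE ->.
- move=> n x y; pose M := maxn (ring_bnd x) (ring_bnd y).
  apply: (@ring_comp_uniq _ M (fun n => ring_comp n x + ring_comp n y)).
  + by move=> i; apply: homD; exact: ring_comp_hom.
  + move=> i; rewrite geq_max => /andP [hx hy].
    by rewrite /ring_comp !ltnNge hx hy addr0.
  by rewrite big_split /= -!ring_comp_sum ?leq_maxl ?leq_maxr.
- exact: ring_comp_sum.
- exact: (grad_mul grR).
- exact: (grad_one grR).
Qed.

Variable N : nat.

Definition mx_hom i (X : 'M[R]_N) := forall p q, G i (X p q).
Definition mx_comp i (X : 'M[R]_N) := map_mx (ring_comp i) X.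
Definition mx_bnd (X : 'M[R]_N) := (\max_p \max_q ring_bnd (X p q))%N.

Lemma mx_grading : grading mx_hom mx_comp mx_bnd.
Proof.
have gr := ring_grading; split.
- by move=> i X p q; rewrite mxE; exact: ring_comp_hom.
- move=> i X h n; apply/matrixP=> p q; rewrite mxE (gr_compE gr (h p q)).
  by case: ifP => // _; rewrite mxE.
- by move=> n X Y; apply/matrixP=> p q; rewrite !mxE (gr_compD gr).
- move=> X g h; apply/matrixP=> p q; rewrite summxE {1}(gr_sum gr (x := X p q) (g := g)).
    by apply: eq_bigr => i _; rewrite mxE.
  apply: leq_trans h; apply: leq_trans (leq_bigmax p).
  exact: (leq_bigmax (F := fun q => ring_bnd (X p q)) q).
- move=> i j X Y hX hY p q; rewrite mxE; elim/big_ind: _ => [|x y|k _].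
  + exact: hom0.
  + exact: homD.
  + exact: (grad_mul grR).
- by move=> p q; rewrite mxE; case: (p == q); [exact: (grad_one grR) | exact: hom0].
Qed.
End GradedRing.

Section DegreeZero.
Variables (R : pzRingType) (bar : R -> R) (lam : R) (L : R -> Prop) (G : nat -> R -> Prop).
Hypothesis GF : is_graded_form_ring bar lam L G.
Local Notation st := (starmx bar).
Local Notation GQ := (GQ bar lam L).
Local Notation EQ := (@EQ R bar lam L _).
Local Notation LH := (Lambda_hermitian bar lam L).

Let FR : is_form_ring bar lam L := gform_form GF.
Let grR : is_graded_ring G := gform_graded GF.
Let gr := ring_grading grR.
Let barP := form_bar FR.
Local Notation c0 := (ring_comp grR 0).
Definition deg0 m n (X : 'M[R]_(m, n)) : 'M[R]_(m, n) := map_mx c0 X.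

Lemma ring_comp0_bar x : c0 (bar x) = bar (c0 x).
Proof.
have hb i y : G i y -> G i (bar y) by move=> h; apply/(gform_bar GF); exists y.
have hx := gr_sum gr (leqnSn (ring_bnd grR x)).
rewrite {1}hx (bar_sum barP) (comp_bigsum gr) big_ord_recl big1 ?addr0 => [|i _].
  by rewrite (gr_compE gr (hb _ _ (gr_comp gr _ _))).
by rewrite (gr_compE gr (hb _ _ (gr_comp gr _ _))).
Qed.

(** The homogeneous pieces of [x] may be taken inside [L]. With [ring_comp0_bar] and [lam] in degree
    0, the projection to degree 0 is thus an endomorphism of the form ring and acts on [GQ] and
    [EQ]. *)
Lemma ring_comp0_form x : L x -> L (c0 x).
Proof.
have [h _] := gform_L GF; move=> /h [m [f [hf ->]]].
rewrite (comp_bigsum gr); apply: (formpar_sum FR) => i _.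
by rewrite (gr_compE gr (hf i).2); case: ifP => _; [exact: (hf i).1 | exact: formpar0 FR].
Qed.

Lemma deg0M m n p (X : 'M_(m, n)) (Y : 'M_(n, p)) : deg0 (X *m Y) = deg0 X *m deg0 Y.
Proof.
apply/matrixP=> i j; rewrite !mxE (comp_bigsum gr); apply: eq_bigr => k _.
by rewrite (comp0M gr) !mxE.
Qed.

Lemma deg0D m n (X Y : 'M_(m, n)) : deg0 (X + Y) = deg0 X + deg0 Y.
Proof. by apply/matrixP=> i j; rewrite !mxE (gr_compD gr). Qed.

Lemma deg0_0 m n : deg0 (0 : 'M_(m, n)) = 0.
Proof. by apply/matrixP=> i j; rewrite !mxE (comp0 gr). Qed.

Lemma deg0N m n (X : 'M_(m, n)) : deg0 (- X) = - deg0 X.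
Proof. by apply: (addrI (deg0 X)); rewrite -deg0D !subrr deg0_0. Qed.

Lemma deg0_scalar n a : deg0 (a%:M : 'M_n) = (c0 a)%:M.
Proof. by apply/matrixP=> i j; rewrite !mxE; case: eqP => _; rewrite ?mulr1n ?mulr0n ?(comp0 gr). Qed.

Lemma deg0_1 n : deg0 (1%:M : 'M_n) = 1%:M.
Proof. by rewrite deg0_scalar (comp01 gr). Qed.

Lemma deg0X n (X : 'M_n) k : deg0 (X ^+ k) = deg0 X ^+ k.
Proof. by elim: k => [|k IH]; rewrite ?expr0 ?deg0_1 // !exprS -IH; exact: deg0M. Qed.

Lemma deg0_block m1 m2 n1 n2 (A : 'M_(m1, n1)) (B : 'M_(m1, n2)) (C : 'M_(m2, n1)) (D : 'M_(m2, n2)) :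
  deg0 (block_mx A B C D) = block_mx (deg0 A) (deg0 B) (deg0 C) (deg0 D).
Proof. exact: map_block_mx. Qed.

Lemma deg0_star m n (X : 'M_(m, n)) : deg0 (st X) = st (deg0 X).
Proof. by apply/matrixP=> i j; rewrite !mxE ring_comp0_bar. Qed.

Lemma deg0_inverse n (X Y : 'M_n) : inverse_mx X Y -> inverse_mx (deg0 X) (deg0 Y).
Proof. by move=> [h h']; split; rewrite -deg0M ?h ?h' deg0_1. Qed.

Lemma deg0_LH n (X : 'M_n) : LH X -> LH (deg0 X).
Proof.
move=> [h d]; split=> [|i]; last by rewrite mxE; exact: ring_comp0_form.
have cl : c0 lam = lam by rewrite (gr_compE gr (gform_lam GF)).
by rewrite {1}h deg0N -mul_scalar_mx deg0M deg0_scalar cl deg0_star mul_scalar_mx.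
Qed.

Lemma deg0_hyp n : deg0 (hyp R n) = hyp R n.
Proof. by rewrite /hyp deg0_block !deg0_0 deg0_1. Qed.

Lemma deg0_GQ n (s : 'M_(n + n)) : GQ s -> GQ (deg0 s).
Proof.
move=> /(GQP FR) [[s' i] h]; apply/(GQP FR); split; first by exists (deg0 s'); exact: deg0_inverse.
by have := deg0_LH h; rewrite deg0D deg0N !deg0M deg0_star deg0_hyp.
Qed.

Lemma deg0_elementary n (e : 'M_n) : elementary e -> elementary (deg0 e).
Proof.
apply: gen_subgroup_morph; [exact: deg0_1 | by move=> B C; exact: deg0M|].
move=> B [i [j [x [ij ->]]]]; apply: gen_base; exists i, j, (c0 x); split=> //.
rewrite deg0D deg0_1; congr (_ + _); apply/matrixP=> p q; rewrite !mxE.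
by case: (_ && _); rewrite ?mulr1 ?mulr0 ?(comp0 gr).
Qed.

Lemma deg0_EQ n (s : 'M_(n + n)) : EQ s -> EQ (deg0 s).
Proof.
apply: gen_subgroup_morph; [exact: deg0_1 | by move=> B C; exact: deg0M|].
move=> B hB; have gB : GQ (deg0 B) by apply/deg0_GQ/(EQ_GQ FR)/gen_base.
case: hB gB => [e f he hf|b _|c _].
- move=> _; have [e' ie] := elementary_inverse he.
  rewrite (inverse_mx_uniq hf (star_inverse barP ie)) deg0_block !deg0_0 deg0_star.
  by apply: (EQ_hypmx FR); [exact: deg0_elementary | exact: deg0_inverse].
- rewrite deg0_block !deg0_0 !deg0_1; exact: EQ_upper_GQ.
- rewrite deg0_block !deg0_0 !deg0_1; exact: EQ_lower_GQ.
Qed.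

Lemma deg0_stab n m (s : 'M_(n + n)) : deg0 (stab m s) = stab m (deg0 s).
Proof.
by rewrite -[s]submxK deg0_block !stab_block !deg0_block !deg0_0 !deg0_1.
Qed.

Lemma deg0_sum m n r (F : nat -> 'M_(m, n)) :
  (forall i, (i <= r)%N -> forall p q, G i (F i p q)) ->
  deg0 (\sum_(0 <= i < r.+1) F i) = F 0%N.
Proof.
move=> h; apply/matrixP=> p q; rewrite mxE summxE big_mkord (comp_bigsum gr) big_ord_recl.
rewrite (gr_compE gr (h 0%N isT p q)) /= big1 ?addr0 // => i _.
by rewrite (gr_compE gr (h _ _ p q)) // -ltnS.
Qed.
End DegreeZero.

(** * Matrices over a matrix ring *)

Section Flatten.
Variables (R : pzRingType) (N : nat).
Local Notation A := 'M[R]_N.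

(** The identification of matrices over a matrix ring with larger matrices over [R], indexed by
    pairs through the tensor product bijection. *)
Definition flatten_mx m n (M : 'M[A]_(m, n)) : 'M[R]_(m * N, n * N) :=
  \matrix_(k, l) M (mxtens_unindex k).1 (mxtens_unindex l).1
                   (mxtens_unindex k).2 (mxtens_unindex l).2.

Lemma flatten_mxE m n (M : 'M[A]_(m, n)) i j p q :
  flatten_mx M (mxtens_index (i, p)) (mxtens_index (j, q)) = M i j p q.
Proof. by rewrite mxE !mxtens_indexK. Qed.

Lemma flattenP m n (X Y : 'M[R]_(m * N, n * N)) :
  (forall i j p q, X (mxtens_index (i, p)) (mxtens_index (j, q)) =
                   Y (mxtens_index (i, p)) (mxtens_index (j, q))) -> X = Y.
Proof.
move=> h; apply/matrixP=> k l.
by case: (mxtens_indexP k) => i p; case: (mxtens_indexP l) => j q.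
Qed.

Lemma flattenD m n (X Y : 'M[A]_(m, n)) : flatten_mx (X + Y) = flatten_mx X + flatten_mx Y.
Proof. by apply/matrixP=> k l; rewrite !mxE. Qed.

Lemma flattenN m n (X : 'M[A]_(m, n)) : flatten_mx (- X) = - flatten_mx X.
Proof. by apply/matrixP=> k l; rewrite !mxE. Qed.

Lemma flatten0 m n : flatten_mx (0 : 'M[A]_(m, n)) = 0.
Proof. by apply/matrixP=> k l; rewrite !mxE. Qed.

Lemma flatten1 n : flatten_mx (1%:M : 'M[A]_n) = 1%:M.
Proof.
apply: flattenP => i j p q; rewrite flatten_mxE !mxE (can_eq (@mxtens_indexK n N)) xpair_eqE.
by case: (i == j); rewrite mxE.
Qed.

Lemma flattenM m n p (X : 'M[A]_(m, n)) (Y : 'M[A]_(n, p)) :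
  flatten_mx (X *m Y) = flatten_mx X *m flatten_mx Y.
Proof.
apply: flattenP => i j a b; rewrite flatten_mxE !mxE summxE.
rewrite (reindex (@mxtens_index n N)) /=; last first.
  by exists (@mxtens_unindex n N) => k _; rewrite (mxtens_indexK, mxtens_unindexK).
pose F k c := flatten_mx X (mxtens_index (i, a)) (mxtens_index (k, c)) *
  flatten_mx Y (mxtens_index (k, c)) (mxtens_index (j, b)).
transitivity (\sum_k \sum_c F k c); last first.
  by rewrite pair_bigA; apply: eq_bigr => -[].
apply: eq_bigr => k _; rewrite mxE; apply: eq_bigr => c _.
by rewrite /F !flatten_mxE.
Qed.

Lemma flatten_star bar m n (X : 'M[A]_(m, n)) :
  flatten_mx (starmx (@starmx R bar N N) X) = starmx bar (flatten_mx X).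
Proof. by apply: flattenP => i j p q; rewrite flatten_mxE !mxE !mxtens_indexK. Qed.

Lemma flatten_scale m n a (X : 'M[A]_(m, n)) : flatten_mx (a%:M *: X) = a *: flatten_mx X.
Proof.
apply: flattenP => i j p q; rewrite flatten_mxE.
have -> : (a%:M *: X) i j = a *: X i j by rewrite mxE; exact: mul_scalar_mx.
by rewrite !mxE !mxtens_indexK.
Qed.

Lemma flatten_inverse n (X Y : 'M[A]_n) : inverse_mx X Y -> inverse_mx (flatten_mx X) (flatten_mx Y).
Proof. by move=> [h h']; split; rewrite -flattenM ?h ?h' flatten1. Qed.

Lemma flatten_elementary n (e : 'M[A]_n) : elementary e -> elementary (flatten_mx e).
Proof.
apply: (gen_subgroup_morph (f := @flatten_mx n n)); [exact: flatten1 | by move=> B C; exact: flattenM|].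
move=> _ [i [j [x [ij ->]]]]; rewrite -/(elementary _).
(* A generator over [A] has a whole matrix [x] as its entry; since [i != j], [Q] is additive in [x],
   which reduces it to multiples of matrix units. *)
pose Q (x : A) := elementary (flatten_mx (1%:M + x *: delta_mx i j)).
have QD x1 x2 : Q x1 -> Q x2 -> Q (x1 + x2).
  rewrite /Q => h1 h2; have := gen_mul h1 h2.
  rewrite -flattenM mulmxDl mul1mx mulmxDr mulmx1 mul_delta_delta0 1?eq_sym // addr0.
  by rewrite -addrA [_ *: _ + _]addrC -scalerDl.
have Q0 : Q 0 by rewrite /Q scale0r addr0 flatten1; exact: gen_one.
rewrite -/(Q x) (matrix_sum_delta x).
apply: (big_ind Q) => // p _; apply: (big_ind Q) => // q _.
apply: gen_base; exists (mxtens_index (i, p)), (mxtens_index (j, q)), (x p q).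
rewrite (can_eq (@mxtens_indexK n N)) xpair_eqE (negbTE ij); split=> //.
rewrite flattenD flatten1; congr (_ + _); apply: flattenP => a b c d; rewrite flatten_mxE.
have -> : ((x p q *: delta_mx p q : A) *: delta_mx i j : 'M[A]_n) a b =
    if (a == i) && (b == j) then x p q *: delta_mx p q else 0.
  by rewrite 2!mxE; case: (_ && _); rewrite ?mulr1 ?mulr0.
rewrite !mxE !(can_eq (@mxtens_indexK n N)) !xpair_eqE andbACA.
by case: (_ && _); rewrite !mxE ?mulr0.
Qed.

(** The statement type checks because [(1 + m) * N] computes to [N + m * N]. It turns stabilization
    of 1 x 1 blocks over [A] into stabilization by [m * N] over [R]. *)
Lemma flatten_block m (a : A) (D : 'M[A]_m) :
  flatten_mx (block_mx (a%:M : 'M_1) 0 0 D) = block_mx a 0 0 (flatten_mx D) :> 'M[R]_(N + m * N).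
Proof.
have ul (k : 'I_N) : mxtens_unindex (lshift (m * N) k : 'I_((1 + m) * N)) = (lshift m 0, k).
  have -> : lshift (m * N) k = mxtens_index (lshift m (0 : 'I_1), k) by exact: val_inj.
  exact: mxtens_indexK.
have ur (k : 'I_(m * N)) : mxtens_unindex (rshift N k : 'I_((1 + m) * N)) =
    (rshift 1 (mxtens_unindex k).1, (mxtens_unindex k).2).
  case: (mxtens_indexP k) => i p; rewrite mxtens_indexK.
  have -> : rshift N (mxtens_index (i, p)) = mxtens_index (rshift 1 i, p).
    by apply: val_inj => /=; rewrite mulnDl mul1n addnA.
  exact: mxtens_indexK.
apply/matrixP => k l; case: (split_ordP k) => i ->; case: (split_ordP l) => j ->.
- by rewrite (block_mxEul a) mxE ul ul block_mxEul mxE.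
- by rewrite (block_mxEur a) mxE ul ur block_mxEur !mxE.
- by rewrite (block_mxEdl a) mxE ur ul block_mxEdl !mxE.
- by rewrite (block_mxEdr a) mxE ur ur block_mxEdr mxE.
Qed.
End Flatten.

Section MatrixFormRing.
Variables (R : pzRingType) (bar : R -> R) (lam : R) (L : R -> Prop).
Hypothesis FR : is_form_ring bar lam L.
Let barP : is_involution bar := form_bar FR.
Let lamC : forall x, lam * x = x * lam := form_lam_central FR.
Variable N : nat.
Local Notation A := 'M[R]_N.
Local Notation barA := (@starmx R bar N N).
Local Notation lamA := (lam%:M : A).
Local Notation LA := (@Lambda_hermitian R bar lam L N).

Lemma matrix_form_ring : is_form_ring barA lamA LA.
Proof.
have sl (X : A) : lamA * X = lam *: X by exact: mul_scalar_mx.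
split.
- by split; [exact: (starD barP) | exact: (starM barP) | exact: (starK barP)].
- move=> X; rewrite sl -[X * _]/(X *m _) -scalemx1 (mulmxZr _ _ lamC) mulmx1 //.
- by rewrite (star_scalar barP) -[_ * _]/(_ *m _) -scalar_mxM (lam_bar FR).
- by split; [exact: LH0 FR _ | move=> X Y; exact: LHB FR _ _ _].
- by move=> _ [X ->]; rewrite sl; exact: (LH_trace FR X).
- by move=> X [h _]; rewrite /Lambda_max sl.
- by move=> X Y h; exact: (LH_conj FR X h).
Qed.
Local Notation FA := matrix_form_ring.

Lemma flatten_LH n (X : 'M[A]_n) : Lambda_hermitian barA lamA LA X ->
  Lambda_hermitian bar lam L (flatten_mx X).
Proof.
move=> [h d]; split=> [|k].
  by rewrite {1}h flattenN flatten_scale flatten_star.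
by case: (mxtens_indexP k) => i p; rewrite flatten_mxE; case: (d i).
Qed.

Definition flatten_blocks n (s : 'M[A]_(n + n)) : 'M[R]_(n * N + n * N) :=
  block_mx (flatten_mx (ulsubmx s)) (flatten_mx (ursubmx s))
           (flatten_mx (dlsubmx s)) (flatten_mx (drsubmx s)).

Lemma flatten_blocksE n (a b c d : 'M[A]_n) : flatten_blocks (block_mx a b c d) =
  block_mx (flatten_mx a) (flatten_mx b) (flatten_mx c) (flatten_mx d).
Proof. by rewrite /flatten_blocks block_mxKul block_mxKur block_mxKdl block_mxKdr. Qed.

Lemma flatten_EQ n (s : 'M[A]_(n + n)) : EQ barA lamA LA s ->
  EQ bar lam L (flatten_blocks s).
Proof.
apply: (gen_subgroup_morph (f := @flatten_blocks n)).
- by rewrite (scalar_mx_block n n) flatten_blocksE flatten0 flatten1 -scalar_mx_block.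
- move=> B C; rewrite -{1}[B]submxK -{1}[C]submxK mulmx_block flatten_blocksE.
  by rewrite /flatten_blocks mulmx_block !flattenD !flattenM.
move=> _ [e f he hf|b hb|c hc]; rewrite flatten_blocksE !(flatten0, flatten1).
- apply/gen_base/EQ_diag; first exact: flatten_elementary.
  by rewrite -flatten_star; exact: flatten_inverse.
- apply/gen_base/EQ_upper/(LH_starP FR); rewrite -flatten_star; apply: flatten_LH.
  exact/(LH_starP FA).
- by apply/gen_base/EQ_lower; exact: flatten_LH.
Qed.

Lemma flatten_EQst (a b c d : A) :
  EQ_stable barA lamA LA (block_mx (a%:M : 'M_1) b%:M c%:M d%:M) ->
  EQ_stable bar lam L (block_mx a b c d).
Proof.
move=> [m /flatten_EQ h]; exists (m * N)%N.
by move: h; rewrite !stab_block flatten_blocksE !flatten_block flatten0 flatten1.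
Qed.
End MatrixFormRing.

(** * Evaluation of elementary matrices over a matrix ring *)

Section EvaluateElementary.
Variables (R : pzRingType) (N : nat).
Local Notation A := 'M[R]_N.
Variables (bar : A -> A) (lam : A) (L : A -> Prop).
Hypothesis FR : is_form_ring bar lam L.
Variables (G : nat -> A -> Prop) (comp : nat -> A -> A) (bnd : A -> nat).
Hypothesis gr : grading G comp bnd.
Local Notation EQst := (EQ_stable bar lam L).

(** As an element of [A], a generator is [1 + a b] with [b a = 0], and the ring morphism of
    evaluation keeps this form. One doubling then makes it a commutator of elementary matrices,
    whatever its entries have become. *)
Lemma gr_eval_elementary m (B : 'M[A]_m) (y y' : A) : central_mx B ->
  elementary y -> inverse_mx y y' ->
  EQst (hypmx bar (gr_eval comp bnd B y) (gr_eval comp bnd B y')).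
Proof.
move=> cB ey; pose ev := gr_eval comp bnd B.
have evi x x' : inverse_mx x x' -> inverse_mx (ev x) (ev x').
  by move=> [h h']; exact: (gr_eval_inverse gr cB h h').
elim: ey y' => [_ [i [j [x [ij ->]]]]||X Y hX IX hY IY|X Y hX IX iXY] y' iy.
- pose a : A := x *: delta_mx i i; pose b : A := 1 *: delta_mx i j.
  have eab : x *: delta_mx i j = a * b by rewrite -[a * b]/(a *m b) mul_delta_delta mulr1.
  have eba : b * a = 0 by rewrite -[b * a]/(b *m a) mul_delta_delta0 // eq_sym.
  exists m; rewrite (stab_hypmx FR); apply: (EQ_hypmx FR).
    rewrite eab (gr_evalD gr) (gr_eval1 gr) (gr_evalM gr cB).
    by apply: elementary_commutator; rewrite -(gr_evalM gr cB) eba (gr_eval0 gr).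
  by apply: inverse_mx_block; [exact: evi | exact: inverse_mx1].
- have <- : 1%:M = y' by rewrite -[RHS]mul1mx; case: iy.
  rewrite (gr_eval1 gr) (hypmx1 FR); exact: EQst1.
- have [X' iX] := elementary_inverse hX; have [Y' iY] := elementary_inverse hY.
  rewrite (inverse_mx_uniq iy (inverse_mxM iX iY)).
  rewrite !(gr_evalM gr cB) -(hypmxM FR).
  exact: (EQstM FR (IX _ iX) (IY _ iY)).
- have ei := inverse_mx_uniq iy (inverse_mxC iXY); rewrite ei.
  exact: (EQstV (IX _ iXY) (hypmx_inverse FR (evi _ _ iXY))).
Qed.
End EvaluateElementary.

Section EQElementary.
Variables (R : pzRingType) (bar : R -> R) (lam : R) (L : R -> Prop).
Hypothesis FR : is_form_ring bar lam L.

(** Forgetting the form is what allows evaluation, which does not respect the involution. The blocks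
    [f] remain elementary because conjugate transposition preserves the elementary group. *)
Lemma EQ_elementary n (s : 'M_(n + n)) : EQ bar lam L s -> elementary s.
Proof.
apply: gen_subgroupS => _ [e f he hf|b _|c _]; [|exact: elementary_upper|exact: elementary_lower].
have ef : elementary f.
  exact: (gen_inv (elementary_star (form_bar FR) he) hf).
have -> : block_mx e 0 0 f = block_mx e 0 0 1%:M *m block_mx 1%:M 0 0 f by blk.
by apply: gen_mul; [exact: elementary_block_l | exact: elementary_block_r].
Qed.
End EQElementary.

Section TorsionUnipotent.
Variable A : pzRingType.

(** The binomial formula gives [k M = - M^2 w], so [M] is [M] times a nilpotent factor; substituting
    this into itself [m] times yields zero. *)
Lemma torsion_unipotent (M c : A) k m : (forall x, c * x = x * c) ->
  k%:R * c = 1 -> M ^+ m = 0 -> (1 + M) ^+ k = 1 -> M = 0.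
Proof.
move=> cc kc Mm Mk; pose P x := GRing.comm M x.
have [w Pw Ew] := @binomial_remainder A P (commr1 M) (@commrB A M) (@commrM A M) M k (erefl _).
have MkE : M *+ k = M * (- (M * w)).
  apply/eqP; rewrite mulrN -addr_eq0 mulrA -expr2; apply/eqP/(@addrI _ 1).
  by rewrite addr0 addrA -Ew.
have E : M = M * (- (M * w) * c) by rewrite mulrA -MkE -mulr_natr -mulrA kc mulr1.
have Ej j : M = M * (- (M * w) * c) ^+ j.
  by elim: j => [|j IH]; rewrite ?expr0 ?mulr1 // exprS mulrA -E.
rewrite (Ej m) exprMn_comm; last by rewrite /GRing.comm cc.
by rewrite exprNn exprMn_comm // Mm mul0r mulr0 mul0r mulr0.
Qed.
End TorsionUnipotent.

Section RootInGQ.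
Variables (R : pzRingType) (bar : R -> R) (lam : R) (L : R -> Prop).
Hypothesis FR : is_form_ring bar lam L.
Local Notation st := (starmx bar).
Local Notation GQ := (GQ bar lam L).
Local Notation adj := (gqinv bar lam).
Let barP : is_involution bar := form_bar FR.

(* With [2] invertible there is only one form parameter. *)
Lemma half_form (h x : R) : (forall y, h * y = y * h) -> 2%:R * h = 1 ->
  x = - (lam * bar x) -> L x.
Proof.
move=> hc h2 hx.
have e2 : bar 2%:R = 2%:R by rewrite mulr2n (bar_add barP) (bar1 barP).
have bh : bar h = h.
  have e : bar h * 2%:R = 1 by rewrite -{1}e2 -(bar_mul barP) h2 (bar1 barP).
  by rewrite -[LHS]mulr1 -h2 mulrA e mul1r.
have <- : h * x - lam * bar (h * x) = x; last exact: formpar_trace FR _.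
rewrite (bar_mul barP) bh mulrA -mulNr -hx -hc.
by rewrite -mulr2n -mulr_natl mulrA h2 mul1r.
Qed.

Lemma GQ_half n (h : R) (T : 'M_(n + n)) : (forall y, h * y = y * h) -> 2%:R * h = 1 ->
  inGL T -> st T *m psi lam n *m T = psi lam n -> GQ T.
Proof.
move=> hc h2 iT eT; apply/(GQP FR); split=> //.
have := gram_polar FR T; rewrite eT subrr => /eqP.
rewrite addr_eq0 => /eqP e; split=> // i; apply: (half_form hc h2).
by rewrite {1}e !mxE.
Qed.

(* [T] is the root of [s] in the bicommutant of [N]; then [adj T * T] is a
   unipotent [k]-th root of [1]. *)
Lemma GQ_root n (N : 'M_(n + n)) (h c : R) k m :
  (forall x, h * x = x * h) -> 2%:R * h = 1 -> (forall x, c * x = x * c) -> k%:R * c = 1 ->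
  N ^+ m = 0 -> GQ (1%:M + N) ->
  exists T, [/\ GQ T, T ^+ k = 1%:M + N & (T - 1%:M) ^+ m = 0].
Proof.
move=> hc h2 cc kc Nm gs.
pose B := 'M[R]_(n + n); pose P (X : B) := forall Z : B, Z * N = N * Z -> X * Z = Z * X.
have P1 : P 1 by move=> Z _; rewrite mul1r mulr1.
have Psub X Y : P X -> P Y -> P (X - Y).
  by move=> hX hY Z hZ; rewrite mulrBl mulrBr hX ?hY.
have PM X Y : P X -> P Y -> P (X * Y).
  by move=> hX hY Z hZ; rewrite -mulrA hY // mulrA hX // mulrA.
have PN : P N by move=> Z ->.
have PC X Y : P X -> P Y -> X * Y = Y * X by move=> hX hY; apply: hX; exact: hY.
have cM (X : B) : c%:M * X = X * c%:M.
  by rewrite -[LHS]/(c%:M *m X) -[RHS]/(X *m c%:M) mul_scalar_mx -scalemx1 (mulmxZr _ _ cc) mulmx1.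
have kcM : k%:R * (c%:M : B) = 1 by rewrite -[k%:R]raddfMn -[LHS]/(_ *m _) -scalar_mxM kc.
have Pc : P c%:M by move=> Z _; exact: cM.
have [T [y [Py ET ETk]]] := unipotent_root P1 Psub PM PC PN Pc kcM Nm.
have Ny : N * y = y * N by exact: PC.
have P1D X : P X -> P (1 + X).
  move=> hX; rewrite -[X]opprK; apply: (Psub 1 (- X) P1).
  by rewrite -[- X]sub0r -(subrr 1); apply: (Psub _ _ (Psub _ _ P1 P1) hX).
have PT : P T by rewrite ET; exact: (P1D _ (PM _ _ PN Py)).
have Tm : (T - 1) ^+ m = 0 by rewrite ET addrC addKr exprMn_comm // Nm mul0r.
pose s : B := 1 + N; have [i1 i2] : inverse_mx s (adj s) := gqinvP FR gs.
have adjM X Y : adj (X * Y) = adj Y * adj X :> B by exact: (gqinvM FR).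
have adjX X k' : adj (X ^+ k') = adj X ^+ k' :> B.
  by elim: k' => [|k' IH]; rewrite ?expr0 ?(gqinv1 FR) // exprS exprSr adjM IH.
have adj_s : adj s = 1 + adj N by rewrite /s (gqinvD FR) (gqinv1 FR).
have comm_s (Z Y : B) : GRing.comm Z (1 + Y) -> GRing.comm Z Y.
  by rewrite /GRing.comm mulrDr mulrDl mulr1 mul1r => /addrI.
have comm_inv (Z X X' : B) : X * X' = 1 -> X' * X = 1 -> GRing.comm Z X -> GRing.comm Z X'.
  move=> e1 e2 e; rewrite /GRing.comm -[LHS]mul1r -e2 -!mulrA [X * (Z * _)]mulrA -e.
  by rewrite -mulrA e1 mulr1.
(* [adj s] is the inverse of [s], hence commutes with whatever commutes with [N]. This is what makes
   [adj T] commute with [N], and so with [T]. *)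
have PaN : P (adj N).
  move=> Z e; apply/commr_sym/comm_s; rewrite -adj_s.
  by apply: (comm_inv _ _ _ i1 i2); apply: commrD => //; exact: commr1.
have Pas : P (adj s) by rewrite adj_s; exact: P1D.
have cy : GRing.comm (adj y) N.
  apply: comm_s; apply: (comm_inv _ _ _ i2 i1); rewrite adj_s; apply: commrD; first exact: commr1.
  by rewrite /GRing.comm -!adjM Ny.
pose v : B := - (adj y * adj s).
have cv : GRing.comm v N.
  by apply/commr_sym/commrN/commrM; apply/commr_sym => //; exact: (Pas N erefl).
(* The adjoint of [N] is a multiple of [N]; therefore [adj T * T - 1] is [N] times an element
   commuting with [N], and is nilpotent. *)
have aNE : adj N = - (N * adj s).
  have : adj N * s = - N.
    by apply: (addrI s); rewrite -{1}[s]mul1r -mulrDl -adj_s [LHS]i2 /s addrK.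
  by move/(congr1 (fun X => X * adj s)); rewrite -mulrA [s * adj s]i1 mulr1 mulNr.
have aTE : adj T = 1 + N * v.
  rewrite ET (gqinvD FR) (gqinv1 FR) adjM aNE mulrN mulrA cy -mulrA -mulrN //.
have cT : GRing.comm T (adj T).
  by apply: PT; rewrite aTE; apply/commr_sym/commrD; [exact: commr1 | apply: commrM => //; exact: commr_sym].
pose w := v + y + v * N * y.
have Mw : adj T * T = 1 + N * w.
  by rewrite aTE {1}ET mulrDl mul1r mulrDr mulr1 /w !mulrDr !mulrA -!addrA [N * y + _]addrCA.
have Mm : (N * w) ^+ m = 0.
  rewrite exprMn_comm ?Nm ?mul0r //.
  by apply: commrD; [apply: commrD|apply: commrM => //; apply: commrM] => //; exact: commr_sym.
have : (1 + N * w) ^+ k = 1.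
  by rewrite -Mw exprMn_comm -?adjX ?ETk //; exact: commr_sym.
move/(torsion_unipotent cM kcM Mm) => M0; rewrite M0 addr0 in Mw.
have eT : st T *m psi lam n *m T = psi lam n.
  have := Mw; rewrite (gqinvE FR) => /(congr1 (fun X => psi lam n *m X)).
  by rewrite -[_ * _]/(_ *m _) -!mulmxA [LHS]mulmxA (psi_inverse FR n).1 mul1mx mulmx1 mulmxA.
exists T; split=> //; apply: (GQ_half hc h2) => //.
exists (adj T); split=> //.
exact: (etrans cT Mw).
Qed.
End RootInGQ.

(** * Unipotent elements of GQ *)

Section ScalarIsometries.
Variables (A : pzRingType) (bar : A -> A) (lam : A) (L : A -> Prop).
Hypothesis FR : is_form_ring bar lam L.
Variables f p p' E : A.
Hypotheses (f_polar : f + lam * bar f = p) (pp' : p * p' = 1) (p'p : p' * p = 1)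
  (pE : p * E = f).
Local Notation iota x := (iota_form (p%:M : 'M_1) p'%:M E%:M x%:M).

Lemma nonsingular_scalar : nonsingular bar lam (f%:M : 'M_1) p%:M p'%:M E%:M.
Proof.
split; last by rewrite -scalar_mxM pE.
  by rewrite /polar (star_scalar (form_bar FR)) scale_scalar_mx -raddfD /= f_polar.
by split; rewrite -scalar_mxM ?pp' ?p'p.
Qed.
Local Notation ns := nonsingular_scalar.

Lemma scalar_isometry_GQ t t' : t * t' = 1 -> t' * t = 1 -> L (bar t * f * t - f) ->
  GQ bar lam L (iota t).
Proof.
move=> tt' t't h; apply: (iota_form_GQ FR ns (t' := t'%:M)).
  by split; rewrite -scalar_mxM ?tt' ?t't.
rewrite /form_isometry (star_scalar (form_bar FR)) -!scalar_mxM -raddfB /=.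
split; last by move=> i; rewrite mxE eqxx.
by rewrite (star_scalar (form_bar FR)) scale_scalar_mx -raddfN /= -(form_max FR h).
Qed.

Variables (G : nat -> A -> Prop) (comp : nat -> A -> A) (bnd : A -> nat).
Hypothesis gr : grading G comp bnd.

(** In classes, 16 iota of [comp 0 t] equals 8 H of it, then 8 H(t), then 16 iota(t). The result is
    stated for the iota matrix of one product, so that it can be carried from [A] to [R] by
    flattening. *)
Lemma unipotent_graded (t t' c : A) (k m : nat) :
  t * t' = 1 -> t' * t = 1 -> k%:R * c = 1 -> (forall x, x * c = c * x) ->
  L (bar t * f * t - f) -> L (bar (comp 0 t) * f * comp 0 t - f) ->
  (t - 1) ^+ m = 0 -> (comp 0 t - 1) ^+ m = 0 ->
  (forall i (B : 'M_i), central_mx B ->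
     EQ_stable bar lam L (hypmx bar (gr_eval comp bnd B (t ^+ k)) (gr_eval comp bnd B (t' ^+ k)))) ->
  EQ_stable bar lam L (iota (comp 0 t' ^+ 16 * t ^+ 16)).
Proof.
move=> tt' t't kc cC ht ht0 tm t0m tk.
have h0 : comp 0 t * comp 0 t' = 1 by rewrite -(comp0M gr) tt' (comp01 gr).
have h0' : comp 0 t' * comp 0 t = 1 by rewrite -(comp0M gr) t't (comp01 gr).
have U := unipotent_hyperbolic FR f_polar pp' p'p pE tt' t't ht tm.
have U0 := unipotent_hyperbolic FR f_polar pp' p'p pE h0 h0' ht0 t0m.
have T := graded_torsion FR gr tt' t't kc cC tk.
have gH x x' : x * x' = 1 -> x' * x = 1 -> GQ bar lam L (hypmx bar (x%:M : 'M_1) x'%:M).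
  by move=> h h'; apply: (GQ_hypmx FR); split; rewrite -scalar_mxM ?h ?h'.
have gJ := scalar_isometry_GQ tt' t't ht; have gJ0 := scalar_isometry_GQ h0 h0' ht0.
have gt := gH _ _ tt' t't; have gt0 := gH _ _ h0 h0'.
have e := eqK_trans FR (GQX FR 8 gt0) U0 (eqK_trans FR (GQX FR 8 gt) (eqKX FR 8 gt0 gt T)
  (eqK_sym FR (GQX FR 16 gJ) (GQX FR 8 gt) U)).
have iX : inverse_mx (iota (comp 0 t) ^+ 16) (iota (comp 0 t') ^+ 16).
  have [i i'] : inverse_mx (iota (comp 0 t)) (iota (comp 0 t')).
    by apply: (iota_form_inverse ns); split; rewrite -scalar_mxM ?h0 ?h0'.
  have cm : GRing.comm (iota (comp 0 t)) (iota (comp 0 t')) by exact: (etrans i (esym i')).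
  split; first by rewrite -[LHS]/(_ * _) -exprMn_comm // [_ * _]i expr1n.
  by rewrite -[LHS]/(_ * _) -exprMn_comm ?[_ * _]i' ?expr1n //; exact: commr_sym.
have sX (x : A) k' : (x ^+ k')%:M = (x%:M : 'M_1) ^+ k'.
  by elim: k' => [|k' IH]; rewrite ?expr0 // !exprS -IH scalar_mxM.
move: e; rewrite /eqK (gqinv_eq FR (GQX FR 16 gJ0) iX).
have eX x k' : iota (x ^+ k') = iota x ^+ k' by rewrite sX; exact: (iota_formX ns).
have -> : iota (comp 0 t' ^+ 16 * t ^+ 16) = iota (comp 0 t') ^+ 16 *m iota t ^+ 16.
  rewrite scalar_mxM -(eX t) -(eX (comp 0 t')).
  exact: (iota_formM ns).
exact.
Qed.
End ScalarIsometries.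

Section UnipotentDegreeZero.
Variables (R : pzRingType) (bar : R -> R) (lam : R) (L : R -> Prop) (G : nat -> R -> Prop).
Hypothesis GF : is_graded_form_ring bar lam L G.
Let FR : is_form_ring bar lam L := gform_form GF.
Local Notation GQ := (GQ bar lam L).
Local Notation eqK := (eqK bar lam L).

Lemma iota_form_flatten N (p p' E x : 'M[R]_N) :
  EQ_stable (@starmx R bar N N) (lam%:M : 'M_N) (@Lambda_hermitian R bar lam L N)
    (iota_form (p%:M : 'M_1) p'%:M E%:M x%:M) ->
  EQ_stable bar lam L (iota_form p p' E x).
Proof.
have sD (a b : 'M[R]_N) : a%:M + b%:M = (a + b)%:M :> 'M_1 by rewrite raddfD.
have sB (a b : 'M[R]_N) : a%:M - b%:M = (a - b)%:M :> 'M_1 by rewrite raddfB.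
rewrite iota_formE !(sD, sB, =^~ scalar_mxM) => h.
rewrite iota_formE; exact: (flatten_EQst FR h).
Qed.

Lemma unipotent_degree_zero n (s : 'M_(n + n)) (c : R) k m : (forall x, c * x = x * c) ->
  k%:R * c = 1 -> GQ s -> (s - 1%:M) ^+ m = 0 -> EQ bar lam L (s ^+ k) ->
  eqK (deg0 GF s ^+ 16) (s ^+ 16).
Proof.
move=> cc kc gs sm sk.
pose B := 'M[R]_(n + n); pose s0 : B := deg0 GF s.
have gs0 : GQ s0 by exact: deg0_GQ.
have is_ := gqinvP FR gs; set s' := gqinv bar lam s in is_.
have is0 := deg0_inverse GF is_; set s0' : B := deg0 GF s' in is0.
pose f : B := hyp R n; pose p : B := psi lam n; pose p' : B := psi_inv bar lam n.
have ip : inverse_mx p p' := psi_inverse FR n.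
pose E : B := p' *m f.
have pE : p *m E = f by rewrite /E mulmxA ip.1 mul1mx.
have f_polar : f + lam%:M *m starmx bar f = p by rewrite mul_scalar_mx /p (psiE FR).
have cM (X : B) : X * c%:M = c%:M * X.
  by rewrite -[RHS]/(c%:M *m X) -[LHS]/(X *m c%:M) mul_scalar_mx -scalemx1 (mulmxZr _ _ cc) mulmx1.
have kcM : k%:R * (c%:M : B) = 1 by rewrite -[k%:R]raddfMn -[LHS]/(_ *m _) -scalar_mxM kc.
have s0m : (s0 - 1) ^+ m = 0 :> B.
  have := congr1 (fun X : B => deg0 GF X) sm; rewrite deg0X deg0D deg0N deg0_1 deg0_0; exact.
have ns : nonsingular bar lam f p p' E.
  by split=> //; rewrite /polar /p (psiE FR).
have h := unipotent_graded (matrix_form_ring FR (n + n)) f_polar ip.1 ip.2 pE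
  (mx_grading (gform_graded GF) (n + n)) is_.1 is_.2 kcM cM ((iffLR (GQP FR s)) gs).2
  ((iffLR (GQP FR s0)) gs0).2 sm s0m.
have iX k' : inverse_mx (s ^+ k') (s' ^+ k').
  have cm : GRing.comm (s : B) s' by exact: (etrans is_.1 (esym is_.2)).
  split; first by rewrite -[LHS]/((_ : B) * _) -exprMn_comm // [_ * _]is_.1 expr1n.
  by rewrite -[LHS]/((_ : B) * _) -exprMn_comm ?[_ * _]is_.2 ?expr1n //; exact: commr_sym.
have {h} /iota_form_flatten := h (fun i D cD => gr_eval_elementary (matrix_form_ring FR _)
  (mx_grading (gform_graded GF) _) cD (EQ_elementary FR sk) (iX k)).
(* [x] is the product of the inverse of [s0 ^+ 16] with [s ^+ 16]. Its iota matrix is now over [R],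
   where the form is the standard [hyp]; by [iota_form_hyp] its class is that of [x]. *)
set x := (X in iota_form _ _ _ X) => hx.
have is0X : inverse_mx (s0 ^+ 16) (s0' ^+ 16).
  have <- : deg0 GF (s ^+ 16) = s0 ^+ 16 by exact: (deg0X GF s 16).
  have <- : deg0 GF (s' ^+ 16) = s0' ^+ 16 by exact: (deg0X GF s' 16).
  exact: (deg0_inverse GF (iX 16%N)).
have gs0X := GQX FR 16 gs0; have gsX := GQX FR 16 gs.
have gx : GQ x := GQM FR (GQV FR gs0X is0X) gsX.
have gh : GQ (iota_form p p' E x).
  have [ix fx] := iffLR (GQ_isometry FR x) gx; have [x' ix'] := ix.
  exact: (iota_form_GQ FR ns ix' fx).
rewrite eqKE (gqinv_eq FR gs0X is0X); apply/(EQst_stab FR n).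
have gsx := stab_GQ FR n gx.
apply/(eqK1 FR gsx); apply: (eqK_trans FR gh); first exact/(eqK1 FR gh).
exact: (iota_form_hyp FR ns gx).
Qed.
End UnipotentDegreeZero.

Section StableNilpotent.
Variable R : pzRingType.

Definition pad n m (X : 'M[R]_(n + n)) : 'M[R]_((n + m) + (n + m)) :=
  block_mx (block_mx (ulsubmx X) 0 0 0) (block_mx (ursubmx X) 0 0 0)
           (block_mx (dlsubmx X) 0 0 0) (block_mx (drsubmx X) 0 0 0).

Lemma padM n m (X Y : 'M[R]_(n + n)) : pad m (X *m Y) = pad m X *m pad m Y.
Proof.
rewrite -{1}[X]submxK -{1}[Y]submxK mulmx_block /pad block_mxKul block_mxKur block_mxKdl block_mxKdr.
by do 3!blk.
Qed.

Lemma stab_pad n m (X : 'M[R]_(n + n)) : stab m (1%:M + X) = 1%:M + pad m X.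
Proof.
rewrite -{1}[X]submxK [in LHS](scalar_mx_block n n) add_block_mx stab_block /pad.
rewrite (scalar_mx_block (n + m) (n + m)) add_block_mx !add0r.
by rewrite [1%:M in RHS](scalar_mx_block n m) !add_block_mx !addr0.
Qed.

(** The exponent must be positive: padding is multiplicative but does not preserve 1, and for
    [n = 0] even [X ^+ 0] vanishes. *)
Lemma padX n m (X : 'M[R]_(n + n)) k : X ^+ k.+1 = 0 -> pad m X ^+ k.+1 = 0.
Proof.
have h j : pad m X ^+ j.+1 = pad m (X ^+ j.+1).
  elim: j => [|j IH]; first by rewrite !expr1.
  by rewrite exprS IH; symmetry; rewrite exprS; exact: padM.
by rewrite h => ->; rewrite /pad /ulsubmx /ursubmx /dlsubmx /drsubmx !linear0 !block_mx0.
Qed.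
End StableNilpotent.

Section CoprimeClasses.
Variables (R : pzRingType) (bar : R -> R) (lam : R) (L : R -> Prop).
Hypothesis FR : is_form_ring bar lam L.
Local Notation GQ := (GQ bar lam L).
Local Notation eqK := (eqK bar lam L).

(** With a Bezout relation [a i = b k + 1], raising to the power [a i] is the identity on classes
    killed by [k]. *)
Lemma eqK_coprime n (s t : 'M_(n + n)) i k : (0 < i)%N -> coprime i k ->
  GQ s -> GQ t -> EQ bar lam L (s ^+ k) -> EQ bar lam L (t ^+ k) ->
  eqK (s ^+ i) (t ^+ i) -> eqK s t.
Proof.
move=> i0 ik gs gt sk tk h.
case: (egcdnP k i0) => a b e _; move: e; rewrite (eqP ik) => e.
have X (x : 'M_(n + n)) : GQ x -> EQ bar lam L (x ^+ k) -> eqK ((x ^+ i) ^+ a) x.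
  move=> gx xk; rewrite -exprM mulnC e addn1 exprSr mulnC exprM.
  apply: (eqK_EQl FR _ gx); elim: b {e} => [|b IH]; first exact: gen_one.
  by rewrite exprS; exact: gen_mul.
have gsi := GQX FR a (GQX FR i gs); have gti := GQX FR a (GQX FR i gt).
apply: (eqK_trans FR gsi (eqK_sym FR gsi gs (X _ gs sk))).
apply: (eqK_trans FR gti _ (X _ gt tk)).
exact: (eqKX FR a (GQX FR i gs) (GQX FR i gt) h).
Qed.
End CoprimeClasses.

Theorem theorem1p2 (R : pzRingType) (bar : R -> R) (lam : R) (L : R -> Prop)
    (G : nat -> R -> Prop) (k n r : nat)
    (N : 'M[R]_(n + n)) (Ncomp : nat -> 'M[R]_(n + n)) :
  is_graded_form_ring bar lam L G ->
  (0 < k)%N ->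
  (exists u : R, [/\ G 0%N u, k%:R * u = 1 & u * k%:R = 1]) ->
  N = \sum_(0 <= i < r.+1) Ncomp i ->
  (forall i, (i <= r)%N -> forall p q, G i (Ncomp i p q)) ->
  (exists m : nat, N ^+ m = 0) ->
  GQ bar lam L (1%:M + N) ->
  K1GQ_eq bar lam L ((1%:M + N) ^+ k) 1%:M ->
  K1GQ_eq bar lam L (1%:M + N) (1%:M + Ncomp 0%N).
Proof.
move=> GF k0 [u [_ ku uk]] EN hom [d Nd] gs [gsk _ [e ee e1]].
have FR := gform_form GF.
pose s := 1%:M + N; rewrite -/s in gs gsk e1 *.
have es : deg0 GF s = 1%:M + Ncomp 0%N.
  by rewrite /s deg0D deg0_1 EN (deg0_sum GF hom).
have gs0 : GQ bar lam L (1%:M + Ncomp 0%N) by rewrite -es; exact: deg0_GQ.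
split=> //; exists (gqinv bar lam s *m (1%:M + Ncomp 0%N)); last first.
  by rewrite mulmxA (gqinvP FR gs).1 mul1mx.
have uC x : u * x = x * u.
  by rewrite -[RHS]mul1r -uk -mulrA [k%:R * _]mulrA mulr_natl -mulr_natr -!mulrA ku mulr1.
have [m skm] : EQ_stable bar lam L (s ^+ k).
  have i := gqinvP FR gsk.
  have ie : e = gqinv bar lam (s ^+ k).
    by rewrite -[RHS]mulmx1 e1 mulmxA i.2 mul1mx.
  by apply: (EQstV ee); rewrite ie; exact: inverse_mxC.
(* After stabilizing, [t ^+ k] is elementary and not merely stably so; evaluation applies to an
   actual product of elementary matrices of the size of [t]. *)
pose t := stab m s; have gt : GQ bar lam L t by exact: stab_GQ.
have tE : t = 1%:M + pad m N by rewrite /t stab_pad.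
have td : pad m N ^+ d.+1 = 0 by apply: padX; rewrite exprS Nd mulr0.
have tk : EQ bar lam L (t ^+ k) by rewrite -(stab_expr m s k).
suff h : eqK bar lam L (deg0 GF t) t.
  apply: (eqK_sym FR gs0 gs); rewrite -es; rewrite deg0_stab in h.
  by apply: (iffLR (eqK_stab FR m _ _)) h; rewrite es.
have t0k : EQ bar lam L (deg0 GF t ^+ k) by rewrite -deg0X; exact: deg0_EQ.
have gt0 : GQ bar lam L (deg0 GF t) by exact: deg0_GQ.
have [ok|ek] := boolP (odd k).
  apply: (eqK_coprime FR (i := 16) (k := k) isT _ gt0 gt t0k tk).
    by rewrite (@coprimeXl 4 2) // coprime2n.
  apply: (unipotent_degree_zero GF uC ku gt (m := d.+1) _ tk).
  by rewrite tE addrC addKr.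
(* As [u] is the inverse of the even number [k], this is one half, so [h ^+ 4] is the inverse of 16
   required by [GQ_root]. *)
pose h := (k./2)%:R * u.
have hC x : h * x = x * h by rewrite /h mulrA -mulrA uC mulrA mulr_natl -mulr_natr -mulrA.
have h2 : 2%:R * h = 1.
  have ke : (k./2.*2)%N = k by rewrite -[RHS]odd_double_half (negbTE ek).
  by rewrite /h mulrA -natrM mul2n ke.
have hXC j x : h ^+ j * x = x * h ^+ j by exact: (commr_sym (commrX j (commr_sym (hC x)))).
have h16 : 16%:R * h ^+ 4 = 1.
  by rewrite (natrX _ 2 4) -exprMn_comm ?h2 ?expr1n //; exact: commr_sym (commr_nat _ _).
have gN : GQ bar lam L (1%:M + pad m N) by rewrite -tE.
(* The comparison of 16-th powers is applied to the root [x], with exponent [16 * k] since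
   [x ^+ (16 * k)] is [t ^+ k]. The 16-th powers of [x] and of its degree zero part are [t] and the
   degree zero part of [t], so the factor 16 disappears. *)
have [x [gx x16 xd]] := GQ_root FR hC h2 (hXC 4) h16 td gN.
rewrite -tE in x16; rewrite -x16 deg0X.
apply: (unipotent_degree_zero GF (c := h ^+ 4 * u) (k := 16 * k) _ _ gx xd).
- by move=> y; rewrite -mulrA uC mulrA hXC mulrA.
- by rewrite natrM mulrA -[_ * _ * h ^+ 4]mulrA -hXC mulrA h16 mul1r.
by rewrite exprM x16.
Qed.
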